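(* The following hold. (i) (strong law of large numbers) For $1\le p<2$, $(Z(t))^{t^{-1/p}}\longrightarrow1$ almost surely as $t\to\infty$. (ii) (weak convergence) As $n\to\infty$, $Y_n\Longrightarrow z\mathfrak B$, where $\mathfrak B(t):=e^{iB(t)}$ is the circular Brownian motion on the unit circle $\mathbb S$ and $B=\{B(t),t\ge0\}$ is a standard Brownian motion.
   Context: Fix $\lambda,c>0$. $\{N(t)\}$ is a homogeneous Poisson process of rate $\lambda$, $V(0)$ is independent of $N$ and uniform on $\{-c,c\}$, $V(t)=V(0)(-1)^{N(t)}$, and $X(t)=\int_0^tV(s)\,ds$ is the telegraph process. $\mathbb S=\{z\in\mathbb C:|z|=1\}$. The circular telegraph process is $Z(t)=Z(0)e^{iX(t)}$ with $Z(0)=e^{i\theta}\in\mathbb S$ deterministic ($\theta$ a fixed real number); for real $a$, $(Z(t))^a$ means $e^{ia(\theta+X(t))}$. For $z\in\mathbb S$ and $n\in\mathbb N$ set $\sigma_n:=\frac1c\sqrt{\frac{\lambda}{n}}$ and $Y_n(t):=(Z(nt))^{\sigma_n}=z\,e^{i\sigma_nX(nt)}$, $t\in[0,1]$ (with $Z(0)=z^{1/\sigma_n}$). $\Longrightarrow$ denotes weak convergence in $C([0,1],\mathbb S)$, the space of continuous $\mathbb S$-valued functions on $[0,1]$ with the sup-norm topology. *)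

(* Defs.v *)
(* MathComp-Analysis, with R[i] from mathcomp-real-closed. *)
From HB Require Import structures.
From mathcomp Require Import all_boot all_order all_algebra finmap.
From mathcomp Require Import complex.
From mathcomp Require Import all_classical all_reals all_analysis.

Set Implicit Arguments.
Unset Strict Implicit.
Unset Printing Implicit Defensive.

Import Order.TTheory GRing.Theory Num.Theory.
Import numFieldNormedType.Exports.

Local Open Scope classical_set_scope.
Local Open Scope ring_scope.

Definition mutually_independent d (T : measurableType d) (R : realType)
    (P : probability T R) (I : choiceType) d' (T' : measurableType d')
    (X : I -> T -> T') : Prop :=
  forall (J : {fset I}) (A : I -> set T'), (forall i, measurable (A i)) ->
    P (\bigcap_(i in [set` J]) (X i @^-1` A i)) =
    (\prod_(i <- J) P (X i @^-1` A i))%E.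

(* Processes are indexed by R; their values at times t < 0 are ignored. *)
Definition process_sigma d (T : measurableType d) (R : realType)
    d' (T' : measurableType d') (X : R -> T -> T') : set (set T) :=
  <<s \bigcup_(t in `[0, +oo[) preimage_set_system setT (X t) measurable >>.

Definition independent_of_process d (T : measurableType d) (R : realType)
    (P : probability T R) d1 (T1 : measurableType d1)
    d2 (T2 : measurableType d2) (U : T -> T1) (X : R -> T -> T2) : Prop :=
  forall (A : set T1) (E : set T), measurable A -> process_sigma X E ->
    P (U @^-1` A `&` E) = (P (U @^-1` A) * P E)%E.

Record poisson_process d (T : measurableType d) (R : realType)
    (P : probability T R) (lambda : R) (N : R -> T -> nat) : Prop := {
  poisson_process_meas : forall t, 0 <= t -> measurable_fun setT (N t);
  poisson_process0 : forall w, N 0 w = 0%N;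
  poisson_process_nd : forall w s t, 0 <= s -> s <= t -> (N s w <= N t w)%N;
  poisson_process_rc : forall w t, 0 <= t -> N s w @[s --> t^'+] --> N t w;
  poisson_process_indep : forall t : nat -> R, 0 <= t 0%N ->
    (forall k, t k <= t k.+1) ->
    mutually_independent P (fun k w => (N (t k.+1) w - N (t k) w)%N);
  poisson_process_law : forall s t k, 0 <= s -> s < t ->
    P [set w | (N t w - N s w)%N = k] =
    (poisson_pmf (lambda * (t - s)) k)%:E }.

(* The second parameter of normal_prob is the standard deviation. *)
Record brownian_motion d (T : measurableType d) (R : realType)
    (P : probability T R) (B : R -> T -> R) : Prop := {
  brownian_motion_meas : forall t, 0 <= t -> measurable_fun setT (B t);
  brownian_motion0 : forall w, B 0 w = 0;
  brownian_motion_continuous : forall w,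
    {within `[0, +oo[, continuous (B ^~ w)};
  brownian_motion_indep : forall t : nat -> R, 0 <= t 0%N ->
    (forall k, t k <= t k.+1) ->
    mutually_independent P (fun k w => B (t k.+1) w - B (t k) w);
  brownian_motion_law : forall s t (A : set R), 0 <= s -> s < t ->
    measurable A ->
    P ((fun w => B t w - B s w) @^-1` A) =
    normal_prob 0 (Num.sqrt (t - s)) A }.

Definition uniform_pm d (T : measurableType d) (R : realType)
    (P : probability T R) (c : R) (V0 : T -> R) : Prop :=
  P [set w | V0 w = c] = (2^-1)%:E /\ P [set w | V0 w = - c] = (2^-1)%:E.

Definition velocity (T : Type) (R : realType)
    (N : R -> T -> nat) (V0 : T -> R) (t : R) (w : T) : R :=
  V0 w * (-1) ^+ N t w.

Definition telegraph (T : Type) (R : realType)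
    (N : R -> T -> nat) (V0 : T -> R) (t : R) (w : T) : R :=
  \int[lebesgue_measure]_(s in `[0, t]) velocity N V0 s w.

(* R[i] has no topology of its own; the regular algebra R[i]^o carries the
   one of the modulus. *)
Definition circle (R : realType) : set R[i]^o := [set z | `|z| = 1].
Arguments circle R : clear implicits.

Definition expi (R : realType) (x : R) : R[i]^o := Complex (cos x) (sin x).

(* (Z t)^a, where Z t = e^(i (theta + X t)). *)
Definition circular_telegraph_pow (T : Type) (R : realType)
    (N : R -> T -> nat) (V0 : T -> R) (theta a t : R) (w : T) : R[i]^o :=
  expi (a * (theta + telegraph N V0 t w)).

Definition I01 (R : realType) : set R := `[0, 1]%classic.
Arguments I01 R : clear implicits.

(* ArrowAsUniformType puts the topology of uniform convergence on the type of
   continuous functions between the subspaces [0, 1] and circle R. *)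
Section space.
Import ArrowAsUniformType.
Definition C01S (R : realType) : uniformType :=
  continuousType (I01 R) (circle R).
End space.

Definition C01S_val (R : realType) (f : C01S R) (t : I01 R) : R[i]^o :=
  \val ((f : continuousType (I01 R) (circle R)) t).
Arguments C01S_val {R} f t.

Lemma C01S_nbhsP (R : realType) (f : C01S R) (U : set (C01S R)) :
  nbhs f U <-> exists2 e : R, 0 < e & forall g : C01S R,
    (forall t, `|C01S_val f t - C01S_val g t| < e%:C%C) -> U g.
Proof.
rewrite -nbhs_entourageE; split.
  move=> [E [E1 [E2 [E3 entE3 E32] E21] E1E] EU].
  move: entE3; rewrite -entourage_ballE => -[[a b]] /=.
  rewrite ltcE /= => /andP[/eqP -> a0] ballE3.
  exists a => // g fg; apply/EU/xsectionP/E1E/E21 => /= t.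
  exact/E32/ballE3/fg.
move=> [e e0 eU].
exists [set fg | forall t, `|C01S_val fg.1 t - C01S_val fg.2 t| < e%:C%C];
    last by move=> g /xsectionP; exact: eU.
exists [set fg | forall t, `|\val (fg.1 t) - \val (fg.2 t)| < e%:C%C] => //.
exists [set xy | `|\val xy.1 - \val xy.2| < e%:C%C] => //.
exists [set xy | `|xy.1 - xy.2| < e%:C%C] => //.
by rewrite -entourage_ballE; exists (e%:C%C) => //=; rewrite ltcR.
Qed.

Section circle_path.
Variable R : realType.

Lemma normC_complex (x y : R) :
  `|Complex x y| = (Num.sqrt (x ^+ 2 + y ^+ 2))%:C%C.
Proof. exact: normc_def. Qed.

Lemma expi_circle (z : circle R) (x : R) : \val z * expi x \in circle R.
Proof.
rewrite inE /circle /= normrM.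
have := set_valP z; rewrite /circle /= => ->; rewrite mul1r.
by rewrite /expi normC_complex cos2Dsin2 sqrtr1.
Qed.

Lemma expiD (x y : R) : expi (x + y) = expi x * expi y.
Proof.
rewrite /expi cosD sinD; apply/eqP; rewrite eq_complex /= eqxx /=.
by rewrite addrC.
Qed.

Definition circle_rot (z : circle R) (x : R) : circle R :=
  exist _ (\val z * expi x) (expi_circle z x).

Lemma expi_continuous : continuous (@expi R).
Proof.
move=> x; apply/cvgrPdist_lt => e e0.
have [er er0 <-] : exists2 r : R, 0 < r & r%:C%C = e.
  case: e e0 => a b; rewrite ltcE /= => /andP[/eqP -> a0].
  by exists a.
have er2 : 0 < er / 2 by exact: divr_gt0.
near=> t.
rewrite /expi /GRing.add /= /GRing.opp /= normC_complex ltcR.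
apply: (@le_lt_trans _ _ (`|cos x - cos t| + `|sin x - sin t|)).
  set a := cos x - cos t; set b := sin x - sin t.
  have -> : `|a| + `|b| = Num.sqrt ((`|a| + `|b|) ^+ 2).
    by rewrite sqrtr_sqr [RHS]ger0_norm// addr_ge0.
  apply: ler_wsqrtr; rewrite [leRHS]sqrrD -(real_normK (num_real a)).
  rewrite -(real_normK (num_real b)) lerD2r lerDl.
  by rewrite mulrn_wge0// mulr_ge0.
rewrite [er]splitr ltrD//.
  near: t; move: (@continuous_cos R x) => /cvgrPdist_lt; exact.
near: t; move: (@continuous_sin R x) => /cvgrPdist_lt; exact.
Unshelve. all: by end_near. Qed.

Lemma circle_rot_continuous (z : circle R) : continuous (circle_rot z).
Proof.
have h : continuous ((set_val : circle R -> R[i]^o) \o circle_rot z).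
  move=> x; rewrite /comp /circle_rot/=.
  apply: (continuous_comp (f := @expi R)); first exact: expi_continuous.
  exact: mulrl_continuous.
exact/continuous_comp_initial.
Qed.

Lemma circle_path_continuous (z : circle R) (x : I01 R -> R) :
  continuous x -> continuous (fun t => circle_rot z (x t)).
Proof.
move=> cx t; apply: continuous_comp; first exact: cx.
exact: circle_rot_continuous.
Qed.

Definition circle_path (z : circle R) (x : I01 R -> R) (hx : continuous x) :
  C01S R := mkcts (circle_path_continuous (z := z) hx).

End circle_path.

Section circular_processes.
Context d (T : measurableType d) (R : realType) (P : probability T R).

Lemma velocity_integrable (lambda : R) (N : R -> T -> nat)
    (hN : poisson_process P lambda N) (V0 : T -> R) (w : T) (b : R) :
  lebesgue_measure.-integrable `[0, b]
    (EFin \o (velocity N V0 ^~ w : measurableTypeR R -> R)).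
Proof.
apply: measurable_bounded_integrable => //=.
- by rewrite lebesgue_measure_itv/=; case: ifPn => // _; rewrite -EFinB ltry.
- apply: measurable_realfun.measurable_funM => //.
  apply: (measurableT_comp (f := fun k : nat => (-1) ^+ k : R)) => //.
  move=> _ Y _.
  rewrite (_ : _ `&` _ =
      \bigcup_(k in Y) (`[0, b] `&` [set t | N t w = k])); last first.
    apply/seteqP; split => [t [tb Yt]|t [k Yk [tb /= Nk]]].
      by exists (N t w).
    by split => //=; rewrite Nk.
  apply: bigcup_measurable => k _.
  apply: measurable_realfun.is_interval_measurable.
  move=> s t [/= sb Ns] [/= tb Nt] r /andP[sr rt].
  move: sb tb; rewrite !in_itv/= => /andP[s0 _] /andP[_ tb].
  have r0 := le_trans s0 sr.
  split => /=; first by rewrite ?in_itv/= r0 (le_trans rt tb).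
  apply/eqP; rewrite eqn_leq -{1}Nt -Ns.
  by rewrite !(poisson_process_nd hN).
- exists `|V0 w|; split; rewrite ?num_real// => x Mx t _ /=.
  by rewrite /velocity normrM normrX normrN1 expr1n mulr1 ltW.
Qed.

Lemma telegraph_continuous (lambda : R) (N : R -> T -> nat)
    (hN : poisson_process P lambda N) (V0 : T -> R) (w : T) (b : R) : 0 <= b ->
  {within `[0, b], continuous (telegraph N V0 ^~ w)}.
Proof.
move=> b0.
exact: (parameterized_integral_continuous b0 (velocity_integrable hN V0 w b)).
Qed.
Arguments telegraph_continuous {lambda N} hN V0 w {b} b0.

Definition sigma_ (lambda c : R) (n : nat) : R :=
  c^-1 * Num.sqrt (lambda / n%:R).

Lemma scaled_telegraph_continuous (lambda : R) (N : R -> T -> nat)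
    (hN : poisson_process P lambda N) (V0 : T -> R) (a : R) (n : nat) (w : T) :
  continuous (fun t : I01 R => a * telegraph N V0 (n%:R * \val t) w).
Proof.
have n0 : 0 <= n%:R :> R by [].
have gP (t : I01 R) : n%:R * \val t \in `[0, n%:R : R]%classic.
  have := set_valP t; rewrite /I01 /= inE /= !in_itv/= => /andP[t0 t1].
  by rewrite mulr_ge0//= ler_piMr.
pose g (t : I01 R) : `[0, n%:R : R]%classic :=
  exist (fun x : R => x \in `[0, n%:R]%classic) _ (gP t).
have cg : continuous g.
  apply: continuous_comp_initial => t.
  apply: (continuous_comp (f := set_val : I01 R -> R)
    (g := fun x : R => n%:R * x)); last exact: mulrl_continuous.
  exact: (@initial_continuous (I01 R) R set_val t).
have /subspace_sigL_continuousP cX := telegraph_continuous hN V0 w n0.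
move=> t; apply: (continuous_comp (f := fun t : I01 R => telegraph N V0 _ w)).
  exact: (continuous_comp (cg t) (cX (g t))).
exact: mulrl_continuous.
Qed.
Arguments scaled_telegraph_continuous {lambda N} hN V0 a n w.

Definition rescaled_circular_telegraph (lambda : R) (N : R -> T -> nat)
    (hN : poisson_process P lambda N) (V0 : T -> R) (c : R) (z : circle R)
    (n : nat) (w : T) : C01S R :=
  circle_path z
    (scaled_telegraph_continuous hN V0 (sigma_ lambda c n) n w).

Lemma rescaled_circular_telegraphE (lambda : R) (N : R -> T -> nat)
    (hN : poisson_process P lambda N) (V0 : T -> R) (c : R) (z : circle R)
    (n : nat) (w : T) (t : I01 R) (phi : R) :
  0 < lambda -> 0 < c -> (0 < n)%N -> expi phi = \val z ->
  C01S_val (rescaled_circular_telegraph hN V0 c z n w) t =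
  circular_telegraph_pow N V0 (phi / sigma_ lambda c n) (sigma_ lambda c n)
    (n%:R * \val t) w.
Proof.
move=> lambda0 c0 n0 phiz.
have s0 : sigma_ lambda c n != 0.
  by rewrite gt_eqF// mulr_gt0// ?invr_gt0// sqrtr_gt0 divr_gt0// ltr0n.
by rewrite /circular_telegraph_pow mulrDr mulrCA divff// mulr1 expiD phiz.
Qed.

Lemma brownian_motion_continuous01 (B : R -> T -> R)
    (hB : brownian_motion P B) (w : T) :
  continuous (fun t : I01 R => B (\val t) w).
Proof.
have sub : I01 R `<=` `[0, +oo[.
  by move=> t; rewrite /I01 /= !in_itv/= andbT => /andP[].
have cB : {within I01 R, continuous (B ^~ w)}.
  apply: (continuous_subspaceW sub).
  exact: (brownian_motion_continuous hB).
exact: (subspace_sigL_continuousP (I01 R) (B ^~ w)).1 cB.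
Qed.
Arguments brownian_motion_continuous01 {B} hB w.

Definition circular_brownian (B : R -> T -> R) (hB : brownian_motion P B)
    (z : circle R) (w : T) : C01S R :=
  circle_path z (brownian_motion_continuous01 hB w).

End circular_processes.

Definition borel_measurable d (T : measurableType d) (S : topologicalType)
    (Y : T -> S) : Prop :=
  forall A : set S, <<s @open S >> A -> measurable (Y @^-1` A).

Definition weak_cvg d (T : measurableType d) (R : realType)
    (S : topologicalType) (P : probability T R) (Y : nat -> T -> S)
    d' (T' : measurableType d') (P' : probability T' R) (Y' : T' -> S) : Prop :=
  [/\ forall n, borel_measurable (Y n), borel_measurable Y' &
      forall f : S -> R, continuous f -> (exists M, forall x, `|f x| <= M) ->
        ('E_P[f \o Y n] @[n --> \oo] --> 'E_P'[f \o Y'])%E].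

(* Main.v *)
(* Sampled on a grid of mesh delta, the velocity is a product of independent signs,
   so X is a limit of positions of a persistent random walk.  The powers of the
   transition operator of that walk act explicitly on polynomials of degree at
   most four; this gives E (X t - X s)^4 <= C (t - s)^2 and, exchanging the blocks
   of the walk one by one for Gaussian increments (Lindeberg), the convergence of
   the finite-dimensional laws of sigma_n X (n t) to those of B.

   The fourth moments of the dyadic increments also control, uniformly in n, the
   distance of a path to its dyadic interpolation, so expectations of bounded
   Lipschitz functionals converge; Lipschitz envelopes give all bounded continuous
   functionals.

   For the strong law, the same chaining on [0, 4^k] gives
   sup |X| <= 2^k G_k + |V0| with E G_k bounded in k.  As 2 * 4^(-1/p) < 1 for
   p < 2, the series sum_k (2 * 4^(-1/p))^k G_(k+1) has finite expectation, so its
   terms tend to 0 almost surely, whence X t / t^(1/p) does. *)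
Require Import Defs.
From mathcomp Require Import all_boot all_order all_algebra.
From mathcomp Require Import complex finmap.
From mathcomp Require Import ring lra.
From mathcomp Require Import all_classical all_reals all_analysis.
Import measurable_realfun.

Import Order.TTheory GRing.Theory Num.Theory.
Import numFieldNormedType.Exports.

Set Implicit Arguments.
Unset Strict Implicit.
Unset Printing Implicit Defensive.

Local Open Scope classical_set_scope.
Local Open Scope ring_scope.

(** * Expectations of bounded variables *)

Section bounded_rv.
Context d (T : measurableType d) (R : realType) (P : probability T R).

(** The independence hypotheses only factor probabilities of rectangles, and no joint law is ever
    formed: conditioning means integrating one coordinate out of a bounded, sequentially continuous
    functional of finitely many coordinates. Boundedness is why fourth moments appear truncated by
    [Num.min _ B], with bounds uniform in [B]. Increments of [X] over disjoint intervals are not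
    independent, because the velocity persists. The exchange works since the past acts on a block
    only through its initial velocity, which is almost surely [c] or [- c], and the comparison with
    a Gaussian increment is uniform over these two values and over test functions of given Lipschitz
    constant and bound. Degree four is what chaining requires: the [2 ^ i] increments of level [i]
    have fourth moments of order [4 ^ - i], so their sum decays with [i], whereas the sum of the
    second moments would not. Interpolation errors are controlled in expectation, uniformly in [n],
    and this takes the place of tightness. The convolution property of normal laws is read off the
    given Brownian motion. *)

Lemma bounded_integrable (X : T -> R) (M : R) :
  measurable_fun setT X -> (forall w, `|X w| <= M) ->
  P.-integrable setT (EFin \o X).
Proof.
move=> mX XM; apply: measurable_bounded_integrable => //.
  by apply: (le_lt_trans (probability_le1 P measurableT)); rewrite ltry.
by exists M; split; [exact: num_real|move=> x Mx w _; exact: le_trans (XM w) (ltW Mx)].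
Qed.

Lemma le_expect (X Y : T -> R) :
  P.-integrable setT (EFin \o X) -> P.-integrable setT (EFin \o Y) ->
  (forall w, X w <= Y w) -> \int[P]_w X w <= \int[P]_w Y w.
Proof. by move=> iX iY XY; apply: le_Rintegral. Qed.

Lemma expect_cst (a : R) : \int[P]_w a = a.
Proof. by rewrite Rintegral_cst//= probability_setT/= mulr1. Qed.

Lemma expect_bounded (X : T -> R) (M : R) :
  measurable_fun setT X -> (forall w, `|X w| <= M) -> `|\int[P]_w X w| <= M.
Proof.
move=> mX XM; have iX := bounded_integrable mX XM.
apply: le_trans (le_normr_Rintegral _ iX) _ => //.
rewrite -[leRHS]expect_cst; apply: le_expect => //.
- exact: integrable_norm.
- by apply: (@bounded_integrable _ `|M|).
Qed.

Lemma expect_dist (X Y : T -> R) (e : R) :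
  P.-integrable setT (EFin \o X) -> P.-integrable setT (EFin \o Y) ->
  (forall w, `|X w - Y w| <= e) -> `|\int[P]_w X w - \int[P]_w Y w| <= e.
Proof.
move=> iX iY XYe; rewrite -RintegralB//; apply: expect_bounded => //.
by apply: measurable_funB; apply/measurable_EFinP;
  [exact: measurable_int iX|exact: measurable_int iY].
Qed.

Lemma bounded_cvg_expect (X_ : nat -> T -> R) (X : T -> R) (M : R) :
  (forall n, measurable_fun setT (X_ n)) -> measurable_fun setT X ->
  (forall n w, `|X_ n w| <= M) ->
  (forall w, X_ n w @[n --> \oo] --> X w) ->
  \int[P]_w X_ n w @[n --> \oo] --> \int[P]_w X w.
Proof.
move=> mX_ mX XM cX.
have XM' w : `|X w| <= M.
  by apply: (ler_cvg_to (cvg_norm (cX w)) (cvg_cst M)); apply: nearW => n /=.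
have [|||||[_ _ h]] := @dominated_convergence _ T R P setT measurableT
  (fun n => EFin \o X_ n) (EFin \o X) (EFin \o cst M).
- by move=> n; exact/measurable_EFinP.
- exact/measurable_EFinP.
- by apply: aeW => w _; apply: cvg_EFin; [exact: nearW|exact: cX].
- by apply: (@bounded_integrable (cst M) `|M|).
- by apply: aeW => w n _ /=; rewrite lee_fin.
apply: fine_cvg.
rewrite fineK; first exact: h.
by apply: integrable_fin_num => //; apply: (bounded_integrable mX XM').
Qed.

End bounded_rv.

(** * Variables with finitely many values *)

Section finite_valued.
Context d (T : measurableType d) (R : realType) (P : probability T R).

Lemma measurable_fun_finite (F : finType) (S : T -> F) (h : F -> R) :
  (forall s, measurable (S @^-1` [set s])) ->
  measurable_fun setT (fun w => h (S w)).
Proof.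
move=> mS _ Y _; rewrite setTI.
rewrite (_ : _ @^-1` _ = \bigcup_(s in [set s | Y (h s)]) (S @^-1` [set s])).
  by apply: fin_bigcup_measurable => //; exact: finite_finset.
apply/seteqP; split=> [w /= Yw|w [s /= Ys Ss]]; first by exists (S w).
by rewrite /= Ss.
Qed.

Lemma expect_finite (F : finType) (S : T -> F) (h : F -> R) :
  (forall s, measurable (S @^-1` [set s])) ->
  \int[P]_w h (S w) = \sum_s h s * fine (P (S @^-1` [set s])).
Proof.
move=> mS.
rewrite /Rintegral (eq_integral (fun w => \sum_s (h s)%:E * (\1_(S @^-1` [set s]) w)%:E)%E).
  rewrite integral_sum//; last first.
    move=> s; apply: integrableZl => //; apply: integrable_indic => //.
  rewrite (eq_bigr (fun s => (h s * fine (P (S @^-1` [set s])))%:E)).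
    by rewrite sumEFin.
  move=> s _; rewrite integralZl//; last exact: integrable_indic.
  by rewrite integral_indic// setIT EFinM fineK// fin_num_measure.
move=> w _; rewrite (bigD1 (S w))//= big1 ?adde0.
  by rewrite indicE mem_set// mule1.
move=> s sS; rewrite indicE memNset ?mule0//= => Ss.
by rewrite Ss eqxx in sS.
Qed.

(** Fubini in the case where both sides are finite sums. Conditioning on the past is reduced to this
    case by rounding. *)
Lemma expect_finite_indep (F F' : finType) (S : T -> F) (S' : T -> F')
    (h : F -> F' -> R) :
  (forall s, measurable (S @^-1` [set s])) ->
  (forall s, measurable (S' @^-1` [set s])) ->
  (forall s s', P (S @^-1` [set s] `&` S' @^-1` [set s']) =
    (P (S @^-1` [set s]) * P (S' @^-1` [set s']))%E) ->
  \int[P]_w h (S w) (S' w) = \int[P]_w \int[P]_w' h (S w) (S' w').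
Proof.
move=> mS mS' SS'.
have mSS' : forall s, measurable ((fun w => (S w, S' w)) @^-1` [set s]).
  move=> [s s'].
  rewrite (_ : _ @^-1` _ = S @^-1` [set s] `&` S' @^-1` [set s']).
    exact: measurableI.
  by apply/seteqP; split=> w /= [-> ->].
rewrite (expect_finite (fun s => h s.1 s.2) mSS').
rewrite (expect_finite (fun s => \int[P]_w' h s (S' w')) mS).
under [RHS]eq_bigr do rewrite (expect_finite _ mS') big_distrl/=.
rewrite pair_big/=; apply: eq_bigr => -[s s'] _ /=.
rewrite -mulrA; congr (_ * _).
rewrite (_ : _ @^-1` _ = S @^-1` [set s] `&` S' @^-1` [set s']).
  by rewrite SS' fineM ?fin_num_measure// mulrC.
by apply/seteqP; split=> w /= [-> ->].
Qed.

End finite_valued.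

(** * Rounding of real variables *)

Section discretization.
Context (R : realType).

(** [[- i, i]] holds this many cells of length [1 / (i + 1)]. Rounding is downwards on this grid.
    Points outside go to the ends of [[- i, i]], on the left because [Num.truncn] is 0 on negative
    numbers. *)
Definition disc_size (i : nat) := (i.*2 * i.+1)%N.

Definition disc_idx (i : nat) (x : R) : 'I_(disc_size i).+1 :=
  inord (minn (Num.truncn ((x + i%:R) * i.+1%:R)) (disc_size i)).

Definition disc_val (i : nat) (j : 'I_(disc_size i).+1) : R :=
  j%:R / i.+1%:R - i%:R.

Definition disc (i : nat) (x : R) : R := disc_val (disc_idx i x).

Lemma measurable_disc_idx (i : nat) (j : 'I_(disc_size i).+1) :
  measurable (disc_idx i @^-1` [set j]).
Proof.
pose f (x : R) : R := (minn (Num.truncn ((x + i%:R) * i.+1%:R)) (disc_size i))%:R.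
rewrite (_ : _ @^-1` _ = f @^-1` [set (j : nat)%:R]).
  rewrite -[X in measurable X]setTI; apply: nondecreasing_measurable => //.
  move=> x y xy; rewrite ler_nat leq_min geq_minr andbT.
  apply: leq_trans (geq_minl _ _) _.
  by rewrite le_truncn// ler_wpM2r// lerD2r.
apply/seteqP; split=> x /=; rewrite /disc_idx /f.
  by move=> <-; rewrite inordK// ltnS geq_minr.
move=> /eqP; rewrite eqr_nat => /eqP h; apply: val_inj => /=.
by rewrite inordK// ltnS geq_minr.
Qed.

Lemma disc_cvg (x : R) : disc i x @[i --> \oo] --> x.
Proof.
apply/cvgrPdist_le => e e0; near=> i.
have : `|x| <= i%:R by near: i; exact: nbhs_infty_ger.
rewrite ler_norml => /andP[x1 x2].
have : i.+1%:R^-1 <= e by apply: ltW; near: i; exact: (near_infty_natSinv_lt (PosNum e0)).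
apply: le_trans.
set y := (x + i%:R) * i.+1%:R.
have i0 : (0 : R) < i.+1%:R by [].
have y0 : 0 <= y by rewrite mulr_ge0//; lra.
have yN : y <= (disc_size i)%:R.
  rewrite /y /disc_size natrM ler_wpM2r// -addnn natrD; lra.
have /andP[ty yt] := truncn_itv y0.
have tN : (Num.truncn y <= disc_size i)%N.
  by rewrite -(ler_nat R) (le_trans ty).
rewrite /disc /disc_val /disc_idx inordK ?ltnS ?geq_minr// -/y.
rewrite (minn_idPl tN).
rewrite (_ : x - _ = (y - (Num.truncn y)%:R) / i.+1%:R); last first.
  by rewrite /y; field; rewrite gt_eqF.
rewrite normrM [X in _ * X]ger0_norm ?invr_ge0//.
rewrite ler_piMl ?invr_ge0//.
rewrite -natr1 in yt.
by rewrite ger0_norm; lra.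
Unshelve. all: by end_near. Qed.

End discretization.

(** * Integrating out the last of a sequence of independent variables *)

Section independent_sequences.
Context d (T : measurableType d) (R : realType) (P : probability T R).

(** Each variable is independent of its past, tested on rectangles: the form of independence needed
    to integrate out the last coordinate. *)
Definition independent_seq d' (U : measurableType d') (D : nat -> T -> U) :=
  forall m (A : nat -> set U) (C : set U), (forall k, measurable (A k)) ->
    measurable C ->
  P (\bigcap_(k < m) (D k @^-1` A k) `&` D m @^-1` C) =
  (P (\bigcap_(k < m) (D k @^-1` A k)) * P (D m @^-1` C))%E.

Lemma mutually_independent_seq d' (U : measurableType d') (D : nat -> T -> U) :
  mutually_independent P D -> independent_seq D.
Proof.
move=> iD m A C mA mC.
pose J : {fset nat} := [fset k in iota 0 m]%fset.
have JE k : (k \in J) = (k < m)%N by rewrite !inE/= mem_iota add0n.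
pose A' k := if k == m then C else A k.
have mA' k : measurable (A' k) by rewrite /A'; case: ifP.
have A'E k : (k < m)%N -> A' k = A k by rewrite /A' => km; rewrite ltn_eqF.
have JS (B : nat -> set U) : \bigcap_(i in [set` J]) (D i @^-1` B i) =
    \bigcap_(k < m) (D k @^-1` B k).
  by apply: eq_bigcapl; split=> k /=; rewrite JE.
have [h1 h2] := (iD J A' mA', iD (m |` J)%fset A' mA').
have mJ : m \notin J by rewrite JE ltnn.
move: h2; rewrite big_fsetU1//= -h1 JS.
rewrite (_ : \bigcap_(k < m) _ = \bigcap_(k < m) (D k @^-1` A k)); last first.
  by apply: eq_bigcapr => k /= km; rewrite A'E.
rewrite {2}/A' eqxx muleC => <-; congr (P _).
apply/seteqP; split=> w.
  move=> [Dw Cw] k /=; rewrite in_fset1U => /orP[/eqP->|]; first by rewrite /A' eqxx.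
  by rewrite JE => km; rewrite A'E//; exact: Dw.
move=> Dw; split=> [k /= km|].
  by rewrite -A'E//; apply: (Dw k); rewrite /= in_fset1U JE km orbT.
by have := Dw m; rewrite /= in_fset1U eqxx /A' eqxx; exact.
Qed.

Definition upd (x : nat -> R) (m : nat) (y : R) : nat -> R :=
  fun k => if k == m then y else x k.

(* in particular G only depends on the first m coordinates *)
Definition seq_continuous (m : nat) (G : (nat -> R) -> R) :=
  forall (x_ : nat -> nat -> R) (x : nat -> R),
    (forall k, (k < m)%N -> x_ i k @[i --> \oo] --> x k) ->
    G (x_ i) @[i --> \oo] --> G x.

(** Turns the rounded first [m] coordinates back into a sequence. The default 0 beyond them is never
    seen by the functionals concerned. *)
Let pick m i (s : {ffun 'I_m -> 'I_(disc_size i).+1}) (k : nat) : R :=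
  if insub k is Some k' then disc_val R (s k') else 0.

Let idx (D : nat -> T -> R) m i w : {ffun 'I_m -> 'I_(disc_size i).+1} :=
  [ffun k : 'I_m => disc_idx i (D k w)].

Let pick_idx D m i w k : (k < m)%N -> pick (idx D m i w) k = disc i (D k w).
Proof. by move=> km; rewrite /pick insubT ffunE. Qed.

Let idx_bigcap D m i (s : {ffun 'I_m -> 'I_(disc_size i).+1}) :
  idx D m i @^-1` [set s] = \bigcap_(k < m) (D k @^-1`
    (if insub k is Some k' then disc_idx i @^-1` [set s k'] else setT)).
Proof.
apply/seteqP; split=> [w /= <- k /= km|w h].
  by rewrite insubT/= ffunE.
apply/ffunP => k /=; rewrite ffunE.
by have := h k (ltn_ord k); rewrite valK.
Qed.

Let measurable_pick m i (s : {ffun 'I_m -> 'I_(disc_size i).+1}) k :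
  measurable (if insub k is Some k' then @disc_idx R i @^-1` [set s k'] else setT).
Proof. by case: insubP => // u _ _; exact: measurable_disc_idx. Qed.

Let measurable_idx (D : nat -> T -> R) m i s :
  (forall k, measurable_fun setT (D k)) -> measurable (idx D m i @^-1` [set s]).
Proof.
move=> mD; rewrite idx_bigcap; apply: bigcap_measurableType => //= k _.
by rewrite -[X in measurable X]setTI; apply: mD => //; exact: measurable_pick.
Qed.

Let measurable_dD (D : nat -> T -> R) m i s :
  (forall k, measurable_fun setT (D k)) ->
  measurable ((fun w => disc_idx i (D m w)) @^-1` [set s]).
Proof.
move=> mD; rewrite -[X in measurable X]setTI.
exact: (mD m measurableT _ (@measurable_disc_idx R i s)).
Qed.

(** On rounded coordinates [G] takes finitely many values, and sequential continuity makes these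
    converge pointwise; this replaces measurability on a product space. *)
Lemma measurable_seq_continuous m (G : (nat -> R) -> R) (D : nat -> T -> R) :
  seq_continuous m G -> (forall k, measurable_fun setT (D k)) ->
  measurable_fun setT (fun w => G (D ^~ w)).
Proof.
move=> cG mD; apply: (@measurable_fun_cvg _ _ _ _ (fun i w => G (pick (idx D m i w)))).
  move=> i; apply: (@measurable_fun_finite _ T R _ (idx D m i) (fun s => G (pick s))).
  by move=> s; exact: measurable_idx.
move=> w _; apply: cG => k km.
by under eq_fun do rewrite pick_idx//; exact: disc_cvg.
Qed.

Lemma seq_continuous_upd m (G : (nat -> R) -> R) (y : R) :
  seq_continuous m.+1 G -> seq_continuous m (fun x => G (upd x m y)).
Proof.
move=> cG x_ x xx; apply: cG => k; rewrite ltnS leq_eqVlt /upd => /predU1P[->|km].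
  by rewrite eqxx; exact: cvg_cst.
by rewrite ltn_eqF//; exact: xx.
Qed.

(** When [D m] is independent of its past, this is the conditional expectation of [G] given the
    first [m] variables, as a function of their values. *)
Definition integrate_last (D : nat -> T -> R) (m : nat) (G : (nat -> R) -> R)
  (x : nat -> R) : R := \int[P]_w G (upd x m (D m w)).

Section chain.
Variables (m : nat) (G : (nat -> R) -> R) (M : R) (D : nat -> T -> R).
Hypothesis (cG : seq_continuous m.+1 G) (GM : forall x, `|G x| <= M).
Hypothesis (mD : forall k, measurable_fun setT (D k)).

Lemma measurable_upd x : measurable_fun setT (fun w => G (upd x m (D m w))).
Proof.
have := @measurable_seq_continuous m.+1 G (fun k w => upd x m (D m w) k) cG.
by apply=> k; rewrite /upd; case: eqP.
Qed.

Lemma seq_continuous_integrate_last : seq_continuous m (integrate_last D m G).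
Proof.
move=> x_ x xx; apply: (@bounded_cvg_expect _ _ _ P _ _ M) => //.
- by move=> n; exact: measurable_upd.
- exact: measurable_upd.
- by move=> w; exact: (@seq_continuous_upd m G (D m w) cG).
Qed.

Lemma integrate_last_bounded x : `|integrate_last D m G x| <= M.
Proof. by apply: expect_bounded => //; exact: measurable_upd. Qed.

(* Both the past and the last coordinate are first rounded to finitely many
   values, for which independence gives the identity as a finite sum. *)
Lemma expect_integrate_last : independent_seq D ->
  \int[P]_w G (D ^~ w) = \int[P]_w integrate_last D m G (D ^~ w).
Proof.
move=> iD.
pose h i (s : {ffun 'I_m -> 'I_(disc_size i).+1}) (s' : 'I_(disc_size i).+1) :=
  G (upd (pick s) m (disc_val R s')).
pose S i := idx D m i; pose S' i w := disc_idx i (D m w).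
have eqi i : \int[P]_w h i (S i w) (S' i w) =
    \int[P]_w \int[P]_w' h i (S i w) (S' i w').
  apply: expect_finite_indep.
  - by move=> s; exact: measurable_idx.
  - by move=> s; exact: measurable_dD.
  - move=> s s'; rewrite idx_bigcap.
    exact: (iD m _ (disc_idx i @^-1` [set s']) (measurable_pick s)
      (@measurable_disc_idx R i s')).
have hM i s s' : `|h i s s'| <= M by exact: GM.
have mh1 i w : measurable_fun setT (fun w' => h i (S i w) (S' i w')).
  by apply: (@measurable_fun_finite _ T R _ (S' i) (h i (S i w))) => s; exact: measurable_dD.
have c1 : \int[P]_w h i (S i w) (S' i w) @[i --> \oo] --> \int[P]_w G (D ^~ w).
  apply: (@bounded_cvg_expect _ _ _ P _ _ M) => //.
  - move=> i.
    apply: (@measurable_fun_finite _ T R _ (fun w => (S i w, S' i w)) (fun s => h i s.1 s.2)).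
    move=> [s s'].
    rewrite (_ : _ @^-1` _ = S i @^-1` [set s] `&` S' i @^-1` [set s']).
      by apply: measurableI; [exact: measurable_idx|exact: measurable_dD].
    by apply/seteqP; split=> w /= [-> ->].
  - exact: measurable_seq_continuous cG mD.
  - move=> w; apply: cG => k; rewrite ltnS leq_eqVlt /upd => /predU1P[->|km].
      by rewrite eqxx; exact: disc_cvg.
    rewrite ltn_eqF//; under eq_fun do rewrite pick_idx//; exact: disc_cvg.
have c2 : \int[P]_w \int[P]_w' h i (S i w) (S' i w') @[i --> \oo] -->
    \int[P]_w integrate_last D m G (D ^~ w).
  apply: (@bounded_cvg_expect _ _ _ P _ _ M) => //.
  - move=> i; apply: (@measurable_fun_finite _ T R _ (S i)
      (fun s => \int[P]_w' h i s (S' i w'))).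
    by move=> s; exact: measurable_idx.
  - exact: measurable_seq_continuous seq_continuous_integrate_last mD.
  - by move=> i w; apply: expect_bounded.
  - move=> w; apply: (@bounded_cvg_expect _ _ _ P _ _ M) => //.
    + exact: measurable_upd.
    + move=> w'; apply: cG => k; rewrite ltnS leq_eqVlt /upd => /predU1P[->|km].
        by rewrite eqxx; exact: disc_cvg.
      rewrite ltn_eqF//; under eq_fun do rewrite pick_idx//; exact: disc_cvg.
rewrite -(cvg_lim _ c1)// -(cvg_lim _ c2)//.
by under eq_fun do rewrite eqi.
Qed.

End chain.
End independent_sequences.

(** * Moments of the persistent walk *)

Section velocity_step.
Context (R : realType).

(* One step of the persistent walk: the position s moves by v, then v is reversed
   with probability q. *)
Definition step (q : R) (phi : R -> R -> R) (s v : R) : R :=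
  (1 - q) * phi (s + v) v + q * phi (s + v) (- v).

Lemma iter_step_linear (q a b : R) (phi psi : R -> R -> R) r s v :
  iter r (step q) (fun s v => a * phi s v + b * psi s v) s v =
  a * iter r (step q) phi s v + b * iter r (step q) psi s v.
Proof.
elim: r s v => //= r IH s v; rewrite /step !IH; ring.
Qed.

Lemma iter_step_cst (q a : R) r s v :
  iter r (step q) (fun _ _ => a) s v = a.
Proof. elim: r s v => //= r IH s v; rewrite /step !IH; ring. Qed.

Lemma iter_step_shift (q a : R) (phi : R -> R -> R) r s v :
  iter r (step q) (fun s v => phi (a + s) v) s v = iter r (step q) phi (a + s) v.
Proof. by elim: r s v => //= r IH s v; rewrite /step !IH addrA. Qed.

Lemma le_iter_step (q : R) (phi psi : R -> R -> R) r s v : 0 <= q <= 1 ->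
  (forall s v, phi s v <= psi s v) ->
  iter r (step q) phi s v <= iter r (step q) psi s v.
Proof.
move=> /andP[q0 q1] h; elim: r s v => //= r IH s v.
by rewrite /step lerD// ler_wpM2l// subr_ge0.
Qed.

(* Started with velocity [v], the walk only ever has velocities [v] and [- v]. *)
Lemma le_iter_step_norm (q e : R) (phi psi : R -> R -> R) r s v : 0 <= q <= 1 ->
  (forall s, `|phi s v - psi s v| <= e) ->
  (forall s, `|phi s (- v) - psi s (- v)| <= e) ->
  `|iter r (step q) phi s v - iter r (step q) psi s v| <= e.
Proof.
move=> /andP[q0 q1] h1 h2.
suff h : forall s, (`|iter r (step q) phi s v - iter r (step q) psi s v| <= e) /\
  (`|iter r (step q) phi s (- v) - iter r (step q) psi s (- v)| <= e) by have [] := h s.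
elim: r => [s'|r IH s' /=]; first by split.
have q1' : 0 <= 1 - q by rewrite subr_ge0.
have A (x y x' y' : R) : `|x - y| <= e -> `|x' - y'| <= e ->
    `|(1 - q) * x + q * x' - ((1 - q) * y + q * y')| <= e.
  move=> xy xy'.
  rewrite (_ : _ - _ = (1 - q) * (x - y) + q * (x' - y')); last by ring.
  rewrite (le_trans (ler_normD _ _))// !normrM (ger0_norm q0) (ger0_norm q1').
  rewrite (_ : e = (1 - q) * e + q * e); last by ring.
  by rewrite lerD// ler_wpM2l.
split; rewrite /step; first by apply: A; [have [] := IH (s' + v)|have [] := IH (s' + v)].
by rewrite opprK; apply: A; [have [] := IH (s' - v)|have [] := IH (s' - v)].
Qed.

Section moments.
Variable q : R.

(** Moments of the position after [r] steps, from position 0 and velocity 1. After one step the walk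
    is at 1 with a velocity of mean [1 - 2 * q]; expanding the power of [1 + sign * rest], each odd
    moment of the rest picks up this factor. *)
Fixpoint mom1 r : R := if r is r'.+1 then 1 + (1 - 2 * q) * mom1 r' else 0.
Fixpoint mom2 r : R :=
  if r is r'.+1 then 1 + 2 * (1 - 2 * q) * mom1 r' + mom2 r' else 0.
Fixpoint mom3 r : R := if r is r'.+1 then
  1 + 3 * (1 - 2 * q) * mom1 r' + 3 * mom2 r' + (1 - 2 * q) * mom3 r' else 0.
Fixpoint mom4 r : R := if r is r'.+1 then
  1 + 4 * (1 - 2 * q) * mom1 r' + 6 * mom2 r' + 4 * (1 - 2 * q) * mom3 r' +
  mom4 r' else 0.

Lemma iter_step_pow1 r s v : iter r (step q) (fun s _ => s) s v = s + v * mom1 r.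
Proof. elim: r s v => [|r IH] s v /=; first by ring. rewrite /step !IH; ring. Qed.

Lemma iter_step_pow2 r s v : iter r (step q) (fun s _ => s ^+ 2) s v =
  s ^+ 2 + 2 * s * v * mom1 r + v ^+ 2 * mom2 r.
Proof. elim: r s v => [|r IH] s v /=; first by ring. rewrite /step !IH; ring. Qed.

Lemma iter_step_pow4 r s v : iter r (step q) (fun s _ => s ^+ 4) s v =
  s ^+ 4 + 4 * s ^+ 3 * v * mom1 r + 6 * s ^+ 2 * v ^+ 2 * mom2 r +
  4 * s * v ^+ 3 * mom3 r + v ^+ 4 * mom4 r.
Proof. elim: r s v => [|r IH] s v /=; first by ring. rewrite /step !IH; ring. Qed.

Hypothesis q0 : 0 < q.
Hypothesis q2 : 2 * q <= 1.

Let qV : 2 <= q^-1. Proof. by rewrite -[q^-1]mul1r ler_pdivlMr. Qed.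

(** The upper bound is the fixed point of the recursion, whose slope [1 - 2 * q] is nonnegative. *)
Lemma mom1_bound r : 0 <= mom1 r <= q^-1 / 2.
Proof.
have [q0' q2' qV'] := And3 q0 q2 qV.
elim: r => [|r /andP[a0 a1]] /=; first by rewrite lexx/= divr_ge0// invr_ge0 ltW.
have r0 : 0 <= 1 - 2 * q by lra.
have h1 : 0 <= (1 - 2 * q) * mom1 r by exact: mulr_ge0.
have h2 : (1 - 2 * q) * mom1 r <= (1 - 2 * q) * (q^-1 / 2) by rewrite ler_wpM2l.
have h3 : (1 - 2 * q) * (q^-1 / 2) = q^-1 / 2 - 1 by field; rewrite gt_eqF.
by apply/andP; split; lra.
Qed.

(** The proof rests on a closed form with main term [r / q]. The corrections [r] and [q^-1 ^+ 2] are
    negligible for small [q] and a number of steps large compared with [q^-1]. *)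
Lemma mom2_bound r : r%:R / q - (r%:R + q^-1 ^+ 2) <= mom2 r <= r%:R / q.
Proof.
have [q0' q2' qV'] := And3 q0 q2 qV.
have qq : q * q^-1 = 1 by rewrite divff ?gt_eqF.
suff : mom2 r = r%:R / q - r%:R - q^-1 * mom1 r * (1 - 2 * q).
  have /andP[a0 a1] := mom1_bound r => ->.
  have xa : 0 <= q^-1 * mom1 r by rewrite mulr_ge0// invr_ge0 ltW.
  have xa' : q^-1 * mom1 r <= q^-1 * (q^-1 / 2).
    by rewrite ler_wpM2l// invr_ge0 ltW.
  have h1 : 0 <= q^-1 * mom1 r * (1 - 2 * q) by rewrite mulr_ge0//; lra.
  have h2 : q^-1 * mom1 r * (1 - 2 * q) <= q^-1 * mom1 r.
    by rewrite ler_piMr//; lra.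
  have h3 : 0 <= q^-1 * q^-1 by rewrite mulr_ge0// invr_ge0 ltW.
  have r0 : (0 : R) <= r%:R by [].
  by rewrite expr2; apply/andP; split; lra.
elim: r => [|r IH] /=; first by rewrite mulr0 !mul0r subrr subr0.
by rewrite IH -(natr1 r); field; rewrite gt_eqF.
Qed.

Let qVV : 4 <= q^-1 ^+ 2.
Proof. by rewrite (_ : 4 = 2 * 2) ?expr2 ?ler_pM//; ring. Qed.

Let qVVV : 2 * q^-1 <= q^-1 ^+ 2.
Proof. by rewrite expr2 ler_wpM2r// invr_ge0 ltW. Qed.

Let mom2_ge0 r : 0 <= mom2 r.
Proof.
have [q0' q2' qV'] := And3 q0 q2 qV.
elim: r => //= r IH; have /andP[a0 _] := mom1_bound r.
by rewrite addr_ge0// addr_ge0// mulr_ge0// mulr_ge0//; lra.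
Qed.

(** The factor [1 - 2 * q] gains [6 * r / q] on the bound, which absorbs the contribution
    [3 * r / q] of [mom2]; what remains costs at most [3 * q^-1 ^+ 2] per step. *)
Lemma mom3_bound r : 0 <= mom3 r <= 3 * r%:R * q^-1 ^+ 2.
Proof.
have [q0' q2' qV' qVV' qVVV'] := And5 q0 q2 qV qVV qVVV.
elim: r => [|r /andP[c0 c1]] /=; first by rewrite mulr0 mul0r lexx.
have /andP[a0 a1] := mom1_bound r; have /andP[_ b1] := mom2_bound r.
have b0 := mom2_ge0 r.
have r1 : 0 <= 1 - 2 * q by lra.
have h1 : 0 <= (1 - 2 * q) * mom1 r by exact: mulr_ge0.
have h2 : (1 - 2 * q) * mom1 r <= mom1 r by rewrite ler_piMl//; lra.
have h3 : 0 <= (1 - 2 * q) * mom3 r by exact: mulr_ge0.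
have h4 : (1 - 2 * q) * mom3 r <= (1 - 2 * q) * (3 * r%:R * q^-1 ^+ 2).
  by rewrite ler_wpM2l.
have h5 : (1 - 2 * q) * (3 * r%:R * q^-1 ^+ 2) =
    3 * r%:R * q^-1 ^+ 2 - 6 * (r%:R / q) by field; rewrite gt_eqF.
have h6 : 0 <= r%:R / q by rewrite divr_ge0// ltW.
rewrite -(natr1 r) (_ : 3 * _ * _ = 3 * r%:R * q^-1 ^+ 2 + 3 * q^-1 ^+ 2); last by ring.
by rewrite -!mulrA; apply/andP; split; lra.
Qed.

(** In units of [r / q ^ 2], a step adds at most 3 from [mom2] and 12 from [mom3], below the
    increment 16 of the bound. Quadratic growth in [r] becomes the square of the time increment. *)
Lemma mom4_bound r : 0 <= mom4 r <= 8 * r%:R ^+ 2 * q^-1 ^+ 2.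
Proof.
have [q0' q2' qV' qVV' qVVV'] := And5 q0 q2 qV qVV qVVV.
elim: r => [|r /andP[c0 c1]] /=; first by rewrite expr0n/= mulr0 mul0r lexx.
have /andP[a0 a1] := mom1_bound r; have /andP[_ b1] := mom2_bound r.
have b0 := mom2_ge0 r; have /andP[d0 d1] := mom3_bound r.
have h1 : 0 <= (1 - 2 * q) * mom1 r by rewrite mulr_ge0//; lra.
have h2 : (1 - 2 * q) * mom1 r <= mom1 r by rewrite ler_piMl//; lra.
have h3 : 0 <= (1 - 2 * q) * mom3 r by rewrite mulr_ge0//; lra.
have h4 : (1 - 2 * q) * mom3 r <= mom3 r by rewrite ler_piMl//; lra.
have h6 : 2 * (r%:R / q) <= r%:R * q^-1 ^+ 2.
  by rewrite mulrCA; apply: ler_wpM2l.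
have h7 : 0 <= r%:R * q^-1 ^+ 2 by rewrite mulr_ge0// exprn_ge0// invr_ge0 ltW.
rewrite -(natr1 r) (_ : 8 * _ * _ = 8 * r%:R ^+ 2 * q^-1 ^+ 2 +
   16 * (r%:R * q^-1 ^+ 2) + 8 * q^-1 ^+ 2); last by ring.
rewrite -(mulrA 3) in d1.
by rewrite -!mulrA in c1 *; apply/andP; split; lra.
Qed.

End moments.
End velocity_step.

(** * Poisson increments and the signs of the velocity *)

(** Probability that the velocity is reversed over a cell of mean jump number [rate]. Its closed
    form is [(1 - e^(-2 rate)) / 2] for positive [rate]; the two bounds below are what the sequel
    works with. *)
Definition poisson_odd (R : realType) (rate : R) : R :=
  fine (poisson_prob rate 0 [set n | odd n]).

(** The odd numbers contain 1 and avoid 0. *)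
Lemma poisson_odd_bounds (R : realType) (rate : R) : 0 < rate ->
  rate * expR (- rate) <= poisson_odd rate <= rate.
Proof.
move=> r0.
pose Q := poisson_prob rate 0.
have Qk k : Q [set k] = (poisson_pmf rate k)%:E.
  by rewrite /Q /poisson_prob r0 esum_set1// lee_fin poisson_pmf_ge0.
have Qo : Q [set n | odd n] = (poisson_odd rate)%:E.
  by rewrite fineK// fin_num_measure.
apply/andP; split; rewrite -lee_fin -Qo.
  rewrite (_ : rate * _ = poisson_pmf rate 1).
    by rewrite -Qk le_measure// ?inE// => _ /= ->.
  by rewrite /poisson_pmf r0 expr1 invr1 mulr1.
have h : (Q [set n | odd n] <= 1 - Q [set 0%N])%E.
  rewrite leeBrDr//; last by rewrite Qk.
  rewrite -measureU//; first exact: probability_le1.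
  by apply/seteqP; split=> [n /= [+ n0]|//]; rewrite n0.
apply: le_trans h _; rewrite Qk -EFinB lee_fin /poisson_pmf r0 expr0 fact0 invr1 !mul1r.
have := expR_ge1Dx (- rate); lra.
Qed.

Section telegraph_signs.
Context d (T : measurableType d) (R : realType) (P : probability T R).
Context (lambda c : R) (N : R -> T -> nat) (V0 : T -> R).
Hypothesis (lambda0 : 0 < lambda).
Hypothesis (hN : poisson_process P lambda N) (mV0 : measurable_fun setT V0).
Hypothesis (hV0 : uniform_pm P c V0) (hV0N : independent_of_process P V0 N).

Definition increment (s t : R) (w : T) : nat := (N t w - N s w)%N.

Let increment_preimage s t (B : set nat) : increment s t @^-1` B =
  \bigcup_(a in setT) \bigcup_(b in [set b | B (b - a)%N])
    (N s @^-1` [set a] `&` N t @^-1` [set b]).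
Proof.
apply/seteqP; split=> [w /= Bw|w [a _ [b /= Bab [Na Nb]]]].
  by exists (N s w) => //; exists (N t w).
by rewrite /increment Na Nb.
Qed.

Lemma measurable_increment s t : 0 <= s -> 0 <= t ->
  measurable_fun setT (increment s t).
Proof.
move=> s0 t0 _ B _; rewrite setTI increment_preimage.
apply: bigcup_measurable => a _; apply: bigcup_measurable => b _.
have mG u x : 0 <= u -> measurable (N u @^-1` [set x]).
  move=> u0; rewrite -[X in measurable X]setTI.
  exact: (poisson_process_meas hN u0).
by apply: measurableI; exact: mG.
Qed.

(** Independence of [V0] from [N] is stated against the sigma-algebra of the process, so events on
    increments have to be placed in it. *)
Lemma increment_sigma s t (B : set nat) : 0 <= s -> 0 <= t ->
  process_sigma N (increment s t @^-1` B).
Proof.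
move=> s0 t0.
pose G := \bigcup_(t in `[0, +oo[%classic) preimage_set_system setT (N t) measurable.
have mG u a : 0 <= u -> @measurable _ (g_sigma_algebraType G) (N u @^-1` [set a]).
  move=> u0; apply: sub_sigma_algebra; exists u; first by rewrite /= in_itv/= u0.
  by exists [set a] => //; rewrite setTI.
change (@measurable _ (g_sigma_algebraType G) (increment s t @^-1` B)).
rewrite increment_preimage.
apply: bigcup_measurable => a _; apply: bigcup_measurable => b _.
by apply: measurableI; exact: mG.
Qed.

Lemma increment_odd s t : 0 <= s -> s < t ->
  P (increment s t @^-1` [set n | odd n]) = (poisson_odd (lambda * (t - s)))%:E.
Proof.
move=> s0 st.
have r0 : 0 < lambda * (t - s) by rewrite mulr_gt0// subr_gt0.
rewrite fineK ?fin_num_measure//.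
rewrite /poisson_prob r0.
rewrite (_ : _ @^-1` _ =
    \bigcup_(k in [set n | odd n]) (increment s t @^-1` [set k])); last first.
  by apply/seteqP; split=> [w /= ow|w [k /= ok ->//]]; exists (increment s t w).
rewrite measure_bigcup//; last 2 first.
- move=> k _; rewrite -[X in measurable X]setTI.
  by apply: measurable_increment => //; exact: le_trans (ltW st).
- by move=> i j _ _ [w [/= <- <-]].
rewrite nneseries_esum//.
  rewrite set_mem_set; apply: eq_esum => k _.
  by rewrite -(poisson_process_law hN).
Qed.

Section grid.
Variable delta : R.
Hypothesis delta0 : 0 < delta.

(** [V0] sits at index 0 and the parity of the jumps in cell [j] at index [j + 1], so that the
    product of the terms up to [k] is the velocity at grid point [k]. *)
Definition sign_seq (k : nat) (w : T) : R :=
  if k is j.+1 then (-1) ^+ increment (j%:R * delta) (j.+1%:R * delta) w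
  else V0 w.

Let grid_ge0 (k : nat) : 0 <= k%:R * delta.
Proof. by rewrite mulr_ge0// ltW. Qed.

Let grid_le (k : nat) : k%:R * delta <= k.+1%:R * delta.
Proof. by rewrite ler_wpM2r ?ler_nat// ltW. Qed.

Lemma measurable_sign_seq k : measurable_fun setT (sign_seq k).
Proof.
case: k => [//|k] /=.
by apply: (measurableT_comp (f := fun n : nat => (-1) ^+ n : R)) => //;
  exact: measurable_increment.
Qed.

Lemma sign_seq_prod k w :
  \prod_(i < k.+1) sign_seq i w = velocity N V0 (k%:R * delta) w.
Proof.
elim: k => [|k IH].
  by rewrite big_ord1 mul0r /velocity (poisson_process0 hN) mulr1.
rewrite big_ord_recr/= IH /velocity -mulrA -exprD /increment subnKC//.
exact: (poisson_process_nd hN).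
Qed.

Let incr k := increment (k%:R * delta) (k.+1%:R * delta).

Let incr_indep : independent_seq P incr.
Proof.
apply: mutually_independent_seq.
by apply: (poisson_process_indep hN) => //; rewrite mul0r.
Qed.

(** [V0] is split off first, both from the past and from the past with the new sign; the Poisson
    increments factor what remains. *)
Lemma sign_seq_indep : independent_seq P sign_seq.
Proof.
move=> [|m] A C mA mC.
  by rewrite bigcap_mkord big_ord0 setTI probability_setT mul1e.
pose B k := [set n : nat | A k.+1 ((-1) ^+ n)].
pose E := \bigcap_(k < m) (incr k @^-1` B k).
pose F := incr m @^-1` [set n : nat | C ((-1) ^+ n)].
have -> : \bigcap_(k < m.+1) (sign_seq k @^-1` A k) = V0 @^-1` A 0%N `&` E.
  apply/seteqP; split=> [w h|w [h0 hE] [|k]//]; last exact: (hE k).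
  by split; [exact: (h 0%N)|move=> k km; exact: (h k.+1)].
have -> : sign_seq m.+1 @^-1` C = F by [].
have sF : process_sigma N F by exact: increment_sigma.
pose G := \bigcup_(t in `[0, +oo[%classic) preimage_set_system setT (N t) measurable.
have sE : process_sigma N E.
  change (@measurable _ (g_sigma_algebraType G) E).
  by apply: bigcap_measurableType => k _; exact: increment_sigma.
have sEF : process_sigma N (E `&` F).
  by change (@measurable _ (g_sigma_algebraType G) (E `&` F)); exact: measurableI.
rewrite -setIA !hV0N// -muleA; congr (_ * _)%E.
exact: incr_indep.
Qed.

Let q := poisson_odd (lambda * delta).

Lemma expect_sign_seq (k : nat) (f : R -> R) :
  \int[P]_w f (sign_seq k.+1 w) = (1 - q) * f 1 + q * f (-1).
Proof.
have modd b : measurable ((fun w => odd (incr k w)) @^-1` [set b]).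
  have := @measurable_increment (k%:R * delta) (k.+1%:R * delta)
    (grid_ge0 k) (grid_ge0 k.+1) measurableT [set n | odd n = b].
  by rewrite setTI; apply.
have Po : P ((fun w => odd (incr k w)) @^-1` [set true]) = q%:E.
  have kk : k%:R * delta < k.+1%:R * delta by rewrite ltr_pM2r// ltr_nat.
  have := increment_odd (grid_ge0 k) kk.
  by rewrite -mulrBl -natrB// subSnn mul1r.
have Pe : P ((fun w => odd (incr k w)) @^-1` [set false]) = (1 - q)%:E.
  rewrite EFinB -Po -probability_setC//; congr (P _).
  by apply/seteqP; split=> w /=; case: odd.
under eq_Rintegral do rewrite /= -signr_odd.
rewrite (@expect_finite _ T R P _ (fun w => odd (incr k w)) (fun b => f ((-1) ^+ b)))//.
rewrite (bigD1 false)//= (bigD1 true)//= big_pred0; last by case.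
by rewrite Pe Po/= addr0 mulrC; congr (_ + _); rewrite mulrC.
Qed.

End grid.
End telegraph_signs.

(** * The walk driven by independent signs *)

Section run.
Context d (T : measurableType d) (R : realType) (P : probability T R).

Definition vel (j : nat) (x : nat -> R) : R := \prod_(i < j.+1) x i.

Definition pos (k r : nat) (x : nat -> R) : R := \sum_(j < r) vel (k + j) x.

(** [Psi] may read the past signs besides the current position and velocity. As for
    [seq_continuous], continuity also encodes that only the first [k] signs are read. *)
Definition past_continuous (k : nat) (Psi : (nat -> R) -> R -> R -> R) :=
  forall (x_ : nat -> nat -> R) x (s_ : nat -> R) s (v_ : nat -> R) v,
    (forall j, (j < k)%N -> x_ i j @[i --> \oo] --> x j) ->
    s_ i @[i --> \oo] --> s -> v_ i @[i --> \oo] --> v ->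
    Psi (x_ i) (s_ i) (v_ i) @[i --> \oo] --> Psi x s v.

Lemma cvg_vel (j m : nat) (x_ : nat -> nat -> R) (x : nat -> R) : (j < m)%N ->
  (forall k, (k < m)%N -> x_ i k @[i --> \oo] --> x k) ->
  vel j (x_ i) @[i --> \oo] --> vel j x.
Proof.
move=> jm xx; rewrite /vel.
elim: j jm => [|j IH] jm.
  by rewrite big_ord1; under eq_fun do rewrite big_ord1; exact: xx.
rewrite big_ord_recr; under eq_fun do rewrite big_ord_recr.
by apply: cvgM; [apply: IH; exact: ltnW|exact: xx].
Qed.

Lemma cvg_pos (k r m : nat) (x_ : nat -> nat -> R) (x : nat -> R) :
  (k + r <= m)%N ->
  (forall k, (k < m)%N -> x_ i k @[i --> \oo] --> x k) ->
  pos k r (x_ i) @[i --> \oo] --> pos k r x.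
Proof.
move=> + xx; rewrite /pos; elim: r => [|r IH] rm.
  by rewrite big_ord0; under eq_fun do rewrite big_ord0; exact: cvg_cst.
rewrite big_ord_recr; under eq_fun do rewrite big_ord_recr.
rewrite addnS in rm.
by apply: cvgD; [apply: IH; exact: ltnW|exact: (cvg_vel rm xx)].
Qed.

Lemma vel_upd j m (x : nat -> R) y : (j < m)%N -> vel j (upd x m y) = vel j x.
Proof.
move=> jm; apply: eq_bigr => i _; rewrite /upd ltn_eqF//.
by rewrite (leq_trans (ltn_ord i)).
Qed.

Lemma vel_upd_eq m (x : nat -> R) y : vel m.+1 (upd x m.+1 y) = vel m x * y.
Proof.
rewrite /vel big_ord_recr/= {2}/upd eqxx; congr (_ * _).
exact: (@vel_upd m m.+1 x y).
Qed.

Lemma pos_upd k r m (x : nat -> R) y : (k + r <= m)%N ->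
  pos k r (upd x m y) = pos k r x.
Proof.
move=> jm; apply: eq_bigr => i _; apply: vel_upd.
by rewrite (leq_trans _ jm)// ltn_add2l.
Qed.

(** Continuity is applied to a constant sequence: the updated point agrees with [x] on the first [k]
    coordinates, so it converges to [x] in the sense of the definition. *)
Lemma past_continuous_upd k m (Psi : (nat -> R) -> R -> R -> R) x y s v :
  past_continuous k Psi -> (k <= m)%N -> Psi (upd x m y) s v = Psi x s v.
Proof.
move=> cP km.
have h : Psi (upd x m y) s v @[_ --> \oo] --> Psi x s v.
  apply: cP; [|exact: cvg_cst..].
  by move=> j jk; rewrite /upd ltn_eqF ?(leq_trans jk)//; exact: cvg_cst.
by rewrite -(cvg_lim _ h)// lim_cst.
Qed.

Lemma past_continuous_step k q (Psi : (nat -> R) -> R -> R -> R) :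
  past_continuous k Psi -> past_continuous k (fun x => step q (Psi x)).
Proof.
move=> cP x_ x s_ s v_ v xx ss vv; rewrite /step.
apply: cvgD; apply: cvgM; try exact: cvg_cst.
  by apply: cP => //; exact: cvgD.
by apply: cP => //; [exact: cvgD|exact: cvgN].
Qed.

Lemma step_bounded q M (phi : R -> R -> R) : 0 <= q <= 1 ->
  (forall s v, `|phi s v| <= M) -> forall s v, `|step q phi s v| <= M.
Proof.
move=> /andP[q0 q1] h s v; rewrite /step.
have q1' : 0 <= 1 - q by rewrite subr_ge0.
rewrite (le_trans (ler_normD _ _))// !normrM (ger0_norm q0) (ger0_norm q1').
rewrite (_ : M = (1 - q) * M + q * M); last by ring.
by rewrite lerD// ler_wpM2l.
Qed.

Variables (D : nat -> T -> R) (q : R).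
Hypothesis (q01 : 0 <= q <= 1) (mD : forall k, measurable_fun setT (D k)).
Hypothesis iD : independent_seq P D.
Hypothesis lD : forall k (f : R -> R),
  \int[P]_w f (D k.+1 w) = (1 - q) * f 1 + q * f (-1).

(** Markov property of the walk after cell index [k]. The last sign is integrated out, which
    replaces [Psi] by one application of [step q], and the induction continues with this new
    functional. *)
Lemma expect_run k r (Psi : (nat -> R) -> R -> R -> R) (M : R) :
  past_continuous k.+1 Psi -> (forall x s v, `|Psi x s v| <= M) ->
  \int[P]_w Psi (D ^~ w) (pos k r (D ^~ w)) (vel (k + r) (D ^~ w)) =
  \int[P]_w iter r (step q) (Psi (D ^~ w)) 0 (vel k (D ^~ w)).
Proof.
elim: r Psi => [|r IH] Psi cP PM.
  by apply: eq_Rintegral => w _ /=; rewrite /pos big_ord0 addn0.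
transitivity (\int[P]_w step q (Psi (D ^~ w)) (pos k r (D ^~ w)) (vel (k + r) (D ^~ w))).
  pose G x := Psi x (pos k r.+1 x) (vel (k + r).+1 x).
  have cG : seq_continuous (k + r).+2 G.
    move=> x_ x xx; apply: cP.
    - move=> j jk; apply: xx; rewrite (leq_trans jk)//.
      by rewrite ltnS (leq_trans (leq_addr r _)).
    - by apply: (cvg_pos _ xx); rewrite addnS.
    - exact: (cvg_vel _ xx).
  transitivity (\int[P]_w G (D ^~ w)).
    by apply: eq_Rintegral => w _; rewrite /G addnS.
  rewrite (@expect_integrate_last _ _ _ P (k + r).+1 G M)//; last by move=> x; exact: PM.
  apply: eq_Rintegral => w _; rewrite /integrate_last.
  rewrite (lD (k + r) (fun y => G (upd (D ^~ w) (k + r).+1 y))) /G /step.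
  (* The position after [r + 1] steps uses velocities up to index [k + r], so the last sign acts on
     the velocity alone. *)
  rewrite !vel_upd_eq !pos_upd ?addnS// mulr1 mulrN1.
  rewrite !(past_continuous_upd _ _ _ _ cP) ?ltnS ?leq_addr//.
  by rewrite /pos big_ord_recr.
have := IH (fun x => step q (Psi x)).
rewrite /= => ->.
- by apply: eq_Rintegral => w _; rewrite -iterSr.
- exact: past_continuous_step.
- by move=> x; apply: step_bounded.
Qed.

End run.

(** * Riemann sums of the telegraph process *)

Section telegraph_path.
Context d (T : measurableType d) (R : realType) (P : probability T R).
Context (lambda : R) (N : R -> T -> nat) (V0 : T -> R).
Hypothesis (hN : poisson_process P lambda N).
Notation X := (telegraph N V0).

Lemma telegraph0 w : X 0 w = 0.
Proof. by rewrite /telegraph set_itv1 Rintegral_set1. Qed.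

(** The velocity differs from its value at [s] only if there is a jump, by at most [2 * |V0|], and
    then the number of jumps is at least 1. *)
Lemma telegraph_freeze (s t : R) w : 0 <= s -> s <= t ->
  `|X t w - X s w - (t - s) * velocity N V0 s w| <=
  2 * `|V0 w| * (t - s) * (N t w - N s w)%N%:R.
Proof.
move=> s0 st.
have iV : lebesgue_measure.-integrable `[0, t]
    (EFin \o (velocity N V0 ^~ w : measurableTypeR R -> R)).
  exact: (velocity_integrable hN).
rewrite /telegraph Rintegral_itvB ?bnd_simp//.
have iV' : lebesgue_measure.-integrable `]s, t]
    (EFin \o (velocity N V0 ^~ w : measurableTypeR R -> R)).
  apply: integrableS iV => //; apply: subset_itvr; by rewrite bnd_simp.
have leb : lebesgue_measure (`]s, t]%classic : set R) = (t - s)%:E.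
  rewrite lebesgue_measure_itv/= lte_fin; case: ltP => // ts.
  by rewrite (_ : t = s) ?subrr//; apply/le_anti; rewrite ts st.
have icst a : lebesgue_measure.-integrable (`]s, t]%classic : set R) (EFin \o cst a).
  apply: measurable_bounded_integrable => //.
    by rewrite [ltLHS]leb ltry.
  exact: bounded_cst.
have cstE a : \int[lebesgue_measure]_(_ in (`]s, t]%classic : set R)) a = a * (t - s).
  by rewrite Rintegral_cst//= [lebesgue_measure _]leb.
rewrite [X in _ - X]mulrC -cstE -RintegralB//; last exact: icst.
set M := 2 * `|V0 w| * (N t w - N s w)%N%:R.
rewrite [leRHS](_ : _ = M * (t - s)); last by rewrite /M; ring.
have iVs := integrableB _ iV' (icst (velocity N V0 s w)).
rewrite -cstE; apply: le_trans (le_normr_Rintegral _ _) _ => //.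
  exact: iVs.
apply: le_Rintegral => //.
  exact: (integrable_norm (iVs _)).
  exact: icst.
move=> u /=; rewrite in_itv/= => /andP[su ut].
have N1 := poisson_process_nd hN w s0 (ltW su).
have N2 := poisson_process_nd hN w (le_trans s0 (ltW su)) ut.
rewrite /M; have [NN|NN] := eqVneq (N t w) (N s w).
  have Nu : N u w = N s w by apply/eqP; rewrite eqn_leq N1 -NN N2.
  by rewrite /velocity Nu subrr normr0 !mulr_ge0.
apply: (@le_trans _ _ (2 * `|V0 w|)).
  rewrite (le_trans (ler_normB _ _))// /velocity !normrM !normrX normrN1 !expr1n !mulr1.
  by rewrite mulr2n mulrDl mul1r.
rewrite ler_peMr ?mulr_ge0// ler1n subn_gt0 ltn_neqAle eq_sym NN.
exact: leq_trans N2.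
Qed.

(** The jump numbers of the cells telescope, so the total error is of order [delta] times the number
    of jumps, whatever the number of cells. *)
Lemma telegraph_riemann (delta : R) k r w : 0 <= delta ->
  `|X ((k + r)%:R * delta) w - X (k%:R * delta) w -
    delta * \sum_(j < r) velocity N V0 ((k + j)%:R * delta) w| <=
  2 * `|V0 w| * delta * (N ((k + r)%:R * delta) w - N (k%:R * delta) w)%N%:R.
Proof.
move=> d0; elim: r => [|r IH].
  by rewrite addn0 big_ord0 mulr0 !subrr normr0 subnn mulr0.
rewrite big_ord_recr/= addnS.
set a := (k + r)%:R * delta in IH *.
have a0 : 0 <= a by rewrite mulr_ge0.
have aE : (k + r).+1%:R * delta = a + delta by rewrite -natr1 mulrDl mul1r.
have ad : a <= a + delta by rewrite lerDl.
have h := @telegraph_freeze a (a + delta) w a0 ad.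
rewrite aE; set b := a + delta in h *.
have kd : k%:R * delta <= a by rewrite ler_wpM2r// ler_nat leq_addr.
have N1 := poisson_process_nd hN w (mulr_ge0 (ler0n _ k) d0) kd.
have N2 : (N a w <= N b w)%N by apply: (poisson_process_nd hN) => //; rewrite lerDl.
rewrite (_ : _ - _ - _ = (X a w - X (k%:R * delta) w -
    delta * \sum_(j < r) velocity N V0 ((k + j)%:R * delta) w) +
  (X b w - X a w - (b - a) * velocity N V0 a w)); last by rewrite /b; ring.
rewrite (le_trans (ler_normD _ _))// (le_trans (lerD IH h))//.
rewrite (_ : b - a = delta); last by rewrite /b; ring.
by rewrite -mulrDr -natrD addnC addnBA// subnK.
Qed.

End telegraph_path.

(** * Bounds on expectations from almost sure inequalities *)

Section almost_sure_bounds.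
Context d (T : measurableType d) (R : realType) (P : probability T R).

Lemma expect_as_le (S : set T) (f : T -> R) (M : R) :
  measurable S -> P S = 1%E -> P.-integrable setT (EFin \o f) ->
  (forall w, S w -> f w <= M) -> \int[P]_w f w <= M.
Proof.
move=> mS PS intf fM.
have PC : P (~` S) = 0%E by rewrite probability_setC// PS subee.
rewrite /Rintegral (negligible_integral (measurableC mS) measurableT intf PC).
rewrite setTD setCK -/(Rintegral _ _ _).
have intS g : P.-integrable setT (EFin \o g) -> P.-integrable S (EFin \o g).
  exact: integrableS.
have iM : P.-integrable setT (EFin \o (fun _ : T => M)).
  by apply: (@bounded_integrable _ T R P (fun=> M) `|M|).
apply: le_trans (le_Rintegral _ (intS _ intf) (intS _ iM) fM) _ => //.
by rewrite Rintegral_cst//= (PS : P S = 1%E) mulr1.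
Qed.

Lemma expect_as_dist (S : set T) (f g : T -> R) (M : R) :
  measurable S -> P S = 1%E -> P.-integrable setT (EFin \o f) ->
  P.-integrable setT (EFin \o g) ->
  (forall w, S w -> `|f w - g w| <= M) ->
  `|\int[P]_w f w - \int[P]_w g w| <= M.
Proof.
move=> mS PS intf intg fg.
have ifg : P.-integrable setT (EFin \o (fun w => f w - g w)).
  exact: (integrableB measurableT intf intg).
rewrite -RintegralB//.
apply: le_trans (le_normr_Rintegral _ ifg) _ => //.
by apply: (expect_as_le mS PS) => //; exact: integrable_norm.
Qed.

End almost_sure_bounds.

Section iterated_step_continuity.
Context (R : realType).

Lemma past_continuous_iter k r q (Psi : (nat -> R) -> R -> R -> R) :
  past_continuous k Psi -> past_continuous k (fun x => iter r (step q) (Psi x)).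
Proof. by move=> cP; elim: r => //= r IH; exact: past_continuous_step. Qed.

Lemma iter_step_bounded q M r (phi : R -> R -> R) : 0 <= q <= 1 ->
  (forall s v, `|phi s v| <= M) -> forall s v, `|iter r (step q) phi s v| <= M.
Proof. by move=> q01 h; elim: r => //= r IH; exact: step_bounded. Qed.

Lemma seq_continuous_run k r q (Psi : (nat -> R) -> R -> R -> R) :
  past_continuous k.+1 Psi ->
  seq_continuous k.+1 (fun x => iter r (step q) (Psi x) 0 (vel k x)).
Proof.
move=> cP x_ x xx; apply: (past_continuous_iter cP) => //.
  exact: cvg_cst.
exact: (cvg_vel _ xx).
Qed.

End iterated_step_continuity.

Section telegraph_riemann.
Context d (T : measurableType d) (R : realType) (P : probability T R).
Context (lambda c : R) (N : R -> T -> nat) (V0 : T -> R).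
Hypothesis (lambda0 : 0 < lambda) (c0 : 0 < c).
Hypothesis (hN : poisson_process P lambda N) (mV0 : measurable_fun setT V0).
Hypothesis (hV0 : uniform_pm P c V0) (hV0N : independent_of_process P V0 N).
Notation X := (telegraph N V0).

Definition telegraph_incr (h : R) (k : nat) (w : T) : R :=
  X (k.+1%:R * h) w - X (k%:R * h) w.

(** Each increment of length [h] has [n] cells, so increment [k] starts at cell [k * n]; the
    increments for different [k] are functions of one sign sequence. *)
Definition riemann (h : R) (n k : nat) (w : T) : R :=
  h / n%:R * pos (k * n) n (sign_seq N V0 (h / n%:R) ^~ w).

Lemma riemann_bound h n k w : 0 < h -> (0 < n)%N ->
  `|telegraph_incr h k w - riemann h n k w| <=
  2 * `|V0 w| * h * (N (k.+1%:R * h) w - N (k%:R * h) w)%N%:R / n%:R.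
Proof.
move=> h0 n0.
have nn : n%:R != 0 :> R by rewrite pnatr_eq0 -lt0n.
have d0 : 0 <= h / n%:R by rewrite divr_ge0// ltW.
have := telegraph_riemann V0 hN (k * n) n w d0.
have -> : (k * n + n)%:R * (h / n%:R) = k.+1%:R * h.
  by rewrite -mulSnr natrM; field.
have -> : (k * n)%:R * (h / n%:R) = k%:R * h by rewrite natrM; field.
rewrite /riemann /pos /vel.
have d0' : 0 < h / n%:R by rewrite divr_gt0// ltr0n.
under [in X in _ -> X]eq_bigr do rewrite (sign_seq_prod V0 hN d0').
move=> /le_trans; apply; rewrite le_eqVlt; apply/orP; left; apply/eqP.
by field.
Qed.

(** The number of cells is kept a multiple of [l + 1] so that an increment can be cut into [l + 1]
    blocks of whole cells. *)
Lemma riemann_cvg h l k w : 0 < h ->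
  riemann h (l.+1 * r.+1) k w @[r --> \oo] --> telegraph_incr h k w.
Proof.
move=> h0; set C := 2 * `|V0 w| * h * (N (k.+1%:R * h) w - N (k%:R * h) w)%N%:R.
have C0 : 0 <= C by rewrite !mulr_ge0// ltW.
have C1 : 0 < C + 1 by rewrite ltr_wpDl.
apply/cvgrPdist_le => e e0; near=> r.
apply: le_trans (@riemann_bound h (l.+1 * r.+1) k w h0 _) _ => //.
rewrite -/C natrM invfM mulrA.
have Cl : C / l.+1%:R <= C by rewrite ler_pdivrMr// ler_peMr// ler1n.
apply: (@le_trans _ _ ((C + 1) * r.+1%:R^-1)).
  by rewrite ler_wpM2r ?invr_ge0// (le_trans Cl)// lerDl.
rewrite mulrC -ler_pdivlMr//; apply: ltW.
near: r; exact: (near_infty_natSinv_lt (PosNum (divr_gt0 e0 C1))).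
Unshelve. all: by end_near. Qed.

Lemma measurable_riemann h n k : 0 < h -> (0 < n)%N ->
  measurable_fun setT (riemann h n k).
Proof.
move=> h0 n0.
have d0 : 0 < h / n%:R by rewrite divr_gt0// ltr0n.
apply: (@measurable_seq_continuous _ T R (k * n + n)
  (fun x => h / n%:R * pos (k * n) n x) (sign_seq N V0 (h / n%:R))).
  move=> x_ x xx; apply: cvgM; first exact: cvg_cst.
  exact: (cvg_pos _ xx).
by move=> j; exact: (measurable_sign_seq hN mV0 d0).
Qed.

Lemma measurable_telegraph_incr h k : 0 < h ->
  measurable_fun setT (telegraph_incr h k).
Proof.
move=> h0; apply: (@measurable_fun_cvg _ _ _ _ (fun r => riemann h (1 * r.+1) k)).
  by move=> r; apply: measurable_riemann => //; rewrite mul1n.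
by move=> w _; exact: (riemann_cvg 0).
Qed.

Lemma measurable_telegraph t : 0 <= t -> measurable_fun setT (X t).
Proof.
rewrite le_eqVlt => /predU1P[<-|t0].
  by rewrite (_ : X 0 = cst 0)//; apply/funext => w; rewrite telegraph0.
have := @measurable_telegraph_incr t 0 t0.
rewrite (_ : telegraph_incr t 0 = X t)//; apply/funext => w.
by rewrite /telegraph_incr mul1r mul0r telegraph0 subr0.
Qed.

(** [V0] is only almost surely equal to [c] or [- c]; estimates that use the speed are made on this
    event of probability 1. *)
Definition velocity_event : set T := [set w | V0 w = c \/ V0 w = - c].

Lemma measurable_velocity_event : measurable velocity_event.
Proof.
have m1 a : measurable [set w | V0 w = a].
  by have := mV0 measurableT (measurable_set1 a); rewrite setTI.
by apply: measurableU; exact: m1.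
Qed.

Lemma velocity_event1 : P velocity_event = 1%E.
Proof.
have m1 a : measurable [set w | V0 w = a].
  by have := mV0 measurableT (measurable_set1 a); rewrite setTI.
have [h1 h2] := hV0.
rewrite (_ : velocity_event = [set w | V0 w = c] `|` [set w | V0 w = - c])//.
rewrite measureU//.
  transitivity ((2^-1 : R)%:E + (2^-1 : R)%:E)%E.
    by congr (_ + _)%E; [exact: h1|exact: h2].
  by rewrite -EFinD; congr EFin; field.
apply/seteqP; split=> // w [/= -> /eqP]; rewrite -subr_eq0 opprK gt_eqF// addr_gt0//.
Qed.

Lemma vel_velocity_event delta k w : 0 < delta -> velocity_event w ->
  vel k (sign_seq N V0 delta ^~ w) = c \/ vel k (sign_seq N V0 delta ^~ w) = - c.
Proof.
move=> d0 Vw; rewrite /vel (sign_seq_prod V0 hN d0) /velocity -signr_odd.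
by case: odd; rewrite ?expr0 ?expr1 ?mulr1 ?mulrN1; case: Vw => ->;
  [right|left|left|right]; rewrite ?opprK.
Qed.

End telegraph_riemann.

(** * Fourth moment of the telegraph process *)

(** [poisson_odd mu] lies between [mu * (1 - mu)] and [mu]. The additive error 2 on its inverse is
    what identifies the limit variance; the factor 2 is enough for upper bounds. *)
Lemma poisson_odd_small (R : realType) (mu : R) : 0 < mu -> 2 * mu <= 1 ->
  [/\ 0 < poisson_odd mu, 2 * poisson_odd mu <= 1, 0 <= poisson_odd mu <= 1,
      mu^-1 <= (poisson_odd mu)^-1 <= mu^-1 + 2 &
      (poisson_odd mu)^-1 <= 2 * mu^-1].
Proof.
move=> m0 m1; have /andP[q1 q2] := poisson_odd_bounds m0.
have e1 : 1 - mu <= expR (- mu) by have := expR_ge1Dx (- mu); lra.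
have q3 : mu * (1 - mu) <= poisson_odd mu.
  by rewrite (le_trans _ q1)// ler_wpM2l// ltW.
have m2 : 0 < 1 - mu by lra.
have q0 : 0 < poisson_odd mu by rewrite (lt_le_trans _ q3)// mulr_gt0.
have mV : 2 <= mu^-1 by rewrite -[mu^-1]mul1r ler_pdivlMr.
have h : (poisson_odd mu)^-1 <= mu^-1 + 2.
  rewrite -[_^-1]mul1r ler_pdivrMr//.
  apply: (@le_trans _ _ ((mu^-1 + 2) * (mu * (1 - mu)))).
    have -> : (mu^-1 + 2) * (mu * (1 - mu)) = 1 + mu * (1 - 2 * mu).
      by field; rewrite gt_eqF.
    by rewrite lerDl; apply: mulr_ge0; lra.
  by apply: ler_wpM2l => //; lra.
split=> //.
- by lra.
- by apply/andP; split; lra.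
- by rewrite h andbT lef_pV2.
- by lra.
Qed.

Section fourth_moment.
Context d (T : measurableType d) (R : realType) (P : probability T R).
Context (lambda c : R) (N : R -> T -> nat) (V0 : T -> R).
Hypothesis (lambda0 : 0 < lambda) (c0 : 0 < c).
Hypothesis (hN : poisson_process P lambda N) (mV0 : measurable_fun setT V0).
Hypothesis (hV0 : uniform_pm P c V0) (hV0N : independent_of_process P V0 N).

Lemma expect_riemann h n k (Phi : (nat -> R) -> R -> R) (M : R) :
  0 < h -> (0 < n)%N -> 2 * (lambda * (h / n%:R)) <= 1 ->
  (forall x_ x (s_ : nat -> R) s,
    (forall j, (j < k * n)%N -> x_ i j @[i --> \oo] --> x j) ->
    s_ i @[i --> \oo] --> s -> Phi (x_ i) (s_ i) @[i --> \oo] --> Phi x s) ->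
  (forall x s, `|Phi x s| <= M) ->
  let D := sign_seq N V0 (h / n%:R) in
  \int[P]_w Phi (D ^~ w) (riemann N V0 h n k w) =
  \int[P]_w iter n (step (poisson_odd (lambda * (h / n%:R))))
    (fun s _ => Phi (D ^~ w) (h / n%:R * s)) 0 (vel (k * n) (D ^~ w)).
Proof.
move=> h0 n0 hn cPhi PhiM D.
have d0 : 0 < h / n%:R by rewrite divr_gt0// ltr0n.
have [q0 q2 q01 _ _] := poisson_odd_small (mulr_gt0 lambda0 d0) hn.
have mD : forall k, measurable_fun setT (D k) by move=> j; exact: (measurable_sign_seq hN mV0 d0).
have := @expect_run _ T R P D (poisson_odd (lambda * (h / n%:R))) q01 mD
  (sign_seq_indep hN hV0N d0) (expect_sign_seq V0 lambda0 hN d0) (k * n) n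
  (fun x s _ => Phi x (h / n%:R * s)) M.
apply=> // x_ x s_ s v_ v xx ss _.
(* [Phi] reads the signs before [k * n], while the walk is conditioned on the sign of index [k * n]
   as well, which fixes the initial velocity. *)
apply: cPhi => [j jk|]; first by apply: xx; rewrite ltnS ltnW.
by apply: cvgM => //; exact: cvg_cst.
Qed.

Lemma integrable_riemann h n k (Phi : (nat -> R) -> R -> R) (M : R) :
  0 < h -> (0 < n)%N ->
  (forall x_ x (s_ : nat -> R) s,
    (forall j, (j < k * n)%N -> x_ i j @[i --> \oo] --> x j) ->
    s_ i @[i --> \oo] --> s -> Phi (x_ i) (s_ i) @[i --> \oo] --> Phi x s) ->
  (forall x s, `|Phi x s| <= M) ->
  let D := sign_seq N V0 (h / n%:R) in forall q, 0 <= q <= 1 ->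
  P.-integrable setT (EFin \o (fun w => iter n (step q)
    (fun s _ => Phi (D ^~ w) (h / n%:R * s)) 0 (vel (k * n) (D ^~ w)))).
Proof.
move=> h0 n0 cPhi PhiM D q q01.
have d0 : 0 < h / n%:R by rewrite divr_gt0// ltr0n.
apply: (@bounded_integrable _ T R P _ M); last first.
  by move=> w; apply: iter_step_bounded.
apply: (@measurable_seq_continuous _ T R (k * n).+1 (fun x => iter n (step q)
    (fun s _ => Phi x (h / n%:R * s)) 0 (vel (k * n) x)) D).
  apply: (@seq_continuous_run R (k * n) n q (fun x s _ => Phi x (h / n%:R * s))).
  move=> x_ x s_ s v_ v xx ss _.
  apply: cPhi => [j jk|]; first by apply: xx; rewrite ltnS ltnW.
  by apply: cvgM => //; exact: cvg_cst.
by move=> j; exact: (measurable_sign_seq hN mV0 d0).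
Qed.

Let minr_continuous (x_ : nat -> R) (x B : R) : x_ i @[i --> \oo] --> x ->
  Num.min (x_ i ^+ 4) B @[i --> \oo] --> Num.min (x ^+ 4) B.
Proof.
move=> xx.
have h : {for x, continuous (fun y : R => Num.min (y ^+ 4) B)}.
  apply: (@continuous_min R R (fun y => y ^+ 4) (cst B)).
    exact: exprn_continuous.
  exact: cst_continuous.
exact: (continuous_cvg _ h xx).
Qed.

(** 32 is the 8 of [mom4_bound] times the square of the 2 in the bound of the inverse of
    [poisson_odd]. *)
Definition moment_cst := 32 * c ^+ 4 / lambda ^+ 2.

Lemma moment_cst_ge0 : 0 <= moment_cst.
Proof. by rewrite divr_ge0 ?mulr_ge0 ?exprn_ge0// ltW. Qed.

Lemma riemann_moment4 h n k B : 0 < h -> (0 < n)%N ->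
  2 * (lambda * (h / n%:R)) <= 1 -> 0 <= B ->
  \int[P]_w Num.min (riemann N V0 h n k w ^+ 4) B <= moment_cst * h ^+ 2.
Proof.
move=> h0 n0 hn B0.
have d0 : 0 < h / n%:R by rewrite divr_gt0// ltr0n.
have m0 : 0 < lambda * (h / n%:R) by exact: mulr_gt0.
have [q0 q2 q01 _ qV] := poisson_odd_small m0 hn.
pose Phi (_ : nat -> R) (s : R) := Num.min (s ^+ 4) B.
have PhiM x s : `|Phi x s| <= B.
  by rewrite ger0_norm /Phi ?ge_min ?lexx ?orbT// le_min B0 andbT exprn_even_ge0.
have cPhi : forall x_ x (s_ : nat -> R) s,
    (forall j, (j < k * n)%N -> x_ i j @[i --> \oo] --> x j) ->
    s_ i @[i --> \oo] --> s -> Phi (x_ i) (s_ i) @[i --> \oo] --> Phi x s.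
  by move=> x_ x s_ s _ ss; exact: minr_continuous.
rewrite (expect_riemann h0 n0 hn cPhi PhiM).
apply: (expect_as_le (measurable_velocity_event c mV0) (velocity_event1 c0 mV0 hV0)).
  exact: integrable_riemann cPhi PhiM _ _.
move=> w Vw; set q := poisson_odd _ in q0 q2 q01 qV *; set v := vel _ _.
have v4 : v ^+ 4 = c ^+ 4.
  have [|] := vel_velocity_event hN (k * n) d0 Vw; rewrite -/v => -> //.
  by rewrite exprNn -signr_odd mul1r.
set dl := h / n%:R in d0 m0 hn qV *.
(* The truncation is dropped under the transition operator, a finite average where integrability is
   no issue; the term [0 * 0] only matches the form of [iter_step_linear]. *)
apply: (@le_trans _ _ (iter n (step q) (fun s _ => dl ^+ 4 * s ^+ 4 + 0 * 0) 0 v)).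
  by apply: le_iter_step => // s _; rewrite mulr0 addr0 -exprMn /Phi ge_min lexx.
rewrite iter_step_linear (iter_step_pow4 q n 0 v) !mul0r addr0 v4.
rewrite !expr0n/= !(mulr0, mul0r, add0r).
have /andP[_ m4] := mom4_bound q0 q2 n.
have qV2 : q^-1 ^+ 2 <= (2 * (lambda * dl)^-1) ^+ 2.
  by rewrite lerXn2r// nnegrE ?invr_ge0 ?mulr_ge0 ?invr_ge0 ?ltW.
apply: (@le_trans _ _ (dl ^+ 4 * (c ^+ 4 * (8 * n%:R ^+ 2 * (2 * (lambda * dl)^-1) ^+ 2)))).
  rewrite ler_wpM2l ?exprn_ge0 ?(ltW d0)// ler_wpM2l ?exprn_ge0 ?(ltW c0)//.
  by rewrite (le_trans m4)// ler_wpM2l// mulr_ge0// exprn_ge0.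
rewrite le_eqVlt; apply/orP; left; apply/eqP; rewrite /moment_cst /dl; field.
by rewrite !gt_eqF//= ltr0n.
Qed.

Lemma telegraph_moment4_trunc h k B : 0 < h -> 0 <= B ->
  \int[P]_w Num.min (telegraph_incr N V0 h k w ^+ 4) B <= moment_cst * h ^+ 2.
Proof.
move=> h0 B0.
have minB x : `|Num.min (x ^+ 4) B| <= B.
  by rewrite ger0_norm ?ge_min ?lexx ?orbT// le_min B0 andbT exprn_even_ge0.
have mmin (f : T -> R) : measurable_fun setT f ->
    measurable_fun setT (fun w : T => Num.min (f w ^+ 4) B).
  move=> mf; apply: measurable_minr => //; exact: measurable_funX.
have : \int[P]_w Num.min (riemann N V0 h (1 * r.+1) k w ^+ 4) B @[r --> \oo] -->
    \int[P]_w Num.min (telegraph_incr N V0 h k w ^+ 4) B.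
  apply: (@bounded_cvg_expect _ T R P _ _ B).
  - by move=> r; apply: mmin; apply: (measurable_riemann hN mV0); rewrite ?mul1n.
  - by apply: mmin; exact: (measurable_telegraph_incr hN mV0).
  - by move=> r w; exact: minB.
  - by move=> w; exact: (@minr_continuous _ _ B (@riemann_cvg _ T R P lambda N V0 hN h 0 k w h0)).
move=> cB; apply: (ler_cvg_to cB (cvg_cst _)).
have e0 : 0 < (2 * (lambda * h))^-1 by rewrite invr_gt0 !mulr_gt0.
near=> r; rewrite mul1n; apply: riemann_moment4 => //.
have : r.+1%:R^-1 <= (2 * (lambda * h))^-1.
  by apply: ltW; near: r; exact: (near_infty_natSinv_lt (PosNum e0)).
move=> /(ler_wpM2l (ltW (mulr_gt0 (ltr0n R 2) (mulr_gt0 lambda0 h0)))).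
by rewrite divff ?gt_eqF ?mulr_gt0// !mulrA.
Unshelve. all: by end_near. Qed.

End fourth_moment.

(** * Taylor expansion and Gaussian moments *)

Section taylor.
Context (R : realType).

Lemma mvt_bound (f df : R -> R) (x y B : R) :
  (forall z : R, is_derive z 1 f (df z)) ->
  (forall z : R, `|z - x| <= `|y| -> `|df z| <= B) ->
  `|f (x + y) - f x| <= B * `|y|.
Proof.
move=> fdf dfB.
have cf : forall A, {within A, continuous f}.
  move=> A; apply: continuous_subspaceT => z.
  exact/differentiable_continuous/derivable1_diffP/(@ex_derive _ _ _ _ _ _ _ (fdf z)).
have [->|y0] := eqVneq y 0; first by rewrite addr0 subrr !normr0 mulr0.
have [yp|yn] := ltP 0 y.
  have xy : x < x + y by rewrite ltrDl.
  have [z + ->] := MVT xy (fun z _ => fdf z) (cf _).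
  rewrite in_itv/= => /andP[xz zy].
  rewrite normrM (_ : x + y - x = y); last by ring.
  by rewrite ler_wpM2r// dfB// !ger0_norm; lra.
have yn' : y < 0 by rewrite lt_neqAle y0.
have xy : x + y < x by rewrite gtrDl.
have [z + h] := MVT xy (fun z _ => fdf z) (cf _).
rewrite in_itv/= => /andP[xz zy].
rewrite distrC h normrM (_ : x - (x + y) = - y); last by ring.
rewrite normrN ler_wpM2r// dfB// !ler0_norm; lra.
Qed.

(** The Lipschitz bound on the second derivative is carried up twice by the mean value inequality,
    which gives [K] where integration would give [K / 6]. *)
Lemma taylor2 (f a b : R -> R) (x y K : R) :
  (forall z : R, is_derive z 1 f (a z)) -> (forall z : R, is_derive z 1 a (b z)) ->
  (forall z : R, `|z - x| <= `|y| -> `|b z - b x| <= K * `|z - x|) ->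
  `|f (x + y) - f x - a x * y - b x * y ^+ 2 / 2| <= K * `|y| ^+ 3.
Proof.
move=> fa ab bK.
have [->|y0] := eqVneq y 0.
  by rewrite addr0 mulr0 expr0n/= mulr0 mul0r !subr0 subrr !normr0 expr0n/= mulr0.
have yp : 0 < `|y| by rewrite normr_gt0.
have K0 : 0 <= K.
  have /bK : `|x + y - x| <= `|y| by rewrite addrC addKr.
  by rewrite (addrC x) addrK => /(le_trans (normr_ge0 _)); rewrite pmulr_lge0.
pose a' z := a z - a x - b x * (z - x).
have da' (z : R) : is_derive z 1 a' (b z - b x).
  rewrite /a'; apply: is_derive_eq.
  by rewrite !subr0 /GRing.scale/= mulr1.
have a'B z : `|z - x| <= `|y| -> `|a' z| <= K * `|y| ^+ 2.
  move=> zy.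
  have h : a' x = 0 by rewrite /a' !subrr mulr0 subr0.
  have := @mvt_bound a' _ x (z - x) (K * `|y|) da'.
  rewrite (addrC x) subrK h subr0 => /(_ _)/le_trans; apply.
    move=> u ux; rewrite (le_trans (bK _ (le_trans ux zy)))// ler_wpM2l//.
    exact: le_trans ux zy.
  by rewrite expr2 mulrA ler_wpM2l// mulr_ge0.
pose f' z := f z - f x - a x * (z - x) - b x / 2 * (z - x) ^+ 2.
have df' (z : R) : is_derive z 1 f' (a' z).
  rewrite /f'; apply: is_derive_eq.
  by rewrite /a' /GRing.scale/=; field.
have := @mvt_bound f' _ x y (K * `|y| ^+ 2) df' a'B.
rewrite (_ : f' x = 0) ?subr0; last by rewrite /f' subrr; ring.
rewrite -mulrA -exprSr /f' (_ : x + y - x = y); last by ring.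
by rewrite (_ : b x / 2 * y ^+ 2 = b x * y ^+ 2 / 2)//; ring.
Qed.

Lemma expR_taylor2 (t : R) :
  `|expR t - 1 - t - t ^+ 2 / 2| <= expR `|t| * `|t| ^+ 3.
Proof.
have := @taylor2 expR expR expR 0 t (expR `|t|) (@is_derive_expR R) (@is_derive_expR R).
rewrite add0r expR0 !mul1r; apply=> z; rewrite subr0 => zt.
have := @mvt_bound expR expR 0 z (expR `|t|) (@is_derive_expR R).
rewrite add0r expR0; apply=> u; rewrite subr0 => uz.
by rewrite ger0_norm ?expR_ge0// ler_expR (le_trans (ler_norm _))// (le_trans uz).
Qed.

End taylor.

Section normal_moments.
Context (R : realType).
Local Notation mu := (@lebesgue_measure R).
Implicit Type s : R.

Section density.
Variable s : R.
Local Notation nu := (normal_prob 0 s).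
Local Notation pdf := (normal_pdf 0 s).

Import HBNNSimple.

Let integral_normal_nnsfun (f : {nnsfun measurableTypeR R >-> R}) :
  (\int[nu]_x (f x)%:E = \int[mu]_x ((f x)%:E * (pdf x)%:E))%E.
Proof.
under [LHS]eq_integral do rewrite fimfunE -fsumEFin//.
rewrite [LHS]ge0_integral_fsum//; last 2 first.
  - by move=> r; exact/measurable_EFinP/measurableT_comp.
  - by move=> n x _; rewrite EFinM nnfun_muleindic_ge0.
under [RHS]eq_integral.
  move=> x xD; rewrite fimfunE -fsumEFin// muleC ge0_mule_fsumr; last first.
    by move=> r; rewrite EFinM nnfun_muleindic_ge0.
  over.
have mpdf : measurable_fun setT (fun x => (pdf x)%:E).
  by apply/measurable_EFinP; exact: measurable_normal_pdf.
rewrite [RHS]ge0_integral_fsum//; last 2 first.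
  - move=> r; apply: emeasurable_funM => //.
    by apply/measurable_EFinP/measurableT_comp.
  - move=> n x _; rewrite EFinM mule_ge0//; last by rewrite nnfun_muleindic_ge0.
    by rewrite lee_fin normal_pdf_ge0.
apply: eq_fsbigr => r _.
rewrite integralZl_indic_nnsfun; last exact: (@measurableT _ (measurableTypeR R)).
rewrite integral_indic//.
rewrite setIT.
have [r0|r0] := ltP r 0.
  rewrite preimage_nnfun0// measure0 mule0 integral0_eq// => x _.
  by rewrite indicE memNset ?mulr0 ?mule0.
rewrite /= /normal_prob -ge0_integralZl//; last 2 first.
- exact: measurable_funTS.
- by move=> x _; rewrite lee_fin normal_pdf_ge0.
rewrite [LHS]integral_mkcond; apply: eq_integral => x _.
rewrite patchE indicE; case: ifPn => _; first by rewrite mulr1 muleC.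
by rewrite mulr0 mule0.
Qed.

Lemma ge0_integral_normal_prob (f : measurableTypeR R -> \bar R) :
  measurable_fun setT f -> (forall x, 0 <= f x)%E ->
  (\int[nu]_x f x = \int[mu]_x (f x * (pdf x)%:E))%E.
Proof.
move=> mf f0.
have mpdf : measurable_fun setT (fun x => (pdf x)%:E).
  by apply/measurable_EFinP; exact: measurable_normal_pdf.
have p0 x : (0 <= (pdf x)%:E)%E by rewrite lee_fin normal_pdf_ge0.
pose f_ := nnsfun_approx measurableT mf.
transitivity (lim (\int[nu]_x (f_ n x)%:E @[n --> \oo])%E).
  rewrite -monotone_convergence//=.
  - apply: eq_integral => ? /[!inE] xD; apply/esym/cvg_lim => //=.
    exact: cvg_nnsfun_approx.
  - by move=> n; exact/measurable_EFinP/measurable_funTS.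
  - by move=> n ? _; rewrite lee_fin.
  - by move=> ? _ ? ? mn; rewrite lee_fin; exact/lefP/nd_nnsfun_approx.
rewrite [RHS](_ : _ = lim (\int[mu]_x ((f_ n x)%:E * (pdf x)%:E) @[n --> \oo])%E).
  by apply: congr_lim; apply/funext => n /=; exact: integral_normal_nnsfun.
rewrite -monotone_convergence//=.
- apply: eq_integral => x /[!inE] xD; apply/esym/cvg_lim => //.
  rewrite muleC; under eq_fun do rewrite muleC.
  by apply: cvgeZl => //; exact: cvg_nnsfun_approx.
- by move=> n; apply: emeasurable_funM => //; exact/measurable_EFinP/measurable_funTS.
- by move=> n ? _; rewrite mule_ge0// lee_fin.
- move=> x _ m n mn; rewrite lee_wpmul2r// lee_fin; exact/lefP/nd_nnsfun_approx.
Qed.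

End density.

(** Completing the square turns the exponentially tilted centered density into a constant times the
    normal density of mean [u * s ^+ 2]. *)
Lemma normal_mgf s u : s != 0 ->
  (\int[normal_prob 0 s]_y (expR (u * y))%:E = (expR (u ^+ 2 * s ^+ 2 / 2))%:E)%E.
Proof.
move=> s0.
have s2 : s ^+ 2 != 0 by rewrite expf_neq0.
rewrite ge0_integral_normal_prob//; last first.
  by apply/measurable_EFinP; apply: measurableT_comp => //; exact: measurable_funM.
under eq_integral => y _.
  rewrite (_ : _ * _ = (expR (u ^+ 2 * s ^+ 2 / 2))%:E *
      (normal_pdf (u * s ^+ 2) s y)%:E)%E; last first.
    rewrite -!EFinM !normal_pdfE// /normal_fun mulrCA [in RHS]mulrCA -!expRD.
    by congr (_ * expR _)%:E; field.
  over.
rewrite ge0_integralZl//=.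
- by rewrite integral_normal_pdf mule1.
- by apply/measurable_EFinP; exact: measurable_normal_pdf.
- by move=> y _; rewrite lee_fin normal_pdf_ge0.
Qed.

Section moments.
Variables (s : R).
Hypothesis s0 : 0 < s.
Local Notation nu := (normal_prob 0 s).

Lemma normal_integrable_exp u :
  nu.-integrable setT (EFin \o (fun y => expR (u * y))).
Proof.
apply/integrableP; split.
  by apply/measurable_EFinP; apply: measurableT_comp => //; exact: measurable_funM.
under eq_integral do rewrite /= ger0_norm ?expR_ge0//.
by rewrite normal_mgf ?ltry// gt_eqF.
Qed.

Lemma normal_expect_exp u :
  \int[nu]_y expR (u * y) = expR (u ^+ 2 * s ^+ 2 / 2).
Proof. by rewrite /Rintegral normal_mgf// gt_eqF. Qed.

(** Dominates the exponential of [u * |y|] for [u >= 0], and has an explicit expectation. *)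
Let cosh2 u (y : R) := expR (u * y) + expR (- u * y).

Let integrable_cosh2 u : nu.-integrable setT (EFin \o cosh2 u).
Proof.
exact: (integrableD measurableT (normal_integrable_exp u) (normal_integrable_exp (- u))).
Qed.

Let expect_cosh2 u : \int[nu]_y cosh2 u y = 2 * expR (u ^+ 2 * s ^+ 2 / 2).
Proof.
rewrite (RintegralD measurableT (normal_integrable_exp u) (normal_integrable_exp (- u))).
by rewrite !normal_expect_exp sqrrN mulr2n mulrDl mul1r.
Qed.

Let exp_norm_cosh2 u (y : R) : 0 <= u -> expR (u * `|y|) <= cosh2 u y.
Proof.
move=> u0; rewrite /cosh2; have [y0|y0] := leP 0 y.
  by rewrite ger0_norm// lerDl expR_ge0.
by rewrite ltr0_norm// mulrN mulNr lerDr expR_ge0.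
Qed.

Let pow_exp (n : nat) (x : R) : 0 <= x -> x ^+ n.+1 <= n.+1`!%:R * expR x.
Proof.
move=> x0; have := expR_ge1Dxn n x0; rewrite -ler_pdivrMl ?ltr0n ?fact_gt0// => h.
by rewrite mulrC (le_trans _ h)// lerDr.
Qed.

Lemma normal_integrable_pow n : nu.-integrable setT (EFin \o (fun y : R => y ^+ n)).
Proof.
case: n => [|n].
  by apply: (@bounded_integrable _ _ R nu (fun y : R => y ^+ 0) 1) => // y; rewrite expr0 normr1.
have := integrableZl measurableT n.+1`!%:R (integrable_cosh2 1).
apply: le_integrable => //; first exact/measurable_EFinP/measurable_funX.
move=> y _ /=; rewrite lee_fin normrX.
rewrite [leRHS]ger0_norm; last by rewrite mulr_ge0// addr_ge0 ?expR_ge0.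
apply: le_trans (pow_exp n (normr_ge0 y)) _.
by rewrite ler_wpM2l// -[X in expR X]mul1r exp_norm_cosh2.
Qed.

(* [y^4 <= 24 s^4 (e^(y/s) + e^(-y/s))], and the right-hand side is integrated by
   the moment generating function *)
Lemma normal_moment4 : \int[nu]_y (y ^+ 4) <= 48 * expR (1 / 2) * s ^+ 4.
Proof.
rewrite -[leRHS](_ : \int[nu]_y (24 * s ^+ 4 * cosh2 s^-1 y) = _).
  apply: (@le_expect _ _ R nu) => //.
  - exact: normal_integrable_pow.
  - exact: (integrableZl measurableT (24 * s ^+ 4) (integrable_cosh2 s^-1)).
  move=> y.
  have sV : 0 <= s^-1 by rewrite invr_ge0 ltW.
  have s4 : 0 < s ^+ 4 by rewrite exprn_gt0.
  have := pow_exp 3 (mulr_ge0 sV (normr_ge0 y)).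
  rewrite exprMn -normrX ger0_norm ?exprn_even_ge0// exprVn mulrC.
  rewrite ler_pdivrMr// => /le_trans; apply.
  rewrite (_ : 4`!%:R = 24)// mulrAC; apply: ler_wpM2l; first by rewrite mulr_ge0// (ltW s4).
  exact: exp_norm_cosh2.
rewrite (RintegralZl _ measurableT (integrable_cosh2 s^-1)).
rewrite expect_cosh2 exprVn mulVf ?expf_neq0 ?gt_eqF//; ring.
Qed.

Let small_eq0 (x C : R) : (forall e, 0 < e -> e <= 1 -> `|x| <= C * e) -> x = 0.
Proof.
move=> h; apply/eqP/negPn/negP => x0.
have xp : 0 < `|x| by rewrite normr_gt0.
have C0 : 0 < C.
  by have := lt_le_trans xp (h 1 ltr01 (lexx _)); rewrite mulr1.
pose e := Num.min 1 (`|x| / (2 * C)).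
have e0 : 0 < e by rewrite lt_min ltr01/= divr_gt0// mulr_gt0.
have e1 : e <= 1 by rewrite ge_min lexx.
have := h e e0 e1.
have : C * e <= C * (`|x| / (2 * C)) by rewrite ler_wpM2l ?(ltW C0)// ge_min lexx orbT.
rewrite (_ : C * (_ / _) = `|x| / 2); last by field; rewrite gt_eqF.
by move=> a b; have := le_trans b a; lra.
Qed.

Let m1 := \int[nu]_y y.
Let m2 := \int[nu]_y (y ^+ 2).

(** Both sides of the identity for the moment generating function are expanded to second order in
    [u]. Their difference is this polynomial, so it is of third order, and its coefficients will
    have to vanish. *)
Let moments_expansion : exists C, forall u, `|u| <= 1 ->
  `|u * m1 + u ^+ 2 * ((m2 - s ^+ 2) / 2)| <= C * `|u| ^+ 3.
Proof.
pose X0 := s ^+ 2 / 2.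
have X00 : 0 <= X0 by rewrite divr_ge0// exprn_ge0// ltW.
(* From [|y|^3 <= 6 e^|y|] and [e^|u y| <= e^|y|]: the remainder is at most [6 e^(2|y|) |u|^3],
   whose expectation is bounded through [cosh2 2]. *)
pose C1 := 6 * (2 * expR (2 ^+ 2 * s ^+ 2 / 2)).
pose C2 := X0 ^+ 2 / 2 + expR X0 * X0 ^+ 3.
exists (C1 + C2) => u u1.
have iexp := normal_integrable_exp u.
have i1 : nu.-integrable setT (EFin \o (fun y : R => y)).
  by have := normal_integrable_pow 1; congr integrable; apply/funext => y /=; rewrite expr1.
have i2 := normal_integrable_pow 2.
have ic : nu.-integrable setT (EFin \o (fun _ : R => 1 : R)).
  exact: (normal_integrable_pow 0).
have iu1 : nu.-integrable setT (EFin \o (fun y : R => u * y)).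
  exact: (integrableZl measurableT u i1).
have iu2 : nu.-integrable setT (EFin \o (fun y : R => u ^+ 2 / 2 * y ^+ 2)).
  exact: (integrableZl measurableT (u ^+ 2 / 2) i2).
have iA : nu.-integrable setT (EFin \o (fun y : R => expR (u * y) - 1)).
  exact: (integrableB measurableT iexp ic).
have iB : nu.-integrable setT (EFin \o (fun y : R => expR (u * y) - 1 - u * y)).
  exact: (integrableB measurableT iA iu1).
have iC : nu.-integrable setT
    (EFin \o (fun y : R => expR (u * y) - 1 - u * y - u ^+ 2 / 2 * y ^+ 2)).
  exact: (integrableB measurableT iB iu2).
have E : \int[nu]_y (expR (u * y) - 1 - u * y - u ^+ 2 / 2 * y ^+ 2) =
    expR (u ^+ 2 * s ^+ 2 / 2) - 1 - u * m1 - u ^+ 2 / 2 * m2.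
  rewrite (RintegralB measurableT iB iu2) (RintegralB measurableT iA iu1).
  rewrite (RintegralB measurableT iexp ic) normal_expect_exp.
  rewrite (RintegralZl _ measurableT i1) (RintegralZl _ measurableT i2).
  by rewrite (expect_cst nu).
have h1 : `|expR (u ^+ 2 * s ^+ 2 / 2) - 1 - u * m1 - u ^+ 2 / 2 * m2| <= C1 * `|u| ^+ 3.
  rewrite -E; apply: le_trans (le_normr_Rintegral measurableT iC) _.
  rewrite /C1 -expect_cosh2 -(RintegralZl _ measurableT (integrable_cosh2 2)).
  have ic2 := integrableZl measurableT 6 (integrable_cosh2 2).
  rewrite -(RintegralZr _ measurableT ic2).
  apply: (@le_expect _ _ R nu).
  - exact: integrable_norm.
  - exact: (integrableZr measurableT (`|u| ^+ 3) ic2).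
  move=> y.
  have := expR_taylor2 (u * y); rewrite exprMn mulrAC => /le_trans; apply.
  rewrite normrM exprMn mulrCA [leRHS]mulrC ler_wpM2l ?exprn_ge0//.
  have y3 := pow_exp 2 (normr_ge0 y).
  have e1 : expR (`|u| * `|y|) <= expR `|y| by rewrite ler_expR ler_piMl.
  apply: (@le_trans _ _ (expR `|y| * (6 * expR `|y|))).
    by rewrite ler_pM ?expR_ge0 ?exprn_ge0.
  rewrite mulrCA -expRD ler_wpM2l// (_ : `|y| + `|y| = 2 * `|y|); last by ring.
  exact: exp_norm_cosh2.
have h2 : `|expR (u ^+ 2 * s ^+ 2 / 2) - 1 - u ^+ 2 * s ^+ 2 / 2| <= C2 * `|u| ^+ 3.
  rewrite -mulrA -/X0 -(real_normK (num_real u)).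
  set v := `|u| in u1 *; have v0 : 0 <= v by exact: normr_ge0.
  set x := v ^+ 2 * X0.
  have x0 : 0 <= x by rewrite mulr_ge0// exprn_ge0.
  have xX : x <= X0 by rewrite ler_piMl// exprn_ile1.
  have := expR_taylor2 x; rewrite (ger0_norm x0) => h.
  have eX : expR x * x ^+ 3 <= expR X0 * (X0 ^+ 3 * v ^+ 3).
    rewrite ler_pM ?expR_ge0 ?exprn_ge0 ?ler_expR//.
    rewrite exprMn -exprM mulrC ler_wpM2l ?exprn_ge0//.
    exact: ler_wiXn2l.
  have x2 : x ^+ 2 <= X0 ^+ 2 * v ^+ 3.
    rewrite exprMn -exprM mulrC ler_wpM2l ?exprn_ge0//.
    exact: ler_wiXn2l.
  rewrite (_ : C2 * v ^+ 3 = expR X0 * (X0 ^+ 3 * v ^+ 3) + X0 ^+ 2 * v ^+ 3 / 2).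
    rewrite (_ : expR x - 1 - x = (expR x - 1 - x - x ^+ 2 / 2) + x ^+ 2 / 2).
      rewrite (le_trans (ler_normD _ _))// lerD//; first exact: le_trans h eX.
      by rewrite ger0_norm ?divr_ge0 ?exprn_ge0// ler_pM2r.
    by ring.
  by rewrite /C2; ring.
rewrite (_ : u * m1 + _ = (expR (u ^+ 2 * s ^+ 2 / 2) - 1 - u ^+ 2 * s ^+ 2 / 2) -
  (expR (u ^+ 2 * s ^+ 2 / 2) - 1 - u * m1 - u ^+ 2 / 2 * m2)); last by field.
by rewrite mulrDl (le_trans (ler_normB _ _))// [leRHS]addrC lerD.
Qed.

Lemma normal_moment1 : \int[nu]_y y = 0.
Proof.
have [C h] := moments_expansion; apply: (@small_eq0 _ C) => e e0 e1.
have /h h1 : `|e| <= 1 by rewrite ger0_norm// ltW.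
have /h h2 : `|- e| <= 1 by rewrite normrN ger0_norm// ltW.
(* Subtracting the expansions at [e] and [- e] cancels the even part. *)
have h3 : `|2 * e * m1| <= 2 * (C * `|e| ^+ 3).
  rewrite (_ : 2 * e * m1 = (e * m1 + e ^+ 2 * ((m2 - s ^+ 2) / 2)) -
    (- e * m1 + (- e) ^+ 2 * ((m2 - s ^+ 2) / 2))); last by ring.
  rewrite (le_trans (ler_normB _ _))// [leRHS]mulr_natl [leRHS]mulr2n lerD//.
  by rewrite normrN in h2.
move: h3; rewrite !normrM (ger0_norm (ltW e0)) ger0_norm// -mulrA ler_pM2l//.
rewrite -ler_pdivlMl// => /le_trans; apply.
rewrite (_ : e^-1 * _ = C * e * e); last by field; rewrite gt_eqF.
have C0 : 0 <= C.
  have := le_trans (normr_ge0 _) h1; rewrite pmulr_lge0// exprn_gt0// normr_gt0 gt_eqF//.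
by rewrite ler_piMr// mulr_ge0// ltW.
Qed.

Lemma normal_moment2 : \int[nu]_y (y ^+ 2) = s ^+ 2.
Proof.
have [C h] := moments_expansion.
apply/eqP; rewrite -subr_eq0; apply/eqP.
apply: (@small_eq0 _ (2 * C)) => e e0 e1.
have /h : `|e| <= 1 by rewrite ger0_norm// ltW.
rewrite [m1]normal_moment1 mulr0 add0r normrM normrX (ger0_norm (ltW e0)) normrM.
have v2 : `|2^-1 : R| = 2^-1 by rewrite ger0_norm ?invr_ge0.
rewrite v2 => h1.
have e2 : 0 < e ^+ 2 by rewrite exprn_gt0.
move: h1; rewrite mulrA ler_pdivrMr// -ler_pdivlMl// => /le_trans; apply.
by rewrite le_eqVlt; apply/orP; left; apply/eqP; field; rewrite gt_eqF.
Qed.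

End moments.
End normal_moments.

(** * Smoothing and Gaussian averages *)

Section smoothing.
Context (R : realType).

Definition lipschitz (L : R) (f : R -> R) := forall x y, `|f x - f y| <= L * `|x - y|.

Lemma lipschitz_continuous L f : lipschitz L f -> continuous f.
Proof.
move=> fL x; apply/cvgrPdist_le => e e0.
have L1 : 0 < `|L| + 1 by rewrite ltr_wpDl.
near=> y; apply: le_trans (fL x y) _.
apply: (@le_trans _ _ ((`|L| + 1) * `|x - y|)).
  by rewrite ler_wpM2r// (le_trans (ler_norm L))// lerDl.
rewrite mulrC -ler_pdivlMr//; near: y.
apply: cvgr_dist_le => //; exact: divr_gt0.
Unshelve. all: by end_near. Qed.

Lemma lipschitz_measurable L f : lipschitz L f -> measurable_fun setT f.
Proof. by move=> /lipschitz_continuous; exact: continuous_measurable_fun. Qed.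

Section average.
Variables (rho : R) (L : R).
Hypothesis rho0 : 0 < rho.

(** Each average gains one derivative, which is a difference quotient of [g] and hence explicitly
    bounded. *)
Definition average (g : R -> R) (x : R) : R :=
  rho^-1 * \int[lebesgue_measure]_(t in `[x, x + rho]) g t.

Let integrable_lip (g : R -> R) (a b : R) : continuous g ->
  lebesgue_measure.-integrable `[a, b] (EFin \o g).
Proof.
move=> cg; apply: continuous_compact_integrable; first exact: segment_compact.
exact: continuous_subspaceT.
Qed.

Let average_cst (a x : R) : average (cst a) x = a.
Proof.
rewrite /average Rintegral_cst//= lebesgue_measure_itv/= lte_fin ltrDl rho0 -EFinD/=.
by field; rewrite gt_eqF.
Qed.

Lemma average_dist (g : R -> R) (x c e : R) : continuous g ->
  (forall t, x <= t -> t <= x + rho -> `|g t - c| <= e) -> `|average g x - c| <= e.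
Proof.
move=> cg h.
have ig := integrable_lip x (x + rho) cg.
have ic a : lebesgue_measure.-integrable `[x, x + rho] (EFin \o cst a).
  by apply: integrable_lip; exact: cst_continuous.
have mI : measurable (`[x, x + rho]%classic : set (measurableTypeR R)) by [].
have rV : 0 <= rho^-1 by rewrite invr_ge0 ltW.
rewrite -{1}[c](average_cst c x) /average -mulrBr normrM (ger0_norm rV).
rewrite -(RintegralB mI ig (ic c)).
rewrite -[e](average_cst e x) /average ler_wpM2l//.
have igc := integrableB mI ig (ic c).
apply: le_trans (le_normr_Rintegral mI igc) _.
have ign := integrable_norm igc.
apply: (le_Rintegral mI ign (ic e)).
by move=> t /=; rewrite in_itv/= => /andP[xt tx]; exact: h.
Qed.

Lemma average_derive (g : R -> R) (x : R) : continuous g ->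
  is_derive x 1 (average g) ((g (x + rho) - g x) / rho).
Proof.
move=> cg.
(* A base point strictly to the left makes both [x] and [x + rho] interior points for the
   fundamental theorem of calculus. *)
pose a := x - 1.
pose F y := \int[lebesgue_measure]_(t in `[a, y]) g t.
have dF y : a < y -> is_derive y 1 F (g y).
  move=> ay; have yy : y < y + 1 by rewrite ltrDl.
  have [d1 d2] := continuous_FTC1_closed yy (integrable_lip a (y + 1) cg) ay (cg y).
  by apply: DeriveDef; [exact: d1|rewrite -derive1E].
have ax : a < x by rewrite /a; lra.
have axr : a < x + rho by move: rho0; rewrite /a => r0; lra.
have dA : is_derive x 1 (fun y => rho^-1 * (F (y + rho) - F y)) ((g (x + rho) - g x) / rho).
  have d1 := dF _ ax.
  have d2 : is_derive x 1 (F \o shift rho) (g (x + rho)).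
    rewrite -[g (x + rho)]mulr1.
    exact: (@is_derive1_comp _ F (shift rho) x (g (x + rho)) 1 (dF _ axr)
      (is_derive_shift x 1 rho)).
  have := @is_deriveZ _ _ _ _ rho^-1 x 1 _ (@is_deriveB _ _ _ _ _ x 1 _ _ d2 d1).
  by rewrite /GRing.scale/= mulrC.
apply: near_eq_is_derive dA.
near=> y.
have ay : a < y by near: y; exact: lt_nbhsr.
rewrite /average /F (Rintegral_itvB (integrable_lip a (y + rho) cg)) ?bnd_simp//.
- rewrite Rintegral_itv_obnd_cbnd//.
  apply: (integrableS _ _ _ (integrable_lip y (y + rho) cg)) => //.
  by apply: subset_itvr; rewrite bnd_simp.
- exact: ltW.
- by rewrite lerDl ltW.
Unshelve. all: by end_near. Qed.


Lemma average_lipschitz (g : R -> R) : 0 <= L -> lipschitz L g -> lipschitz L (average g).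
Proof.
move=> L0 gL x y.
have cg := lipschitz_continuous gL.
have dg (z : R) : is_derive z 1 (average g) ((g (z + rho) - g z) / rho) by exact: average_derive.
have := @mvt_bound _ _ _ y (x - y) L dg; rewrite (_ : y + (x - y) = x); last by ring.
apply.
move=> z _; rewrite normrM [X in _ * X]ger0_norm ?invr_ge0 ?(ltW rho0)//.
rewrite ler_pdivrMr// (le_trans (gL _ _))// addrAC subrr add0r ger0_norm// ltW//.
Qed.

End average.

(** [a] and [b] stand for the first two derivatives, recorded through the Taylor inequality. In this
    form the class is preserved by Gaussian averaging without differentiating under an integral. *)
Definition smooth (K : R) (phi : R -> R) := exists a b : R -> R,
  [/\ lipschitz K phi, lipschitz K a, lipschitz K b,
      (forall x, `|a x| <= K /\ `|b x| <= K) &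
      forall x y, `|phi (x + y) - phi x - a x * y - b x * y ^+ 2 / 2| <= K * `|y| ^+ 3].

(* [phi] averages [g] twice over intervals of length [rho]. *)
Lemma smoothing (L M rho : R) : 0 < rho -> 0 <= L ->
  exists K, 0 <= K /\ forall g, lipschitz L g -> (forall x, `|g x| <= M) ->
    exists phi, [/\ smooth K phi, (forall x, `|phi x| <= M) &
      forall x, `|phi x - g x| <= 2 * (L * rho)].
Proof.
move=> r0 L0; have rn : rho != 0 by rewrite gt_eqF.
(* The three terms are Lipschitz constants of [phi] and of its first two derivatives; none depends
   on [g]. *)
pose K := L + 2 * L / rho + 4 * L / rho ^+ 2.
have K1 : 0 <= 2 * L / rho by rewrite divr_ge0 ?mulr_ge0// ltW.
have K2 : 0 <= 4 * L / rho ^+ 2 by rewrite divr_ge0 ?mulr_ge0 ?exprn_ge0// ltW.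
have K0 : 0 <= K by rewrite /K !addr_ge0.
exists K; split=> // g gL gM.
have cg := lipschitz_continuous gL.
pose g1 := average rho g.
have g1L : lipschitz L g1 by exact: average_lipschitz.
have cg1 := lipschitz_continuous g1L.
pose phi := average rho g1.
have phiL : lipschitz L phi by exact: average_lipschitz.
pose a x := (g1 (x + rho) - g1 x) / rho.
pose dg1 x := (g (x + rho) - g x) / rho.
pose b x := (dg1 (x + rho) - dg1 x) / rho.
have dphi (x : R) : is_derive x 1 phi (a x) by exact: average_derive.
have dg (x : R) : is_derive x 1 g1 (dg1 x) by exact: average_derive.
have da (x : R) : is_derive x 1 a (b x).
  have d2 : is_derive x 1 (g1 \o shift rho) (dg1 (x + rho)).
    rewrite -[dg1 (x + rho)]mulr1.
    exact: (@is_derive1_comp _ g1 (shift rho) x _ 1 (dg _) (is_derive_shift x 1 rho)).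
  have := @is_deriveZ _ _ _ _ rho^-1 x 1 _ (@is_deriveB _ _ _ _ _ x 1 _ _ d2 (dg x)).
  rewrite /GRing.scale/= mulrC -/(b x); congr is_derive.
  by apply/funext => y; rewrite /a mulrC.
have divB (u v w z e : R) : `|u - w| <= e -> `|v - z| <= e ->
    `|(u - v) / rho - (w - z) / rho| <= 2 * e / rho.
  move=> uw vz; rewrite -mulrBl normrM [X in _ * X]ger0_norm ?invr_ge0 ?(ltW r0)//.
  rewrite ler_wpM2r ?invr_ge0 ?(ltW r0)// (_ : _ - _ = (u - w) - (v - z)); last by ring.
  by rewrite (le_trans (ler_normB _ _))// [leRHS]mulr_natl [leRHS]mulr2n lerD.
have divN (u v e : R) : `|u - v| <= e -> `|(u - v) / rho| <= e / rho.
  move=> uv; rewrite normrM [X in _ * X]ger0_norm ?invr_ge0 ?(ltW r0)//.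
  by rewrite ler_wpM2r ?invr_ge0 ?(ltW r0).
have dg1L x y : `|dg1 x - dg1 y| <= 2 * (L * `|x - y|) / rho.
  apply: divB; last exact: gL.
  by rewrite (le_trans (gL _ _))// opprD addrACA subrr addr0.
have dg1B x : `|dg1 x| <= L.
  have := divN _ _ _ (gL (x + rho) x).
  by rewrite (_ : x + rho - x = rho) ?(ger0_norm (ltW r0)) ?mulfK//; ring.
have aB x : `|a x| <= L.
  have := divN _ _ _ (g1L (x + rho) x).
  by rewrite (_ : x + rho - x = rho) ?(ger0_norm (ltW r0)) ?mulfK//; ring.
have aL x y : `|a x - a y| <= 2 * L / rho * `|x - y|.
  rewrite [leRHS](_ : _ = 2 * (L * `|x - y|) / rho); last by ring.
  apply: divB; last exact: g1L.
  by rewrite (le_trans (g1L _ _))// opprD addrACA subrr addr0.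
have bL x y : `|b x - b y| <= 4 * L / rho ^+ 2 * `|x - y|.
  rewrite [leRHS](_ : _ = 2 * (2 * (L * `|x - y|) / rho) / rho); last by field.
  apply: divB; last exact: dg1L.
  by rewrite (le_trans (dg1L _ _))// opprD addrACA subrr addr0.
have bB x : `|b x| <= 2 * L / rho.
  rewrite normrM [X in _ * X]ger0_norm ?invr_ge0 ?(ltW r0)//.
  rewrite ler_wpM2r ?invr_ge0 ?(ltW r0)// (le_trans (ler_normB _ _))//.
  by rewrite [leRHS]mulr_natl [leRHS]mulr2n lerD.
have close f x : lipschitz L f -> `|average rho f x - f x| <= L * rho.
  move=> fL; apply: average_dist => //; first exact: lipschitz_continuous fL.
  move=> t xt tx; rewrite (le_trans (fL _ _))// ler_wpM2l// ger0_norm ?subr_ge0//.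
  by rewrite lerBlDl.
have bnd f x : continuous f -> (forall t, `|f t| <= M) -> `|average rho f x| <= M.
  move=> cf fM; rewrite -[average _ _ _]subr0; apply: average_dist => //.
  by move=> t _ _; rewrite subr0.
exists phi; split.
- exists a, b; split.
  + by move=> x y; rewrite (le_trans (phiL _ _))// ler_wpM2r// /K -addrA lerDl addr_ge0.
  + move=> x y; rewrite (le_trans (aL _ _))// ler_wpM2r//.
    by rewrite /K addrAC lerDr addr_ge0.
  + move=> x y; rewrite (le_trans (bL _ _))// ler_wpM2r//.
    by rewrite /K lerDr addr_ge0.
  + move=> x; split.
      by rewrite (le_trans (aB _))// /K -addrA lerDl addr_ge0.
    by rewrite (le_trans (bB _))// /K addrAC lerDr addr_ge0.
  + move=> x y; apply: (taylor2 dphi da) => z _; rewrite (le_trans (bL _ _))// ler_wpM2r//.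
    by rewrite /K lerDr addr_ge0.
- by move=> x; apply: (bnd) => // t; exact: bnd.
- move=> x; rewrite (_ : _ - _ = (phi x - g1 x) + (g1 x - g x)); last by ring.
  rewrite (le_trans (ler_normD _ _))// [leRHS]mulr_natl [leRHS]mulr2n lerD//.
    exact: close.
  exact: close.
Qed.

End smoothing.

Section gauss.
Context (R : realType).

Definition gauss (h : R) (g : R -> R) (x : R) : R :=
  \int[normal_prob 0 (Num.sqrt h)]_y g (x + y).

(** Constant of [normal_moment4], so that the centered normal law of variance [h] has fourth moment
    at most [normal4 * h ^+ 2]. The exact constant is 3. *)
Definition normal4 : R := 48 * expR (1 / 2).

Lemma lipschitz_shift L (f : R -> R) x : lipschitz L f -> lipschitz L (fun y => f (x + y)).
Proof. by move=> fL y z; rewrite (le_trans (fL _ _))// opprD addrACA subrr add0r. Qed.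

Section fixed_variance.
Variable h : R.
Hypothesis h0 : 0 < h.
Local Notation nu := (normal_prob 0 (Num.sqrt h)).

Let sh0 : 0 < Num.sqrt h. Proof. by rewrite sqrtr_gt0. Qed.

Lemma gauss_integrable L M (f : R -> R) x : lipschitz L f -> (forall x, `|f x| <= M) ->
  nu.-integrable setT (EFin \o (fun y => f (x + y))).
Proof.
move=> fL fM; apply: (@bounded_integrable _ _ R nu _ M) => //.
exact: (lipschitz_measurable (lipschitz_shift x fL)).
Qed.

Lemma gauss_bounded L M (f : R -> R) x : lipschitz L f -> (forall x, `|f x| <= M) ->
  `|gauss h f x| <= M.
Proof.
move=> fL fM; apply: (@expect_bounded _ _ R nu) => //.
exact: (lipschitz_measurable (lipschitz_shift x fL)).
Qed.

Lemma gauss_dist L L' M e (f g : R -> R) x : lipschitz L f -> lipschitz L' g ->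
  (forall x, `|f x| <= M) -> (forall x, `|g x| <= M) ->
  (forall x, `|f x - g x| <= e) -> `|gauss h f x - gauss h g x| <= e.
Proof.
move=> fL gL fM gM fg; apply: (@expect_dist _ _ R nu) => //.
- exact: gauss_integrable fL fM.
- exact: gauss_integrable gL gM.
Qed.

Lemma gauss_lipschitz L M (f : R -> R) : lipschitz L f -> (forall x, `|f x| <= M) ->
  lipschitz L (gauss h f).
Proof.
move=> fL fM x z; apply: (@expect_dist _ _ R nu) => //.
- exact: gauss_integrable fL fM.
- exact: gauss_integrable fL fM.
- by move=> y; rewrite (le_trans (fL _ _))// opprD addrACA subrr addr0.
Qed.

(** The Taylor inequality is integrated in the base point. As [K] is unchanged, any number of
    Gaussian steps may be applied. *)
Lemma gauss_smooth K M (f : R -> R) : smooth K f -> (forall x, `|f x| <= M) ->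
  smooth K (gauss h f).
Proof.
move=> [a [b [fK aK bK abB taylor]]] fM.
have aB x : `|a x| <= K by have [] := abB x.
have bB x : `|b x| <= K by have [] := abB x.
exists (gauss h a), (gauss h b); split.
- exact: gauss_lipschitz fK fM.
- exact: gauss_lipschitz aK aB.
- exact: gauss_lipschitz bK bB.
- by move=> x; split; [exact: gauss_bounded aK aB|exact: gauss_bounded bK bB].
move=> x y.
have i1 z := gauss_integrable z fK fM.
have i2 := gauss_integrable x aK aB.
have i3 := gauss_integrable x bK bB.
have i2y : nu.-integrable setT (EFin \o (fun z : R => a (x + z) * y)).
  exact: (integrableZr measurableT y i2).
have i3y : nu.-integrable setT (EFin \o (fun z : R => b (x + z) * (y ^+ 2 / 2))).
  exact: (integrableZr measurableT (y ^+ 2 / 2) i3).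
have i4 := integrableB measurableT (i1 (x + y)) (i1 x).
have i5 := integrableB measurableT i4 i2y.
have i6 := integrableB measurableT i5 i3y.
rewrite -mulrA /gauss -(RintegralZr _ measurableT i2) -(RintegralZr _ measurableT i3).
rewrite -(RintegralB measurableT (i1 (x + y)) (i1 x)).
rewrite -(RintegralB measurableT i4 i2y) -(RintegralB measurableT i5 i3y).
apply: le_trans (le_normr_Rintegral measurableT i6) _.
rewrite -[leRHS](expect_cst nu); apply: (@le_expect _ _ R nu).
- exact: integrable_norm i6.
- by apply: (@bounded_integrable _ _ R nu _ `|K * `|y| ^+ 3|).
- by move=> z; have := taylor (x + z) y; rewrite mulrA (addrAC x y z).
Qed.

(** The linear term has mean 0 and the quadratic one mean [h]. The cubic remainder is split by
    [|y|^3 <= theta y^2 + y^4 / theta], so that only even moments occur; [theta] remains free. *)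
Lemma gauss_expansion K M theta (f a b : R -> R) x : 0 < theta ->
  lipschitz K f -> (forall x, `|f x| <= M) -> 0 <= K ->
  (forall x y, `|f (x + y) - f x - a x * y - b x * y ^+ 2 / 2| <= K * `|y| ^+ 3) ->
  `|gauss h f x - f x - b x * h / 2| <= K * (theta * h + normal4 * h ^+ 2 / theta).
Proof.
move=> t0 fK fM K0 taylor.
have i0 := gauss_integrable x fK fM.
have ic c : nu.-integrable setT (EFin \o (fun _ : R => c)).
  by apply: (@bounded_integrable _ _ R nu _ `|c|).
have i1 : nu.-integrable setT (EFin \o (fun y : R => y)).
  by have := normal_integrable_pow sh0 1; congr integrable; apply/funext => y /=; rewrite expr1.
have i2 := normal_integrable_pow sh0 2.
have i4 := normal_integrable_pow sh0 4.
have ia : nu.-integrable setT (EFin \o (fun y : R => a x * y)).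
  exact: (integrableZl measurableT (a x) i1).
have ib : nu.-integrable setT (EFin \o (fun y : R => b x / 2 * y ^+ 2)).
  exact: (integrableZl measurableT (b x / 2) i2).
have j1 := integrableB measurableT i0 (ic (f x)).
have j2 := integrableB measurableT j1 ia.
have j3 := integrableB measurableT j2 ib.
have E : \int[nu]_y (f (x + y) - f x - a x * y - b x / 2 * y ^+ 2) =
    gauss h f x - f x - b x * h / 2.
  rewrite (RintegralB measurableT j2 ib) (RintegralB measurableT j1 ia).
  rewrite (RintegralB measurableT i0 (ic (f x))).
  rewrite (RintegralZl _ measurableT i1) (RintegralZl _ measurableT i2).
  rewrite (expect_cst nu) normal_moment1// normal_moment2// mulr0 subr0.
  by rewrite sqr_sqrtr ?(ltW h0)// mulrAC.
rewrite -E; apply: le_trans (le_normr_Rintegral measurableT j3) _.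
have k2 : nu.-integrable setT (EFin \o (fun y : R => K * theta * y ^+ 2)).
  exact: (integrableZl measurableT (K * theta) i2).
have k4 : nu.-integrable setT (EFin \o (fun y : R => K / theta * y ^+ 4)).
  exact: (integrableZl measurableT (K / theta) i4).
apply: (@le_trans _ _ (\int[nu]_y (K * theta * y ^+ 2 + K / theta * y ^+ 4))).
  apply: (@le_expect _ _ R nu).
  - exact: integrable_norm j3.
  - exact: (integrableD measurableT k2 k4).
  - move=> y; rewrite (_ : b x / 2 * y ^+ 2 = b x * y ^+ 2 / 2); last by ring.
    rewrite (le_trans (taylor x y))//.
    rewrite (_ : _ + _ = K * (theta * y ^+ 2 + y ^+ 4 / theta)); last by ring.
    rewrite ler_wpM2l// -(real_normK (num_real y)) (_ : y ^+ 4 = (y ^+ 2) ^+ 2); last by ring.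
    rewrite -(real_normK (num_real y)); set v := `|y|; have v0 : 0 <= v by exact: normr_ge0.
    rewrite -subr_ge0 (_ : _ - _ = v ^+ 2 * (theta - v + v ^+ 2 / theta)); last by ring.
    rewrite mulr_ge0 ?exprn_ge0//.
    rewrite (_ : _ - _ + _ = ((theta - v) ^+ 2 + theta * v) / theta); last first.
      by field; rewrite gt_eqF.
    by rewrite divr_ge0 ?(ltW t0)// addr_ge0 ?sqr_ge0// mulr_ge0// ltW.
rewrite (RintegralD measurableT k2 k4).
rewrite (RintegralZl _ measurableT i2) (RintegralZl _ measurableT i4).
rewrite normal_moment2// sqr_sqrtr ?(ltW h0)//.
have := normal_moment4 sh0; rewrite -/normal4.
rewrite (_ : Num.sqrt h ^+ 4 = h ^+ 2); last first.
  by rewrite -[in RHS](sqr_sqrtr (ltW h0)); ring.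
move=> m4.
rewrite [leRHS](_ : _ = K * theta * h + K / theta * (normal4 * h ^+ 2)); last by ring.
by rewrite lerD2l ler_wpM2l// divr_ge0// ltW.
Qed.

End fixed_variance.
End gauss.

(** * The central limit theorem for one increment *)

Section block.
Context (R : realType).
Variables (lambda c : R).
Hypotheses (lambda0 : 0 < lambda) (c0 : 0 < c).

Lemma sigmaE n : (0 < n)%N -> (sigma_ lambda c n * c) ^+ 2 = lambda / n%:R.
Proof.
move=> n0; rewrite /sigma_ mulrAC mulVf ?gt_eqF// mul1r sqr_sqrtr//.
by rewrite divr_ge0// ltW.
Qed.

Lemma sigma_ge0 n : 0 <= sigma_ lambda c n.
Proof. by rewrite mulr_ge0 ?invr_ge0 ?sqrtr_ge0// ltW. Qed.

Section scaled_moments.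
Variables (eta : R) (n r : nat).
Hypotheses (eta0 : 0 < eta) (n0 : (0 < n)%N) (r0 : (0 < r)%N).
(** A block lasts [eta] in rescaled time, that is [n * eta] in the time of [X], and has [r] cells of
    length [delta]. [kappa] converts a step of the walk into a rescaled displacement. *)
Let delta := n%:R * eta / r%:R.
Hypothesis delta1 : 2 * (lambda * delta) <= 1.
Let q := poisson_odd (lambda * delta).
Let kappa := sigma_ lambda c n * delta.

Let nR : (0 : R) < n%:R. Proof. by rewrite ltr0n. Qed.
Let rR : (0 : R) < r%:R. Proof. by rewrite ltr0n. Qed.
Let delta0 : 0 < delta. Proof. by rewrite divr_gt0// mulr_gt0. Qed.
Let ld0 : 0 < lambda * delta. Proof. exact: mulr_gt0. Qed.

Let kc2 : (kappa * c) ^+ 2 = lambda * delta ^+ 2 / n%:R.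
Proof. by rewrite /kappa mulrAC exprMn sigmaE// mulrAC. Qed.

(** Reversals keep the mean displacement bounded whatever the length of the block, so the rescaling
    removes it. *)
Lemma scaled_mom1 : 0 <= kappa * c * mom1 q r <= Num.sqrt (lambda / n%:R) / lambda.
Proof.
have [q0 q2 q01 _ qV] := poisson_odd_small ld0 delta1.
have /andP[a0 a1] := mom1_bound q0 q2 r.
have k0 : 0 <= kappa * c.
  by apply: mulr_ge0; [apply: mulr_ge0; [exact: sigma_ge0|exact: ltW]|exact: ltW].
rewrite mulr_ge0//=.
apply: (@le_trans _ _ (kappa * c * (2 * (lambda * delta)^-1 / 2))).
  by rewrite ler_wpM2l// (le_trans a1)// ler_wpM2r// invr_ge0.
rewrite /kappa /sigma_ le_eqVlt; apply/orP; left; apply/eqP; field.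
by rewrite !gt_eqF.
Qed.

(** With [q] close to [lambda * delta] and [mom2] close to [r / q], the product is close to [(lambda
    delta^2 / n) * r / (lambda delta) = eta]: this is where the normalisation [sigma_] comes from.
    The first error vanishes with the mesh, the second as [n] grows. *)
Lemma scaled_mom2 :
  `|(kappa * c) ^+ 2 * mom2 q r - eta| <= 3 * (lambda * eta * delta) + 4 / (lambda * n%:R).
Proof.
have [q0 q2 q01 /andP[qV1 qV2] qV] := poisson_odd_small ld0 delta1.
have /andP[b0 b1] := mom2_bound q0 q2 r.
rewrite kc2; set A := lambda * delta ^+ 2 / n%:R.
have A0 : 0 <= A by rewrite divr_ge0 ?mulr_ge0 ?exprn_ge0// ltW.
have rd : r%:R * delta = n%:R * eta by rewrite /delta; field; rewrite gt_eqF.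
have e1 : A * (r%:R * (lambda * delta)^-1) = eta.
  by rewrite /A /delta; field; rewrite ?gt_eqF.
have e2 : A * (r%:R * 2) = 2 * (lambda * eta * delta).
  by rewrite /A /delta; field; rewrite ?gt_eqF.
have e3 : A * (2 * (lambda * delta)^-1) ^+ 2 = 4 / (lambda * n%:R).
  by rewrite /A; field; rewrite !gt_eqF.
have u1 : A * mom2 q r <= eta + 2 * (lambda * eta * delta).
  rewrite -e2 -{1}e1 -mulrDr ler_wpM2l// (le_trans b1)// -mulrDr.
  by rewrite ler_wpM2l// ltW.
have u2 : eta - (lambda * eta * delta) - 4 / (lambda * n%:R) <= A * mom2 q r.
  have e2' : lambda * eta * delta = A * r%:R by rewrite /A /delta; field; rewrite ?gt_eqF.
  rewrite -e3 e2' -{1}e1 -!mulrBr ler_wpM2l//.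
  apply: le_trans b0; rewrite opprD addrA lerB//.
    by rewrite lerB// ler_wpM2l// ltW.
  by rewrite lerXn2r// nnegrE ?invr_ge0 ?mulr_ge0 ?invr_ge0 ?ltW.
have led : 0 <= lambda * eta * delta by rewrite !mulr_ge0// ltW.
have ln : 0 <= 4 / (lambda * n%:R) by rewrite divr_ge0// mulr_ge0// ltW.
rewrite ler_norml; apply/andP; split; lra.
Qed.

Lemma scaled_mom2_le : (kappa * c) ^+ 2 * mom2 q r <= 2 * eta.
Proof.
have [q0 q2 q01 _ qV] := poisson_odd_small ld0 delta1.
have /andP[_ b1] := mom2_bound q0 q2 r.
apply: (@le_trans _ _ ((kappa * c) ^+ 2 * (r%:R * (2 * (lambda * delta)^-1)))).
  apply: ler_wpM2l; first exact: sqr_ge0.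
  by apply: le_trans b1 _; exact: ler_wpM2l.
rewrite kc2 le_eqVlt; apply/orP; left; apply/eqP; rewrite /delta; field.
by rewrite !gt_eqF.
Qed.

Lemma scaled_mom4 : 0 <= mom4 q r /\ (kappa * c) ^+ 4 * mom4 q r <= 32 * eta ^+ 2.
Proof.
have [q0 q2 q01 _ qV] := poisson_odd_small ld0 delta1.
have /andP[m0 m4] := mom4_bound q0 q2 r; split=> //.
have -> : (kappa * c) ^+ 4 = ((kappa * c) ^+ 2) ^+ 2 by rewrite -exprM.
apply: (@le_trans _ _ (((kappa * c) ^+ 2) ^+ 2 *
    (8 * r%:R ^+ 2 * (2 * (lambda * delta)^-1) ^+ 2))).
  apply: ler_wpM2l; first exact: sqr_ge0.
  apply: le_trans m4 _; apply: ler_wpM2l; first by rewrite mulr_ge0// exprn_ge0.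
  by rewrite lerXn2r// nnegrE ?invr_ge0 ?mulr_ge0 ?invr_ge0 ?ltW.
rewrite kc2 le_eqVlt; apply/orP; left; apply/eqP; rewrite /delta; field.
by rewrite !gt_eqF.
Qed.

(* The three groups of terms bound the first moment, the error in the second
   moment and, through [|y|^3 <= theta y^2 + y^4 / theta], the Taylor remainder. *)
Definition block_error theta : R := Num.sqrt (lambda / n%:R) / lambda +
  (3 * (lambda * eta * delta) + 4 / (lambda * n%:R)) / 2 +
  (3 * (theta * eta) + (32 + normal4 R) * eta ^+ 2 / theta).

(** Both averages are compared through the second-order Taylor polynomial at [x], on which the walk
    operator is explicit. The sign of [v] enters only the first moment, which is small in absolute
    value. *)
Lemma block_estimate K M theta phi x v : 0 < theta -> 0 <= K ->
  smooth K phi -> (forall x, `|phi x| <= M) -> v = c \/ v = - c ->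
  `|iter r (step q) (fun s _ => phi (x + kappa * s)) 0 v - gauss eta phi x| <=
  K * block_error theta.
Proof.
move=> t0 K0 [a [b [phiK aK bK abB taylor]]] phiM vc.
have [q0 q2 q01 _ qV] := poisson_odd_small ld0 delta1.
have [aB bB] := abB x.
have v2 : v ^+ 2 = c ^+ 2 by case: vc => ->; rewrite ?sqrrN.
pose w := iter r (step q) (fun s _ => phi (x + kappa * s)) 0 v.
pose p1 (s _ : R) := phi x * 1 + a x * kappa * s.
pose psi (s v : R) := 1 * p1 s v + b x * kappa ^+ 2 / 2 * s ^+ 2.
have psiE : iter r (step q) psi 0 v =
    phi x + a x * (kappa * v * mom1 q r) + b x * ((kappa * c) ^+ 2 * mom2 q r) / 2.
  rewrite /psi iter_step_linear (iter_step_pow2 q r 0 v) /p1.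
  rewrite (iter_step_linear q (phi x) (a x * kappa) (fun _ _ => 1) (fun s _ => s)).
  rewrite iter_step_cst iter_step_pow1 (exprMn _ kappa c) -v2; ring.
pose E (s _ : R) := K * theta * kappa ^+ 2 * s ^+ 2 + K / theta * kappa ^+ 4 * s ^+ 4.
have EE : iter r (step q) E 0 v = K * (theta * ((kappa * c) ^+ 2 * mom2 q r) +
    (kappa * c) ^+ 4 * mom4 q r / theta).
  rewrite /E iter_step_linear (iter_step_pow2 q r 0 v) (iter_step_pow4 q r 0 v).
  rewrite (exprMn 2 kappa c) (exprMn 4 kappa c) (_ : c ^+ 4 = (c ^+ 2) ^+ 2); last by ring.
  by rewrite -v2; ring.
have tay s : `|phi (x + kappa * s) - psi s v| <= E s v.
  have := taylor x (kappa * s).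
  rewrite (_ : phi (x + kappa * s) - psi s v = phi (x + kappa * s) - phi x -
    a x * (kappa * s) - b x * (kappa * s) ^+ 2 / 2); last by rewrite /psi /p1; ring.
  move=> /le_trans; apply.
  set y := kappa * s.
  rewrite (_ : E s v = K * (theta * y ^+ 2 + (y ^+ 2) ^+ 2 / theta)); last by rewrite /E /y; ring.
  rewrite ler_wpM2l// -(real_normK (num_real y)); set z := `|y|.
  have z0 : 0 <= z by exact: normr_ge0.
  rewrite -subr_ge0 (_ : _ - _ = z ^+ 2 * (theta - z + z ^+ 2 / theta)); last by ring.
  rewrite mulr_ge0 ?exprn_ge0//.
  rewrite (_ : _ - _ + _ = ((theta - z) ^+ 2 + theta * z) / theta); last first.
    by field; rewrite gt_eqF.
  by rewrite divr_ge0 ?(ltW t0)// addr_ge0 ?sqr_ge0// mulr_ge0// ltW.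
have h1 : `|w - iter r (step q) psi 0 v| <= iter r (step q) E 0 v.
  have Elin (A B : R -> R -> R) : iter r (step q) A 0 v - iter r (step q) B 0 v =
      iter r (step q) (fun s v => 1 * A s v + (-1) * B s v) 0 v.
    by rewrite iter_step_linear; ring.
  rewrite ler_norml Elin.
  have -> : - iter r (step q) E 0 v = iter r (step q) (fun s v => (-1) * E s v + 0 * 0) 0 v.
    by rewrite (iter_step_linear q (-1) 0 E (fun _ _ => 0)); ring.
  apply/andP; split; apply: le_iter_step => // s u; have := tay s;
    rewrite ler_norml => /andP[]; rewrite /psi /p1 /E; lra.
have h2 := gauss_expansion eta0 x t0 phiK phiM K0 taylor.
have /andP[_ m1] := scaled_mom1; have m2 := scaled_mom2.
have m2' := scaled_mom2_le; have [m40 m4] := scaled_mom4.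
rewrite -/w (_ : w - _ = (w - iter r (step q) psi 0 v) +
  a x * (kappa * v * mom1 q r) + b x * (((kappa * c) ^+ 2 * mom2 q r - eta) / 2) -
  (gauss eta phi x - phi x - b x * eta / 2)); last by rewrite psiE; ring.
rewrite (le_trans (ler_normB _ _))//.
apply: (le_trans (lerD (le_trans (ler_normD _ _) (lerD (ler_normD _ _) (lexx _))) h2)).
have k1 : `|a x * (kappa * v * mom1 q r)| <= K * (Num.sqrt (lambda / n%:R) / lambda).
  rewrite normrM ler_pM//.
  have -> : `|kappa * v * mom1 q r| = kappa * c * mom1 q r.
    have /andP[b0 _] := scaled_mom1.
    by case: vc => ->; rewrite ?mulrN ?mulNr ?normrN ger0_norm.
  exact: m1.
have k2 : `|b x * (((kappa * c) ^+ 2 * mom2 q r - eta) / 2)| <=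
    K * ((3 * (lambda * eta * delta) + 4 / (lambda * n%:R)) / 2).
  rewrite normrM ler_pM// normrM [X in _ * X]ger0_norm ?invr_ge0//.
  by rewrite ler_pM2r ?invr_gt0.
have k3 : `|w - iter r (step q) psi 0 v| <= K * (theta * (2 * eta) + 32 * eta ^+ 2 / theta).
  rewrite (le_trans h1)// EE ler_wpM2l// lerD//; first by rewrite ler_pM2l.
  by rewrite ler_pM2r ?invr_gt0.
rewrite /block_error [leRHS](_ : _ = K * (theta * (2 * eta) + 32 * eta ^+ 2 / theta) +
  K * (Num.sqrt (lambda / n%:R) / lambda) +
  K * ((3 * (lambda * eta * delta) + 4 / (lambda * n%:R)) / 2) +
  K * (theta * eta + normal4 R * eta ^+ 2 / theta)); last by ring.
by rewrite lerD2r lerD// lerD.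
Qed.

End scaled_moments.
End block.

Section law.
Context d (T : measurableType d) (R : realType) (P : probability T R).

Lemma expect_law (nu : probability (measurableTypeR R) R) (W : T -> R)
    (f : R -> R) (M : R) : measurable_fun setT W ->
  (forall A, measurable A -> P (W @^-1` A) = nu A) ->
  measurable_fun setT f -> (forall x, `|f x| <= M) ->
  \int[P]_w f (W w) = \int[nu]_y f y.
Proof.
move=> mW WA mf fM.
have ifW : P.-integrable setT (EFin \o (fun w => f (W w))).
  by apply: (@bounded_integrable _ _ _ _ _ M) => //; exact: measurableT_comp.
rewrite /Rintegral; congr fine.
transitivity (\int[pushforward P (W : T -> measurableTypeR R)]_y (f y)%:E)%E; last first.
  by apply: eq_measure_integral => A mA _; exact: WA.
have mf' : measurable_fun setT (EFin \o f) by exact/measurable_EFinP.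
rewrite [RHS](@integral_pushforward _ _ T (measurableTypeR R) R W mW P setT
  (EFin \o f) mf' ifW measurableT).
by [].
Qed.

End law.

Lemma gauss_shift (R : realType) h (g : R -> R) x : gauss h (fun y => g (x + y)) 0 = gauss h g x.
Proof. by apply: eq_Rintegral => y _; rewrite add0r. Qed.

(** * Gaussian averages and Brownian increments *)

Section brownian.
Context d (T : measurableType d) (R : realType) (P : probability T R).
Variables (B : R -> T -> R).
Hypothesis hB : brownian_motion P B.

Lemma expect_brownian_incr s t (f : R -> R) L M : 0 <= s -> s < t ->
  lipschitz L f -> (forall x, `|f x| <= M) ->
  \int[P]_w f (B t w - B s w) = gauss (t - s) f 0.
Proof.
move=> s0 st fL fM; rewrite /gauss.
under [RHS]eq_Rintegral do rewrite add0r.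
apply: (@expect_law _ _ _ P (normal_prob 0 (Num.sqrt (t - s))) _ _ M) => //.
- apply: measurable_funB; apply: (brownian_motion_meas hB) => //.
  exact: le_trans (ltW st).
- by move=> A mA; exact: (brownian_motion_law hB).
- exact: lipschitz_measurable fL.
Qed.

Definition brownian_incr (t : nat -> R) (k : nat) (w : T) : R := B (t k.+1) w - B (t k) w.

Lemma brownian_incr_indep (t : nat -> R) : 0 <= t 0%N -> (forall k, t k <= t k.+1) ->
  independent_seq P (brownian_incr t).
Proof.
by move=> t0 tt; apply: mutually_independent_seq; exact: (brownian_motion_indep hB).
Qed.

Lemma measurable_brownian_incr (t : nat -> R) k : 0 <= t 0%N -> (forall k, t k <= t k.+1) ->
  measurable_fun setT (brownian_incr t k).
Proof.
move=> t0 tt; have tk j : 0 <= t j by elim: j => // j /le_trans; apply.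
by apply: measurable_funB; exact: (brownian_motion_meas hB).
Qed.

(** Adding two consecutive increments of [B] and integrating out the second one proves the
    convolution property of normal laws. *)
Lemma gauss_add h1 h2 (g : R -> R) L M x : 0 < h1 -> 0 < h2 -> 0 <= L ->
  lipschitz L g -> (forall x, `|g x| <= M) ->
  gauss h1 (gauss h2 g) x = gauss (h1 + h2) g x.
Proof.
move=> h10 h20 L0 gL gM.
(* Times 0, [h1], [h1 + h2], constant afterwards: independence is stated for infinite nondecreasing
   sequences of times. *)
pose t (k : nat) := if k is k'.+1 then if k' is _.+1 then h1 + h2 else h1 else 0.
have t0 : 0 <= t 0%N by [].
have tt k : t k <= t k.+1.
  by case: k => [|[|k]] /=; rewrite ?lexx ?(ltW h10)// lerDl ltW.
have shiftB y z : `|g (y + z)| <= M by [].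
pose G (u : nat -> R) := g (x + u 0%N + u 1%N).
have cG : seq_continuous 2 G.
  move=> x_ u xu.
  have H : (x + x_ i 0%N + x_ i 1%N) @[i --> \oo] --> x + u 0%N + u 1%N.
    by apply: cvgD; [apply: cvgD; [exact: cvg_cst|exact: xu]|exact: xu].
  exact: (cvg_comp _ _ H (@lipschitz_continuous R L g gL (x + u 0%N + u 1%N))).
have E1 : \int[P]_w G (brownian_incr t ^~ w) = gauss (h1 + h2) g x.
  transitivity (\int[P]_w g (x + (B (h1 + h2) w - B 0 w))).
    apply: eq_Rintegral => w _; rewrite /G /brownian_incr/=; congr g; ring.
  have h12 : 0 < h1 + h2 by exact: addr_gt0.
  rewrite (expect_brownian_incr (lexx 0) h12 (lipschitz_shift x gL) (shiftB x)).
  by rewrite subr0; exact: gauss_shift.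
rewrite -E1.
have mD k : measurable_fun setT (brownian_incr t k) by exact: measurable_brownian_incr.
have GM u : `|G u| <= M by exact: gM.
rewrite (expect_integrate_last cG GM mD (brownian_incr_indep t0 tt)).
have I u : integrate_last P (brownian_incr t) 1 G u = gauss h2 g (x + u 0%N).
  rewrite /integrate_last /G /upd/= /brownian_incr/=.
  have h12 : h1 < h1 + h2 by rewrite ltrDl.
  rewrite (expect_brownian_incr (ltW h10) h12 (lipschitz_shift (x + u 0%N) gL) (shiftB _)).
  by rewrite (_ : h1 + h2 - h1 = h2); [exact: gauss_shift|ring].
under [RHS]eq_Rintegral do rewrite I /brownian_incr/=.
have gL2 := gauss_lipschitz h2 gL gM.
have shiftM y : `|gauss h2 g (x + y)| <= M by exact: (gauss_bounded h2 _ gL gM).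
rewrite (expect_brownian_incr (lexx 0) h10 (lipschitz_shift x gL2) shiftM) subr0.
by apply/esym; exact: gauss_shift.
Qed.

Lemma iter_gauss h (g : R -> R) L M l x : 0 < h -> 0 <= L ->
  lipschitz L g -> (forall x, `|g x| <= M) ->
  iter l.+1 (gauss h) g x = gauss (l.+1%:R * h) g x.
Proof.
move=> h0 L0 gL gM; elim: l x => [|l IH] x; first by rewrite mul1r; exact: erefl.
rewrite iterS (_ : iter l.+1 (gauss h) g = gauss (l.+1%:R * h) g); last exact/funext.
have lh0 : 0 < l.+1%:R * h by rewrite mulr_gt0.
have -> : l.+2%:R * h = h + l.+1%:R * h by rewrite -(natr1 l.+1); ring.
exact: (gauss_add x h0 lh0 L0 gL gM).
Qed.

End brownian.

(** * Lindeberg exchange inside one increment *)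

Section core.
Context (R : realType).
Variables (lambda c : R).
Hypotheses (lambda0 : 0 < lambda) (c0 : 0 < c).

Lemma iter_gauss_smooth eta K M (phi : R -> R) l : 0 < eta -> smooth K phi ->
  (forall x, `|phi x| <= M) ->
  smooth K (iter l (gauss eta) phi) /\ (forall x, `|iter l (gauss eta) phi x| <= M).
Proof.
move=> e0 phiK phiM; elim: l => // l [IH1 IH2]; split; first exact: gauss_smooth IH1 IH2.
by move=> x; have [a [b [h _ _ _ _]]] := IH1; exact: (gauss_bounded eta x h IH2).
Qed.

(** The first block is compared with a Gaussian step applied to the function already averaged over
    the other blocks. These start from velocity [v] or [- v], and the induction hypothesis covers
    both, so the errors simply add up. *)
Lemma blocks_estimate (eta : R) (n r : nat) K M theta (phi : R -> R) l x v :
  let delta := n%:R * eta / r%:R in let kappa := sigma_ lambda c n * delta in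
  0 < eta -> (0 < n)%N -> (0 < r)%N -> 2 * (lambda * delta) <= 1 ->
  0 < theta -> 0 <= K -> smooth K phi -> (forall x, `|phi x| <= M) ->
  v = c \/ v = - c ->
  `|iter (l * r) (step (poisson_odd (lambda * delta)))
      (fun s _ => phi (x + kappa * s)) 0 v - iter l (gauss eta) phi x| <=
  l%:R * (K * block_error lambda eta n r theta).
Proof.
move=> delta kappa e0 n0 r0 d1 t0 K0 phiK phiM.
set q := poisson_odd _; set be := K * _.
have d0 : 0 < delta by rewrite divr_gt0 ?mulr_gt0 ?ltr0n.
have [_ _ q01 _ _] := poisson_odd_small (mulr_gt0 lambda0 d0) d1.
elim: l x v => [|l IH] x v vc.
  by rewrite mul0n/= mulr0 addr0 subrr normr0 mul0r.
have [psiK psiM] := iter_gauss_smooth l e0 phiK phiM.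
rewrite mulSn iterD iterS; set psi := iter l (gauss eta) phi in psiK psiM *.
have h1 := block_estimate lambda0 c0 e0 n0 r0 d1 x t0 K0 psiK psiM vc.
have IH' u s : u = c \/ u = - c -> `|iter (l * r) (step q)
    (fun s _ => phi (x + kappa * s)) s u - psi (x + kappa * s)| <= l%:R * be.
  move=> uc; rewrite -[s in iter _ _ _ s]addr0 -iter_step_shift.
  rewrite (_ : (fun s0 (_ : R) => phi (x + kappa * (s + s0))) =
    (fun s0 _ => phi (x + kappa * s + kappa * s0))); first exact: IH.
  by apply/funext => s0; apply/funext => _; rewrite mulrDr addrA.
have vc' : - v = c \/ - v = - c by case: vc => ->; [right|left; rewrite opprK].
have h2 := @le_iter_step_norm R q (l%:R * be)
  (iter (l * r) (step q) (fun s _ => phi (x + kappa * s)))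
  (fun s _ => psi (x + kappa * s)) r 0 v q01 (fun s => IH' v s vc) (fun s => IH' (- v) s vc').
rewrite -natr1 mulrDl mul1r.
rewrite (_ : _ - _ = (iter r (step q)
    (iter (l * r) (step q) (fun s : R => fun=> phi (x + kappa * s))) 0 v -
  iter r (step q) (fun s _ => psi (x + kappa * s)) 0 v) +
  (iter r (step q) (fun s _ => psi (x + kappa * s)) 0 v - gauss eta psi x)); last by ring.
by rewrite (le_trans (ler_normD _ _))// lerD.
Qed.

End core.

Lemma ratio_small (R : realType) (A e : R) : 0 < e ->
  exists m, forall n, (m < n)%N -> A / n%:R <= e.
Proof.
move=> e0; exists (Num.truncn (`|A| / e)) => n mn.
have n0 : 0 < n%:R :> R by rewrite ltr0n (leq_trans _ mn).
rewrite ler_pdivrMr// (le_trans (ler_norm A))// -ler_pdivrMl// mulrC.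
have Ae0 : 0 <= `|A| / e by rewrite divr_ge0// ltW.
by have := truncnS_gt (`|A| / e) => /ltW/le_trans; apply; rewrite ler_nat.
Qed.

Section core_limit.
Context (R : realType).
Variables (lambda c : R).
Hypotheses (lambda0 : 0 < lambda) (c0 : 0 < c).

(** Summed over [l + 1] blocks of length [h / (l + 1)], the Taylor error is of order
    [theta + 1 / ((l + 1) * theta)]: [theta] is fixed first, then [l]. With [l] fixed, the mean and
    the [1 / n] terms are killed by [n], and the mesh term by [r], for each [n]. *)
Lemma block_error_small K h e : 0 < h -> 0 < e -> 0 <= K ->
  exists l theta n0, 0 < theta /\ forall n, (n0 < n)%N -> exists r0, forall r, (r0 < r)%N ->
    2 * (lambda * (n%:R * (h / l.+1%:R) / r%:R)) <= 1 /\
    l.+1%:R * (K * block_error lambda (h / l.+1%:R) n r theta) <= e.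
Proof.
move=> h0 e0 K0.
have K1 : 0 < K + 1 by rewrite ltr_wpDl.
(* Makes [3 * theta * h * (K + 1)] equal to [e / 4]; [K + 1] guards against [K = 0]. *)
pose theta := e / (12 * h * (K + 1)).
have th0 : 0 < theta by rewrite divr_gt0// !mulr_gt0.
have [l /(_ l.+1 (ltnSn _)) hl] := @ratio_small R
  (K * (32 + normal4 R) * h ^+ 2 / theta) (e / 4) (divr_gt0 e0 (ltr0Sn _ _)).
pose q : R := l.+1%:R.
have q0 : 0 < q by rewrite ltr0n.
(* Threshold for the square root of [lambda / n] that brings the mean term below [e / 8]. *)
pose z := e * lambda / (8 * q * (K + 1)).
have z0 : 0 < z by rewrite divr_gt0 ?mulr_gt0.
have [n1 hn1] := @ratio_small R lambda (z ^+ 2) (exprn_gt0 2 z0).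
have [n2 hn2] := @ratio_small R (q * K * 2 / lambda) (e / 8) (divr_gt0 e0 (ltr0Sn _ _)).
exists l, theta, (maxn n1 n2); split=> // n.
rewrite gtn_max => /andP[n1n n2n].
have {n1n}hn1 := hn1 _ n1n; have hn2' := hn2 _ n2n.
have n0 : (0 < n)%N by rewrite (leq_trans _ n2n).
pose eta := h / q; have eta0 : 0 < eta by exact: divr_gt0.
have [r1 hr1] := @ratio_small R (2 * (lambda * (n%:R * eta))) 1 ltr01.
have [r2 hr2] := @ratio_small R (q * K * (3 / 2) * (lambda * eta * (n%:R * eta))) (e / 4)
  (divr_gt0 e0 (ltr0Sn _ _)).
exists (maxn r1 r2) => r; rewrite gtn_max => /andP[r1r r2r].
have rr0 : (0 < r)%N by rewrite (leq_trans _ r2r).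
have {r1r}hr1 := hr1 _ r1r; have {r2r}hr2 := hr2 _ r2r.
rewrite -/q -/eta; split; first by rewrite (le_trans _ hr1)// !mulrA.
have sz : Num.sqrt (lambda / n%:R) <= z.
  by rewrite -(ger0_norm (ltW z0)) -sqrtr_sqr ler_wsqrtr.
have h1 : q * (K * (Num.sqrt (lambda / n%:R) / lambda)) <= e / 8.
  apply: (@le_trans _ _ (q * ((K + 1) * (z / lambda)))).
    rewrite ler_pM2l//; apply: ler_pM => //; first by rewrite divr_ge0// ?sqrtr_ge0// ltW.
      by rewrite lerDl.
    by rewrite ler_pM2r ?invr_gt0.
  by rewrite le_eqVlt; apply/orP; left; apply/eqP; rewrite /z; field; rewrite !gt_eqF.
have h2 : q * (K * (3 * (theta * eta))) <= e / 4.
  apply: (@le_trans _ _ (q * ((K + 1) * (3 * (theta * eta))))).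
    rewrite ler_pM2l// ler_wpM2r ?lerDl//.
    by rewrite mulr_ge0// mulr_ge0// ltW.
  by rewrite le_eqVlt; apply/orP; left; apply/eqP; rewrite /theta /eta; field; rewrite !gt_eqF.
have -> : q * (K * block_error lambda eta n r theta) =
  q * (K * (Num.sqrt (lambda / n%:R) / lambda)) +
  q * K * (3 / 2) * (lambda * eta * (n%:R * eta)) / r%:R +
  q * K * 2 / lambda / n%:R + q * (K * (3 * (theta * eta))) +
  K * (32 + normal4 R) * h ^+ 2 / theta / q.
  rewrite /block_error /eta; field.
  by rewrite nat1r !gt_eqF// ltr0n.
move: h1 h2 hl hr2 hn2'; rewrite -/q.
set a1 := q * (K * (_ / lambda)); set a2 := q * (K * (3 * _)); set a3 := _ / q.
set a4 := _ / r%:R; set a5 := _ / n%:R.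
lra.
Qed.

(** Smoothing [g] costs [e / 4] on each side and the blocks cost [e / 2]. The thresholds do not
    depend on [g], [x], [v], because the result will be applied to test functions that depend on the
    past. The Brownian motion supplies the semigroup law of [gauss]. *)
Lemma telegraph_clt L M h e : 0 < h -> 0 < e -> 0 <= L ->
  forall d (T : measurableType d) (P : probability T R) (B : R -> T -> R),
  brownian_motion P B ->
  exists l n0, forall n, (n0 < n)%N -> exists r0, forall r, (r0 < r)%N ->
    let delta := n%:R * h / (l.+1 * r)%:R in
    2 * (lambda * delta) <= 1 /\
    forall (g : R -> R) x v, lipschitz L g -> (forall x, `|g x| <= M) -> v = c \/ v = - c ->
    `|iter (l.+1 * r) (step (poisson_odd (lambda * delta)))
        (fun s _ => g (x + sigma_ lambda c n * delta * s)) 0 v - gauss h g x| <= e.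
Proof.
move=> h0 e0 L0 d T P B hB.
pose rho := e / (8 * (L + 1)).
have L1 : 0 < L + 1 by rewrite ltr_wpDl.
have rho0 : 0 < rho by rewrite divr_gt0// mulr_gt0.
have Lrho : 2 * (L * rho) <= e / 4.
  apply: (@le_trans _ _ (2 * ((L + 1) * rho))).
    by rewrite ler_pM2l// ler_pM2r// lerDl.
  by rewrite le_eqVlt; apply/orP; left; apply/eqP; rewrite /rho; field; rewrite gt_eqF.
have [K [K0 sm]] := smoothing M rho0 L0.
have e2 : 0 < e / 2 by rewrite divr_gt0.
have [l [theta [n0 [th0 H]]]] := block_error_small h0 e2 K0.
exists l, n0 => n n0n; have [r0 Hr] := H n n0n; exists r0 => r r0r delta.
have r_gt0 : (0 < r)%N by rewrite (leq_trans _ r0r).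
have n_gt0 : (0 < n)%N by rewrite (leq_trans _ n0n).
have [d1 be] := Hr r r0r.
have rn0 : r%:R != 0 :> R by rewrite pnatr_eq0 -lt0n.
have deltaE : n%:R * (h / l.+1%:R) / r%:R = delta.
  by rewrite /delta natrM; field; rewrite nat1r rn0 ?pnatr_eq0.
split; first by rewrite -deltaE.
move=> g x v gL gM vc.
have [phi [phiK phiM phig]] := sm g gL gM.
have eta0 : 0 < h / l.+1%:R by rewrite divr_gt0.
have [a [b [phiL _ _ _ _]]] := phiK.
have d0 : 0 < delta by rewrite -deltaE divr_gt0 ?mulr_gt0 ?ltr0n.
have d1' : 2 * (lambda * delta) <= 1 by rewrite -deltaE.
have [_ _ q01 _ _] := poisson_odd_small (mulr_gt0 lambda0 d0) d1'.
have B1 := @blocks_estimate R lambda c lambda0 c0 (h / l.+1%:R) n r K M theta phi l.+1 x v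
  eta0 n_gt0 r_gt0 d1 th0 K0 phiK phiM vc.
rewrite deltaE in B1.
have phig' y : `|g y - phi y| <= e / 4 by rewrite distrC (le_trans (phig y)).
have B2 := @le_iter_step_norm R _ (e / 4) (fun s _ => g (x + sigma_ lambda c n * delta * s))
  (fun s _ => phi (x + sigma_ lambda c n * delta * s)) (l.+1 * r) 0 v q01
  (fun s => phig' _) (fun s => phig' _).
have B3 : `|gauss h phi x - gauss h g x| <= e / 4.
  apply: (gauss_dist h x phiL gL phiM gM) => y; exact: le_trans (phig y) Lrho.
have E : iter l.+1 (gauss (h / l.+1%:R)) phi x = gauss h phi x.
  rewrite (iter_gauss hB l x eta0 K0 phiL phiM).
  by congr (gauss _ phi x); rewrite mulrC divfK// pnatr_eq0.
rewrite E in B1.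
move: B1 B2 B3 be.
set A := iter _ _ (fun s _ => g _) 0 v; set A' := iter _ _ _ 0 v.
set G1 := gauss _ phi x; set G2 := gauss _ g x; set bb := l.+1%:R * _.
move=> B1 B2 B3 be.
have -> : A - G2 = (A - A') + (A' - G1) + (G1 - G2) by ring.
have := ler_normD (A - A' + (A' - G1)) (G1 - G2); have := ler_normD (A - A') (A' - G1).
move: B1 B2 B3 be; lra.
Qed.

End core_limit.

(** * Finite-dimensional convergence *)

Section coordinate_lipschitz.
Context (R : realType).

Definition coord_lipschitz (m : nat) (L : R) (G : (nat -> R) -> R) :=
  forall x y, `|G x - G y| <= L * \sum_(k < m) `|x k - y k|.

Lemma coord_lipschitz_continuous m L G : coord_lipschitz m L G -> seq_continuous m G.
Proof.
move=> GL x_ x xx; apply/cvgrPdist_le => e e0.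
have L1 : 0 < `|L| + 1 by rewrite ltr_wpDl.
have S : (\sum_(k < m) `|x k - x_ i k|) @[i --> \oo] --> (0 : R).
  have E0 : \sum_(k < m) `|x k - x k| = 0 by rewrite big1// => k _; rewrite subrr normr0.
  rewrite -[X in _ --> X]E0.
  apply: (cvg_big (op := +%R)) => [a|k _]; first exact: add_continuous.
  by apply: cvg_norm; apply: cvgB; [exact: cvg_cst|exact: xx].
near=> i; rewrite (le_trans (GL _ _))//.
apply: (@le_trans _ _ ((`|L| + 1) * \sum_(k < m) `|x k - x_ i k|)).
  by rewrite ler_wpM2r ?sumr_ge0// (le_trans (ler_norm L))// lerDl.
rewrite mulrC -ler_pdivlMr//.
have S0 : 0 <= \sum_(k < m) `|x k - x_ i k| by exact: sumr_ge0.
rewrite -[leLHS]ger0_norm// -normrN -[X in `|X|]add0r.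
near: i; move/cvgrPdist_le : S; apply; exact: divr_gt0.
Unshelve. all: by end_near. Qed.

Lemma coord_lipschitz_upd m L G x y : coord_lipschitz m.+1 L G -> 0 <= L ->
  coord_lipschitz m L (fun x => G (upd x m y)) /\ lipschitz L (fun y => G (upd x m y)).
Proof.
move=> GL L0; split=> [u v|u v]; rewrite (le_trans (GL _ _))//; apply: ler_wpM2l => //.
  rewrite big_ord_recr/= /upd eqxx subrr normr0 addr0 le_eqVlt; apply/orP; left.
  by apply/eqP/eq_bigr => i _; rewrite ltn_eqF.
rewrite big_ord_recr/= /upd eqxx big1 ?add0r// => i _.
by rewrite ltn_eqF// subrr normr0.
Qed.

End coordinate_lipschitz.

Lemma le_cvg_dist (R : realType) (u v : nat -> R) (a b e : R) :
  u i @[i --> \oo] --> a -> v i @[i --> \oo] --> b ->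
  (\forall i \near \oo, `|u i - v i| <= e) -> `|a - b| <= e.
Proof.
move=> ua vb uv.
have cu : `|u i - v i| @[i --> \oo] --> `|a - b| by apply: cvg_norm; exact: cvgB.
by rewrite -(cvg_lim _ cu)//; apply: limr_le => //; exact: cvgP cu.
Qed.

Section finite_dimensional.
Context d (T : measurableType d) (R : realType) (P : probability T R).
Context (lambda c : R) (N : R -> T -> nat) (V0 : T -> R).
Hypothesis (lambda0 : 0 < lambda) (c0 : 0 < c).
Hypothesis (hN : poisson_process P lambda N) (mV0 : measurable_fun setT V0).
Hypothesis (hV0 : uniform_pm P c V0) (hV0N : independent_of_process P V0 N).
Context d' (T' : measurableType d') (P' : probability T' R) (B : R -> T' -> R).
Hypothesis hB : brownian_motion P' B.
Variable h : R.
Hypothesis h0 : 0 < h.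

Definition scaled_incr n (w : T) (k : nat) : R :=
  sigma_ lambda c n * telegraph_incr N V0 (n%:R * h) k w.

Let grid (k : nat) : R := k%:R * h.

Let grid0 : 0 <= grid 0%N. Proof. by rewrite /grid mul0r. Qed.

Let gridS k : grid k < grid k.+1.
Proof. by rewrite /grid -[k.+1%:R]natr1 mulrDl mul1r ltrDl. Qed.

Let gridS' k : grid k <= grid k.+1. Proof. exact: ltW. Qed.

Let mBi k : measurable_fun setT (brownian_incr B grid k).
Proof. exact: (measurable_brownian_incr hB). Qed.

Let last_gauss m L M (G : (nat -> R) -> R) x : coord_lipschitz m.+1 L G -> 0 <= L ->
  (forall x, `|G x| <= M) ->
  integrate_last P' (brownian_incr B grid) m G x = gauss h (fun y => G (upd x m y)) 0.
Proof.
move=> GL L0 GM; have [_ gl] := coord_lipschitz_upd x 0 GL L0.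
have gk0 : 0 <= grid m by rewrite mulr_ge0// ltW.
rewrite /integrate_last /brownian_incr.
have gM y : `|G (upd x m y)| <= M by exact: GM.
rewrite (expect_brownian_incr hB gk0 (gridS m) gl gM).
have -> : grid m.+1 - grid m = h by rewrite /grid -natr1; ring.
exact: erefl.
Qed.

Let last_lipschitz m L M (G : (nat -> R) -> R) : coord_lipschitz m.+1 L G -> 0 <= L ->
  (forall x, `|G x| <= M) ->
  coord_lipschitz m L (integrate_last P' (brownian_incr B grid) m G).
Proof.
move=> GL L0 GM x y; have cG := coord_lipschitz_continuous GL.
apply: expect_dist.
- by apply: (bounded_integrable _ (M := M)) => //; exact: measurable_upd cG mBi x.
- by apply: (bounded_integrable _ (M := M)) => //; exact: measurable_upd cG mBi y.
- by move=> w; have [h1 _] := coord_lipschitz_upd x (brownian_incr B grid m w) GL L0.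
Qed.

Let Dr n NN (w : T) (k : nat) : R := sigma_ lambda c n * riemann N V0 (n%:R * h) NN k w.

(* The last increment of the walk is exchanged for a Gaussian one, conditionally
   on the previous ones. *)
Let block_replace m L M G e l n0 : 0 <= L -> coord_lipschitz m.+1 L G ->
  (forall x, `|G x| <= M) ->
  (forall n, (n0 < n)%N -> exists r0, forall r, (r0 < r)%N ->
    let delta := n%:R * h / (l.+1 * r)%:R in
    2 * (lambda * delta) <= 1 /\
    forall (g : R -> R) x v, lipschitz L g -> (forall x, `|g x| <= M) -> v = c \/ v = - c ->
    `|iter (l.+1 * r) (step (poisson_odd (lambda * delta)))
        (fun s _ => g (x + sigma_ lambda c n * delta * s)) 0 v - gauss h g x| <= e) ->
  forall n, (n0 < n)%N -> exists r0, forall r, (r0 < r)%N ->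
    `|\int[P]_w G (Dr n (l.+1 * r) w) -
      \int[P]_w integrate_last P' (brownian_incr B grid) m G (Dr n (l.+1 * r) w)| <= e.
Proof.
move=> L0 GL GM H n n0n; have [r0 Hr] := H n n0n; exists r0 => r r0r.
have n_gt0 : (0 < n)%N by rewrite (leq_trans _ n0n).
have r_gt0 : (0 < r)%N by rewrite (leq_trans _ r0r).
have nh0 : 0 < n%:R * h by rewrite mulr_gt0// ltr0n.
set NN := (l.+1 * r)%N; have NN0 : (0 < NN)%N by rewrite muln_gt0.
have [d1 {}Hr] := Hr r r0r; rewrite -/NN in d1 Hr.
set delta := _ / NN%:R in d1 Hr.
have d0 : 0 < delta by rewrite divr_gt0 ?ltr0n.
have [_ _ q01 _ _] := poisson_odd_small (mulr_gt0 lambda0 d0) d1.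
set sg := sigma_ lambda c n in Hr *.
have cG := coord_lipschitz_continuous GL.
(* The rescaled increments as functions of the signs: [Phi] keeps the earlier ones as functions of
   the past and isolates the increment [m]. *)
pose pre x (j : nat) : R := sg * (delta * pos (j * NN) NN x).
pose Phi x s := G (upd (pre x) m (sg * s)).
set D := sign_seq N V0 delta.
have cPhi x_ x (s_ : nat -> R) s : (forall j, (j < m * NN)%N -> x_ i j @[i --> \oo] --> x j) ->
    s_ i @[i --> \oo] --> s -> Phi (x_ i) (s_ i) @[i --> \oo] --> Phi x s.
  move=> xx ss; apply: cG => k km; rewrite /upd.
  have [_|km'] := eqVneq k m; first by apply: cvgM => //; exact: cvg_cst.
  apply: cvgM; [exact: cvg_cst|apply: cvgM; [exact: cvg_cst|]].
  apply: (@cvg_pos R (k * NN) NN (m * NN)) => //.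
  by rewrite -mulSnr leq_mul2r ltn_neqAle km' -ltnS km orbT.
have PhiM x s : `|Phi x s| <= M by exact: GM.
have E1 := expect_riemann lambda0 hN mV0 hV0N nh0 NN0 d1 cPhi PhiM.
have E2 w : G (Dr n NN w) = Phi (D ^~ w) (riemann N V0 (n%:R * h) NN m w).
  congr G; apply/funext => k; rewrite /upd /Dr; case: eqP => [->//|_].
  by rewrite /pre /riemann.
under eq_Rintegral do rewrite E2.
rewrite E1 -/D -/delta.
have iP := integrable_riemann hN mV0 nh0 NN0 cPhi PhiM q01.
rewrite -/delta -/D in iP.
apply: (expect_as_dist (measurable_velocity_event c mV0) (velocity_event1 c0 mV0 hV0) iP).
  apply: (bounded_integrable _ (M := M)) => [|w]; last exact: integrate_last_bounded cG GM mBi _.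
  apply: (measurable_seq_continuous (seq_continuous_integrate_last cG GM mBi)) => k.
  by apply: measurable_funM => //; exact: (measurable_riemann hN mV0 k nh0 NN0).
move=> w Vw; rewrite (last_gauss _ GL L0 GM).
have gE y : G (upd (Dr n NN w) m y) = G (upd (pre (D ^~ w)) m y) by [].
have [_ gl] := coord_lipschitz_upd (pre (D ^~ w)) 0 GL L0.
have := Hr (fun y => G (upd (pre (D ^~ w)) m y)) 0 _ gl (fun y => GM _)
  (vel_velocity_event hN (m * NN) d0 Vw).
rewrite (_ : (fun s _ => G (upd _ m (0 + _ * s))) = (fun s _ => Phi (D ^~ w) (delta * s))).
  exact: id.
by apply/funext => s; apply/funext => _; rewrite /Phi add0r -mulrA.
Qed.

Let cvg_Dr m G M n l : seq_continuous m G -> (forall x, `|G x| <= M) -> (0 < n)%N ->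
  \int[P]_w G (Dr n (l.+1 * r.+1) w) @[r --> \oo] --> \int[P]_w G (scaled_incr n w).
Proof.
move=> cG GM n_gt0; have nh0 : 0 < n%:R * h by rewrite mulr_gt0// ltr0n.
apply: (@bounded_cvg_expect _ _ _ P _ _ M) => //.
- move=> r; apply: (measurable_seq_continuous cG) => k.
  by apply: measurable_funM => //; exact: (measurable_riemann hN mV0 k nh0).
- apply: (measurable_seq_continuous cG) => k.
  by apply: measurable_funM => //; exact: (measurable_telegraph_incr hN mV0).
- move=> w; apply: cG => k _; apply: cvgM; first exact: cvg_cst.
  exact: (riemann_cvg hN).
Qed.

(** Exchanging the last increment turns [G] into [H], which reads one coordinate less and has the
    same Lipschitz constant and bound, so the induction hypothesis applies to [H]. *)
Lemma cvg_finite_dimensional m L M G : 0 <= L -> coord_lipschitz m L G ->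
  (forall x, `|G x| <= M) ->
  \int[P]_w G (scaled_incr n w) @[n --> \oo] --> \int[P']_w G (brownian_incr B grid ^~ w).
Proof.
elim: m G => [|m IH] G L0 GL GM.
  have GE x : G x = G (fun=> 0).
    by apply/eqP; rewrite -subr_eq0 -normr_le0 (le_trans (GL _ _))// big_ord0 mulr0.
  under eq_fun do (under eq_Rintegral do rewrite GE; rewrite expect_cst).
  under eq_Rintegral do rewrite GE.
  by rewrite expect_cst; exact: cvg_cst.
have cG := coord_lipschitz_continuous GL.
set H := integrate_last P' (brownian_incr B grid) m G.
have HL : coord_lipschitz m L H := last_lipschitz GL L0 GM.
have HM x : `|H x| <= M by exact: integrate_last_bounded cG GM mBi x.
have cH := coord_lipschitz_continuous HL.
rewrite (expect_integrate_last cG GM mBi (brownian_incr_indep hB grid0 gridS')).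
have {}IH := IH H L0 HL HM.
apply/cvgrPdist_le => e e0; have e2 : 0 < e / 2 by rewrite divr_gt0.
have [l [n0 clt]] := telegraph_clt lambda0 c0 M h0 e2 L0 hB.
have rep := block_replace L0 GL GM clt.
near=> n.
have n0n : (n0 < n)%N by near: n; exact: nbhs_infty_gt.
have n_gt0 : (0 < n)%N by rewrite (leq_trans _ n0n).
have h1 : `|\int[P]_w G (scaled_incr n w) - \int[P]_w H (scaled_incr n w)| <= e / 2.
  (* At fixed [n] the comparison holds for all fine meshes; letting the mesh tend to 0 transfers it
     from Riemann sums to [X]. *)
  have c1 := cvg_Dr l cG GM n_gt0; have c2 := cvg_Dr l cH HM n_gt0.
  apply: (le_cvg_dist c1 c2); have [r0 Hr] := rep n n0n.
  by near=> r; apply: Hr; rewrite ltnS; near: r; exact: nbhs_infty_ge.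
have h2 : `|\int[P']_w H (brownian_incr B grid ^~ w) - \int[P]_w H (scaled_incr n w)| <= e / 2.
  by near: n; move/cvgrPdist_le : IH; apply.
rewrite [leRHS]splitr; apply: le_trans (lerD h2 h1).
rewrite -normrN [X in _ <= _ + X]distrC.
move: (\int[P']_w _) (\int[P]_w H _) (\int[P]_w G _) => a b g.
by rewrite -normrN opprK -[X in `|X|](subrKA b) ler_normD.
Unshelve. all: by end_near. Qed.

End finite_dimensional.

(** * Dyadic interpolation and chaining *)

Section dyadic.
Context (R : realType).

(** Passing from node [k] to its parent [k./2] costs one increment of the finer level if [k] is odd
    and nothing if [k] is even. *)
Lemma dyadic_chain (y : nat -> nat -> R) (W : nat -> R) m j k :
  (forall i k, y i.+1 k.*2 = y i k) ->
  (forall i k, (m < i)%N -> (k < 2 ^ i)%N -> `|y i k.+1 - y i k| <= W i) ->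
  (forall i, 0 <= W i) ->
  (k <= 2 ^ (m + j))%N ->
  `|y (m + j)%N k - y m (k %/ 2 ^ j)%N| <= \sum_(i < j) W (m + i).+1.
Proof.
move=> yy yW W0; elim: j k => [|j IH] k kj.
  by rewrite addn0 expn0 divn1 subrr normr0 big_ord0.
rewrite addnS big_ord_recr/=.
have {}IH : `|y (m + j)%N k./2 - y m (k %/ 2 ^ j.+1)%N| <= \sum_(i < j) W (m + i).+1.
  rewrite expnS divnMA divn2; apply: IH.
  by rewrite -(doubleK (2 ^ (m + j))%N) half_leq// -mul2n -expnS -addnS.
apply: (le_trans (ler_distD (y (m + j)%N k./2) _ _)); rewrite addrC lerD//.
rewrite -(yy (m + j)%N k./2); have := odd_double_half k; case: (odd k) => /= kE; last first.
  by rewrite add0n in kE; rewrite kE subrr normr0.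
rewrite -[X in y _ X]kE add1n yW// ?ltnS ?leq_addr//.
by rewrite -addnS; apply: leq_trans kj; rewrite -[leqRHS]kE.
Qed.

Lemma truncn_divn (s : R) q : 0 <= s -> (0 < q)%N ->
  (Num.truncn (q%:R * s) %/ q)%N = Num.truncn s.
Proof.
move=> s0 q0; apply/esym/truncn_def.
have q0' : 0 < q%:R :> R by rewrite ltr0n.
have /andP[h1 h2] := truncn_itv (mulr_ge0 (ltW q0') s0).
apply/andP; split.
  rewrite -(ler_pM2l q0') (le_trans _ h1)// -natrM ler_nat mulnC; exact: leq_divM.
rewrite -(ltr_pM2l q0') (lt_le_trans h2)// -natrM ler_nat mulnC.
exact: ltn_ceil.
Qed.

Definition clamp (s : R) : R := Num.max 0 (Num.min s 1).

Lemma clamp01 s : 0 <= clamp s <= 1.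
Proof.
rewrite /clamp le_max lexx/= ge_max ler01/=.
by rewrite ge_min lexx orbT.
Qed.

Lemma clamp_ge1 s : 1 <= s -> clamp s = 1.
Proof. by move=> s1; rewrite /clamp (min_idPr _)//; apply/max_idPr. Qed.

Lemma clamp_le0 s : s <= 0 -> clamp s = 0.
Proof.
move=> s0; rewrite /clamp (min_idPl _) ?(le_trans s0)//.
by apply/max_idPl.
Qed.

Lemma clamp_continuous : continuous clamp.
Proof.
move=> s; apply: (@continuous_max R R (cst 0) (fun y => Num.min y 1)).
  exact: cst_continuous.
by apply: (@continuous_min R R id (cst 1)) => //; exact: cst_continuous.
Qed.

(** Piecewise linear path from 0 with increments [u k] over cells of length [1 / p]. Written with
    ramps, it is a Lipschitz function of the increments, whose joint laws are the ones that
    converge. *)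
Definition interp (p : nat) (u : nat -> R) (t : R) : R :=
  \sum_(k < p) u k * clamp (p%:R * t - k%:R).

Lemma interp_dist p u v t : `|interp p u t - interp p v t| <= \sum_(k < p) `|u k - v k|.
Proof.
rewrite /interp -sumrB (le_trans (ler_norm_sum _ _ _))//; apply: ler_sum => k _.
rewrite -mulrBl normrM -[leRHS]mulr1; apply: ler_wpM2l => //.
by have /andP[h0 h1] := clamp01 (p%:R * t - k%:R); rewrite ger0_norm.
Qed.

Lemma interp_continuous p u : continuous (interp p u).
Proof.
move=> t; rewrite /interp /continuous_at.
apply: (cvg_big (op := +%R)) => [a|k _]; first exact: add_continuous.
apply: cvgM; first exact: cvg_cst.
have h : p%:R * s - k%:R @[s --> t] --> p%:R * t - k%:R.
  by apply: cvgB; [apply: cvgM; [exact: cvg_cst|exact: cvg_id]|exact: cvg_cst].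
exact: (cvg_comp _ _ h (@clamp_continuous (p%:R * t - k%:R))).
Qed.

(** At time [t] the ramps before [K] are complete and telescope, those after [K] vanish, and only
    ramp [K] is possibly partial. *)
Lemma interp_partial p (a : nat -> R) t W : 0 <= t -> t <= 1 -> a 0%N = 0 -> 0 <= W ->
  let K := Num.truncn (p%:R * t) in
  ((K < p)%N -> `|a K.+1 - a K| <= W) ->
  `|interp p (fun k => a k.+1 - a k) t - a K| <= W.
Proof.
move=> t0 t1 a0 W0 K aW.
have pt0 : 0 <= p%:R * t by rewrite mulr_ge0.
have /andP[h1 h2] := truncn_itv pt0; rewrite -/K in h1 h2.
have Kp : (K <= p)%N by rewrite -(ler_nat R) (le_trans h1)// ler_piMr.
rewrite /interp -(big_mkord xpredT (fun k => (a k.+1 - a k) * clamp (p%:R * t - k%:R))).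
rewrite (big_cat_nat (leq0n K) Kp)/=.
rewrite (@eq_big_nat _ _ _ _ _ _ (fun k => a k.+1 - a k)); last first.
  move=> k /andP[_ kK]; rewrite clamp_ge1 ?mulr1// lerBrDr (le_trans _ h1)//.
  by rewrite nat1r ler_nat.
rewrite telescope_sumr// a0 subr0 addrAC subrr add0r.
move: Kp; rewrite leq_eqVlt => /predU1P[->|Kp]; first by rewrite big_geq// normr0.
rewrite big_ltn// big_nat_cond big1 ?addr0; last first.
  move=> k; rewrite andbT => /andP[Kk _]; rewrite clamp_le0 ?mulr0// subr_le0.
  by rewrite (le_trans (ltW h2))// ler_nat.
rewrite normrM (le_trans _ (aW Kp))// ler_piMr//.
by have /andP[z0 z1] := clamp01 (p%:R * t - K%:R); rewrite ger0_norm.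
Qed.

Definition dyadic (x : R -> R) (i k : nat) : R := x (k%:R / (2 ^ i)%:R).

Definition dyadic_incr (x : R -> R) (i k : nat) : R := dyadic x i k.+1 - dyadic x i k.

Lemma dyadic_double x i k : dyadic x i.+1 k.*2 = dyadic x i k.
Proof.
by congr x; rewrite -mul2n expnS !natrM -mulf_div divff ?mul1r// pnatr_eq0.
Qed.

(** Moving to a node costs [W (m + j)] at the fine level and [W m] at the coarse one, and chaining
    the nodes costs the levels in between; the factor 2 absorbs the end terms. *)
Lemma interp_chain (x : R -> R) (W : nat -> R) m j t : 0 <= t -> t <= 1 -> x 0 = 0 ->
  (forall i k, (m <= i)%N -> (k < 2 ^ i)%N -> `|dyadic_incr x i k| <= W i) ->
  (forall i, 0 <= W i) ->
  `|interp (2 ^ (m + j)) (dyadic_incr x (m + j)) t - interp (2 ^ m) (dyadic_incr x m) t| <=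
  2 * \sum_(i < j.+1) W (m + i)%N.
Proof.
move=> t0 t1 x0 xW W0.
have dy0 i : dyadic x i 0 = 0 by rewrite /dyadic mul0r.
set K := Num.truncn ((2 ^ (m + j))%:R * t).
have KE : Num.truncn ((2 ^ m)%:R * t) = (K %/ 2 ^ j)%N.
  by rewrite /K expnD mulnC natrM -mulrA truncn_divn ?expn_gt0// mulr_ge0.
have h1 : `|interp (2 ^ (m + j)) (dyadic_incr x (m + j)) t - dyadic x (m + j) K| <= W (m + j)%N.
  by apply: interp_partial => // Kp; apply: xW => //; exact: leq_addr.
have h2 : `|interp (2 ^ m) (dyadic_incr x m) t - dyadic x m (K %/ 2 ^ j)| <= W m.
  by rewrite -KE; apply: interp_partial => // Kp; exact: xW.
have Kp : (K <= 2 ^ (m + j))%N.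
  rewrite -(ler_nat R); apply: (@le_trans _ _ ((2 ^ (m + j))%:R * t)); last by rewrite ler_piMr.
  by rewrite truncn_le mulr_ge0.
have h3 := dyadic_chain (dyadic_double x) (fun i k mi => xW i k (ltnW mi)) W0 Kp.
have S1 : \sum_(i < j.+1) W (m + i)%N = W m + \sum_(i < j) W (m + i).+1.
  by rewrite big_ord_recl/= addn0; congr (_ + _); apply: eq_bigr => i _; rewrite addnS.
have S2 : W (m + j)%N <= \sum_(i < j.+1) W (m + i)%N.
  by rewrite big_ord_recr/= lerDr sumr_ge0.
move: h1 h2 h3 S2; rewrite S1.
move: (interp _ _ t) (interp _ _ t) (dyadic _ _ K) (dyadic _ _ (_ %/ _)) (W (m + j)%N) (W m).
move=> A B a b w1 w2; move: (\sum_(i < j) _) => S.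
rewrite !ler_norml => /andP[? ?] /andP[? ?] /andP[? ?] ?; apply/andP; split; lra.
Qed.

(** The near-covering form of compactness makes the estimate uniform in [t] from continuity at each
    point. *)
Lemma interp_cvg (x : R -> R) e : {within `[0, 1], continuous x} -> x 0 = 0 -> 0 < e ->
  \forall m \near \oo, forall t, 0 <= t -> t <= 1 ->
    `|interp (2 ^ m) (dyadic_incr x m) t - x t| <= e.
Proof.
move=> cx x0 e0.
have /compact_near_coveringP := @segment_compact R 0 1.
move=> /(_ nat \oo (fun m t => 0 <= t -> t <= 1 ->
  `|interp (2 ^ m) (dyadic_incr x m) t - x t| <= e)) H.
suff H2 : \forall m \near \oo, `[0, 1] `<=` (fun t => 0 <= t -> t <= 1 ->
    `|interp (2 ^ m) (dyadic_incr x m) t - x t| <= e).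
  by apply: filterS H2 => m + t t0 t1; apply => //; rewrite /= in_itv/= t0.
apply: H => t0 t01.
have e4 : 0 < e / 4 by rewrite divr_gt0.
have [r r0 xr] : exists2 r, 0 < r & forall s, 0 <= s <= 1 -> `|t0 - s| < r ->
    `|x t0 - x s| <= e / 4.
  have /subspace_continuousP := cx => /(_ t0 t01) /cvgrPdist_le /(_ _ e4).
  rewrite /within/= -nbhs_ballE => -[r /= r0 br]; exists r => // s s01 sr.
  by apply: (br s) => //; rewrite in_itv.
have r4 : 0 < r / 4 by rewrite divr_gt0.
have r2 : 0 < r / 2 by rewrite divr_gt0.
(* The nodes next to [t] are then within [r / 2 + r / 4] of [t0]. *)
exists ([set t | `|t0 - t| < r / 2], [set m | ((2 ^ m)%:R : R)^-1 < r / 4]).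
  split => /=.
    by rewrite -nbhs_ballE; exists (r / 2).
  near=> m => /=.
  rewrite invf_plt ?posrE ?ltr0n ?expn_gt0//.
  apply: (@lt_trans _ _ m%:R); last by rewrite ltr_nat ltn_expl.
  by near: m; exact: nbhs_infty_gtr.
move=> [t m] /= [tr mr].
move=> t_ge0 t_le1; set p := (2 ^ m)%N in mr *.
have p0 : 0 < p%:R :> R by rewrite ltr0n expn_gt0.
have pt0 : 0 <= p%:R * t by rewrite mulr_ge0// ltW.
have dy0 : dyadic x m 0 = 0 by rewrite /dyadic mul0r.
set K := Num.truncn (p%:R * t).
have /andP[h1 h2] := truncn_itv pt0; rewrite -/K in h1 h2.
have near_t0 k : (K <= k)%N -> (k <= K.+1)%N -> (k <= p)%N -> `|x t0 - dyadic x m k| <= e / 4.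
  move=> Kk kK kp; apply: xr.
    by rewrite divr_ge0//= ler_pdivrMr// mul1r ler_nat.
  apply: (@le_lt_trans _ _ (`|t0 - t| + `|t - k%:R / p%:R|)).
    by rewrite -(subrKA t) ler_normD.
  have : `|t - k%:R / p%:R| <= p%:R^-1.
    rewrite -(ler_pM2l p0) divff ?gt_eqF// -[X in X * _ <= _]ger0_norm ?(ltW p0)//.
    rewrite -normrM mulrBr mulrCA divff ?gt_eqF// mulr1 ler_norml.
    have k1 : K%:R <= k%:R :> R by rewrite ler_nat.
    have k2 : k%:R <= K%:R + 1 :> R by rewrite natr1 ler_nat.
    have h2' : p%:R * t < K%:R + 1 by rewrite natr1.
    by apply/andP; split; lra.
  by move: tr mr; lra.
have Kp : (K <= p)%N by rewrite -(ler_nat R) (le_trans h1)// ler_piMr// ltW.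
have xt : `|x t0 - x t| <= e / 4 by apply: xr; [rewrite t_ge0|lra].
have kk := near_t0 K (leqnn _) (leqnSn _) Kp.
have e2 : 0 <= e / 2 by lra.
have aW : (K < p)%N -> `|dyadic x m K.+1 - dyadic x m K| <= e / 2.
  move=> K1; have := near_t0 K.+1 (leqnSn _) (leqnn _) K1; move: kk.
  by rewrite !ler_norml => /andP[? ?] /andP[? ?]; apply/andP; split; lra.
have := interp_partial t_ge0 t_le1 dy0 e2 aW; rewrite -/K.
move: xt kk; rewrite -/(dyadic_incr x m) !ler_norml => /andP[? ?] /andP[? ?] /andP[? ?].
by apply/andP; split; lra.
Unshelve. all: by end_near. Qed.

End dyadic.

Section truncation.
Context d (T : measurableType d) (R : realType) (P : probability T R).

(** Removes the truncations: bounds uniform in [B] give integrability by monotone convergence along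
    integer levels. *)
Lemma le_expect_trunc (f : T -> R) (C : R) : measurable_fun setT f ->
  (forall w, 0 <= f w) -> (forall B, 0 <= B -> \int[P]_w Num.min (f w) B <= C) ->
  P.-integrable setT (EFin \o f) /\ \int[P]_w f w <= C.
Proof.
move=> mf f0 fC.
pose g (n : nat) w : \bar R := (Num.min (f w) n%:R)%:E.
have mg' n : measurable_fun setT (fun w => Num.min (f w) n%:R).
  by apply: measurable_minr => //; exact: measurable_cst.
have mg n : measurable_fun setT (g n) by apply/measurable_EFinP; exact: mg'.
have g0 n w : setT w -> (0 <= g n w)%E by rewrite lee_fin le_min f0/=.
have gnd w : setT w -> {homo g ^~ w : n m / (n <= m)%N >-> (n <= m)%E}.
  by move=> _ n m nm; rewrite lee_fin le_min ge_min lexx/= ge_min ler_nat nm orbT.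
have ig n : P.-integrable setT (EFin \o (fun w => Num.min (f w) n%:R)).
  apply: (@bounded_integrable _ T R P _ n%:R (mg' n)) => w.
  have m0 : 0 <= Num.min (f w) n%:R by rewrite le_min f0/=.
  by rewrite (ger0_norm m0) ge_min lexx orbT.
have gC n : (\int[P]_w g n w <= C%:E)%E.
  have := fC n%:R (ler0n _ _); rewrite /Rintegral -lee_fin fineK//.
  exact: integrable_fin_num (ig n).
have fE : (\int[P]_w (f w)%:E <= C%:E)%E.
  have -> : (\int[P]_w (f w)%:E = \int[P]_w limn (g ^~ w))%E.
    apply: eq_integral => w _; apply/esym/cvg_lim => //.
    apply: cvg_near_cst.
    near=> n; congr EFin; apply/min_idPl.
    by near: n; exact: nbhs_infty_ger.
  rewrite (monotone_convergence P measurableT mg g0 gnd).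
  apply: lime_le; last by near=> n; exact: gC.
  apply: ereal_nondecreasing_is_cvgn => n m nm; apply: ge0_le_integral => //.
  - by move=> w _; exact: g0.
  - by move=> w _; exact: gnd.
have iF : P.-integrable setT (EFin \o f).
  apply/integrableP; split; first exact/measurable_EFinP.
  under eq_integral do rewrite /= ger0_norm//.
  by rewrite (le_lt_trans fE)// ltry.
split=> //; rewrite -lee_fin /Rintegral fineK//.
exact: integrable_fin_num iF.
Unshelve. all: by end_near. Qed.

Lemma expect_sum (p : nat) (f : nat -> T -> R) :
  (forall k, (k < p)%N -> P.-integrable setT (EFin \o f k)) ->
  P.-integrable setT (EFin \o (fun w => \sum_(k < p) f k w)) /\
  \int[P]_w (\sum_(k < p) f k w) = \sum_(k < p) \int[P]_w f k w.
Proof.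
elim: p => [_|p IH fi].
  under eq_Rintegral do rewrite big_ord0; rewrite big_ord0 expect_cst; split=> //.
  apply: (@bounded_integrable _ T R P _ 0) => [|w]; last by rewrite big_ord0 normr0.
  by under eq_fun do rewrite big_ord0; exact: measurable_cst.
have [IH1 IH2] := IH (fun k kp => fi k (ltnW kp)).
have fp := fi p (ltnSn p).
have E : (fun w => \sum_(k < p.+1) f k w) = (fun w => \sum_(k < p) f k w + f p w).
  by apply/funext => w; rewrite big_ord_recr.
rewrite E (RintegralD measurableT IH1 fp) IH2 big_ord_recr; split=> //.
have := integrableD measurableT IH1 fp.
by apply: eq_integrable => // w _.
Qed.

End truncation.

(** * Expected size of dyadic increments *)

Section chaining.
Context d (T : measurableType d) (R : realType) (P : probability T R).
Variables (z : nat -> nat -> T -> R) (K : R).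
Hypothesis K0 : 0 <= K.
Hypothesis mz : forall i k, measurable_fun setT (z i k).
Hypothesis hz : forall i k B, (k < 2 ^ i)%N -> 0 <= B ->
  \int[P]_w Num.min (z i k w ^+ 4) B <= K / 4 ^+ i.

(** Any ratio below 1 whose fourth power is at least [1 / 2] would do: the fourth moments of level
    [i] sum to at most [K / 2 ^ i], and division by [eps i ^ 3] must leave at most [K * eps i]. The
    8 in the bound on sums of levels is [1 / (1 - 7 / 8)]. *)
Let eps i : R := (7 / 8) ^+ i.

Let eps0 i : 0 < eps i. Proof. by rewrite exprn_gt0. Qed.

(* By [|a| <= e + a^4 / e^3] this dominates every increment of level [i], and its
   expectation only involves fourth moments. *)
Definition level_bound (i : nat) (w : T) : R :=
  eps i + (eps i) ^- 3 * \sum_(k < 2 ^ i) z i k w ^+ 4.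

Lemma level_bound_ge0 i w : 0 <= level_bound i w.
Proof.
rewrite addr_ge0 ?(ltW (eps0 i))// mulr_ge0 ?invr_ge0 ?exprn_ge0 ?(ltW (eps0 i))//.
by rewrite sumr_ge0// => k _; rewrite exprn_even_ge0.
Qed.

Lemma le_level_bound i k w : (k < 2 ^ i)%N -> `|z i k w| <= level_bound i w.
Proof.
move=> ki; have S : z i k w ^+ 4 <= \sum_(k < 2 ^ i) z i k w ^+ 4.
  rewrite (bigD1 (Ordinal ki))//= lerDl sumr_ge0// => j _.
  by rewrite exprn_even_ge0.
have e0 := eps0 i; have e3 : 0 < (eps i) ^- 3 by rewrite invr_gt0 exprn_gt0.
apply: le_trans (_ : eps i + (eps i) ^- 3 * z i k w ^+ 4 <= _); last first.
  by rewrite lerD2l ler_pM2l.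
have [ze|ez] := leP `|z i k w| (eps i).
  by rewrite (le_trans ze)// lerDl mulr_ge0 ?exprn_even_ge0// ltW.
rewrite -[leLHS]add0r lerD ?(ltW e0)// -[z i k w ^+ 4]ger0_norm ?exprn_even_ge0//.
rewrite normrX [X in _ <= _ * X]exprSr mulrA ler_peMl// mulrC ler_pdivlMr ?exprn_gt0// mul1r.
by rewrite lerXn2r ?nnegrE// ltW.
Qed.

Lemma expect_level_bound i : P.-integrable setT (EFin \o level_bound i) /\
  \int[P]_w level_bound i w <= (1 + K) * (7 / 8) ^+ i.
Proof.
have hf k : (k < 2 ^ i)%N -> P.-integrable setT (EFin \o (fun w => z i k w ^+ 4)) /\
    \int[P]_w z i k w ^+ 4 <= K / 4 ^+ i.
  move=> ki; apply: le_expect_trunc => [|w|B B0].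
  - exact: measurable_funX.
  - by rewrite exprn_even_ge0.
  - exact: hz.
have [iS ES] := expect_sum (fun k ki => (hf k ki).1).
have iZ : P.-integrable setT (EFin \o (fun w => (eps i) ^- 3 * \sum_(k < 2 ^ i) z i k w ^+ 4)).
  have := integrableZl measurableT ((eps i) ^- 3) iS.
  by apply: eq_integrable => // w _.
have ic : P.-integrable setT (EFin \o (fun _ : T => eps i)).
  by apply: (@bounded_integrable _ T R P _ `|eps i|).
split.
  have := integrableD measurableT ic iZ.
  by apply: eq_integrable => // w _.
rewrite (RintegralD measurableT ic iZ) expect_cst (RintegralZl _ measurableT iS) ES.
rewrite mulrDl mul1r lerD2l -ler_pdivlMl ?invr_gt0 ?exprn_gt0// invrK.
apply: (@le_trans _ _ (\sum_(k < 2 ^ i) K / 4 ^+ i)).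
  by apply: ler_sum => k _; exact: (hf k (ltn_ord k)).2.
rewrite sumr_const card_ord -[leLHS]mulr_natl mulrCA [leRHS]mulrCA.
apply: ler_wpM2l => //; rewrite natrX -exprSr -/(eps i) /eps -exprM mulnC exprM.
rewrite -exprVn -exprMn lerXn2r ?nnegrE//; lra.
Qed.

Lemma expect_level_sum m j :
  P.-integrable setT (EFin \o (fun w => \sum_(i < j) level_bound (m + i) w)) /\
  \int[P]_w (\sum_(i < j) level_bound (m + i) w) <= 8 * (1 + K) * (7 / 8) ^+ m.
Proof.
have [h1 h2] := @expect_sum _ _ _ P j (fun i => level_bound (m + i))
  (fun i _ => (expect_level_bound _).1).
split=> //; rewrite h2.
apply: (@le_trans _ _ (\sum_(i < j) ((1 + K) * (7 / 8) ^+ m) * (7 / 8) ^+ i)).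
  apply: ler_sum => i _; rewrite -mulrA -exprD; exact: (expect_level_bound _).2.
rewrite -mulr_sumr [leRHS](_ : _ = (1 + K) * (7 / 8) ^+ m * 8); last by ring.
apply: ler_wpM2l.
  by rewrite mulr_ge0 ?exprn_ge0// addr_ge0.
elim: j {h1 h2} => [|j IH]; first by rewrite big_ord0.
suff -> : \sum_(i < j.+1) (7 / 8 : R) ^+ i = 8 * (1 - (7 / 8) ^+ j.+1).
  by rewrite -[leRHS]mulr1 ler_pM2l// gerBl exprn_ge0.
elim: j {IH} => [|j IH]; first by rewrite big_ord_recl big_ord0 expr0 expr1; lra.
by rewrite big_ord_recr/= IH [(7 / 8) ^+ j.+2]exprS; lra.
Qed.

End chaining.

(** * Functionals of circle-valued paths *)

Section circle_paths.
Context (R : realType).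

Lemma normr_sin_le (x : R) : `|sin x| <= `|x|.
Proof.
have := @mvt_bound R (@sin R) (@cos R) 0 x 1 (fun z => is_derive_sin z).
rewrite add0r sin0 subr0 mul1r; apply=> z _.
by rewrite ler_norml cos_geN1 cos_le1.
Qed.

Lemma expi_dist (a b : R) : `|expi a - expi b| <= (`|a - b|)%:C%C.
Proof.
rewrite /expi /GRing.add /= /GRing.opp /= normC_complex lecR.
rewrite -sqrtr_sqr; apply: ler_wsqrtr.
(* In terms of half difference and half sum, the chord is twice the absolute sine of [u]. *)
pose u := (a - b) / 2; pose v := (a + b) / 2.
have [-> ->] : a = v + u /\ b = v - u by rewrite /u /v; split; lra.
rewrite !cosD !sinD cosN sinN.
have h := normr_sin_le u; have c2 := cos2Dsin2 v.
have h2 : sin u ^+ 2 <= u ^+ 2.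
  by rewrite -(real_normK (num_real (sin u))) -(real_normK (num_real u)) lerXn2r ?nnegrE.
have -> : (cos v * cos u - sin v * sin u - (cos v * cos u - sin v * - sin u)) ^+ 2 +
  (sin v * cos u + cos v * sin u - (sin v * cos u + cos v * - sin u)) ^+ 2 =
  4 * (cos v ^+ 2 + sin v ^+ 2) * sin u ^+ 2 by ring.
rewrite c2 mulr1; have -> : (v + u - (v - u)) ^+ 2 = 4 * u ^+ 2 by ring.
by rewrite ler_pM2l.
Qed.

(** The sup-distance bound as a relation, since [C01S R] is only given as a uniform space. *)
Definition within_dist (x y : C01S R) (e : R) :=
  forall t, `|C01S_val x t - C01S_val y t| <= e%:C%C.

Definition path_lipschitz (L : R) (F : C01S R -> R) :=
  forall x y e, 0 <= e -> within_dist x y e -> `|F x - F y| <= L * e.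

Lemma circle_path_dist (z : circle R) (x y : I01 R -> R) (cx : continuous x)
    (cy : continuous y) (e : R) : (forall t, `|x t - y t| <= e) ->
  within_dist (circle_path z cx) (circle_path z cy) e.
Proof.
move=> xy t; rewrite /C01S_val/= -mulrBr normrM.
have := set_valP z; rewrite /circle /= => ->; rewrite mul1r.
by rewrite (le_trans (expi_dist _ _))// lecR.
Qed.

Lemma interp_continuous01 (p : nat) (u : nat -> R) :
  continuous (fun t : I01 R => interp p u (\val t)).
Proof.
move=> t; apply: (continuous_comp (f := set_val : I01 R -> R)).
  exact: (@initial_continuous (I01 R) R set_val t).
exact: interp_continuous.
Qed.

Definition interp_path (z : circle R) (p : nat) (u : nat -> R) : C01S R :=
  circle_path z (interp_continuous01 (p:=p) (u:=u)).

Lemma path_lipschitz_interp (z : circle R) L F p : path_lipschitz L F ->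
  coord_lipschitz p L (fun u => F (interp_path z p u)).
Proof.
move=> FL u v; apply: FL; first exact: sumr_ge0.
by apply: circle_path_dist => t; exact: interp_dist.
Qed.

End circle_paths.

(** * Circle paths of a process with controlled fourth moments *)

Section path_process.
Context d (T : measurableType d) (R : realType) (P : probability T R).
Variables (z : circle R) (x : T -> R -> R) (K : R).
Hypothesis K0 : 0 <= K.
Hypothesis x0 : forall w, x w 0 = 0.
Hypothesis cx : forall w, continuous (fun t : I01 R => x w (\val t)).
Hypothesis mx : forall t, 0 <= t -> t <= 1 -> measurable_fun setT (x ^~ t).
Hypothesis hx : forall i k B, (k < 2 ^ i)%N -> 0 <= B ->
  \int[P]_w Num.min (dyadic_incr (x w) i k ^+ 4) B <= K / 4 ^+ i.
Variables (F : C01S R -> R) (L M : R).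
Hypotheses (L0 : 0 <= L) (FL : path_lipschitz L F) (FM : forall y, `|F y| <= M).

Let path w : C01S R := circle_path z (cx (w := w)).

Let G m (u : nat -> R) : R := F (interp_path z (2 ^ m) u).

(** Cells beyond [[0, 1]] get the value 0, because measurability is available for times in [[0, 1]]
    only. *)
Let incr m k : T -> R := if (k < 2 ^ m)%N then fun w => dyadic_incr (x w) m k else cst 0.

Let mincr m k : measurable_fun setT (incr m k).
Proof.
rewrite /incr; case: ifPn => [km|_]; last exact: measurable_cst.
have p0 : 0 < (2 ^ m)%:R :> R by rewrite ltr0n expn_gt0.
apply: measurable_funB; apply: mx; rewrite ?divr_ge0 ?ler_pdivrMr ?mul1r ?ler_nat//.
exact: ltnW.
Qed.

Let GE m w : G m (incr m ^~ w) = G m (dyadic_incr (x w) m).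
Proof.
apply/eqP; rewrite -subr_eq0 -normr_le0 (le_trans (path_lipschitz_interp _ _ FL _ _))//.
by rewrite big1 ?mulr0// => k _; rewrite /incr ltn_ord subrr normr0.
Qed.

Lemma measurable_interp m : measurable_fun setT (fun w => G m (dyadic_incr (x w) m)).
Proof.
rewrite (_ : (fun w => _) = (fun w => G m (incr m ^~ w))); last first.
  by apply/funext => w; rewrite GE.
have cG : seq_continuous (2 ^ m) (G m).
  exact: (coord_lipschitz_continuous (path_lipschitz_interp z (2 ^ m)%N FL)).
exact: (measurable_seq_continuous (D := incr m) cG (mincr m)).
Qed.

Lemma cvg_interp w : G m (dyadic_incr (x w) m) @[m --> \oo] --> F (path w).
Proof.
apply/cvgrPdist_le => e e0; have L1 : 0 < L + 1 by rewrite ltr_wpDl.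
have eL : 0 < e / (L + 1) by rewrite divr_gt0.
have cw : {within `[0, 1], continuous (x w)}.
  by apply/(subspace_sigL_continuousP (I01 R)); exact: cx.
have := interp_cvg cw (x0 w) eL; apply: filterS => m H.
rewrite (le_trans (FL (ltW eL) _))//.
  apply: circle_path_dist => t; rewrite distrC.
  have := set_valP t; rewrite /I01 /= in_itv/= => /andP[t0 t1].
  exact: H.
by rewrite mulrCA ler_piMr ?(ltW e0)// ler_pdivrMr// mul1r lerDl.
Qed.

Lemma measurable_path : measurable_fun setT (fun w => F (path w)).
Proof.
by apply: (measurable_fun_cvg (h := fun m w => G m (dyadic_incr (x w) m))) => // [m|w _];
  [exact: measurable_interp|exact: cvg_interp].
Qed.

(** The interpolation of level [m] is compared with finer ones by chaining, and the finer level then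
    tends to infinity. The bound depends on the process through [K] only, hence is uniform along a
    family. *)
Lemma expect_interp_dist m :
  `|\int[P]_w F (path w) - \int[P]_w G m (dyadic_incr (x w) m)| <=
  2 * L * (8 * (1 + K) * (7 / 8) ^+ m).
Proof.
have c1 : \int[P]_w G (m + j) (dyadic_incr (x w) (m + j)) @[j --> \oo] --> \int[P]_w F (path w).
  apply: (@bounded_cvg_expect _ _ _ P _ _ M) => //.
  - by move=> j; exact: measurable_interp.
  - exact: measurable_path.
  - by move=> j w; exact: FM.
  - move=> w; have := @cvg_interp w.
    by rewrite -(cvg_shiftn m); under eq_fun do rewrite addnC.
apply: (le_cvg_dist c1 (cvg_cst _)); near=> j.
have mz i k : measurable_fun setT (incr i k) by exact: mincr.
have hz i k B : (k < 2 ^ i)%N -> 0 <= B -> \int[P]_w Num.min (incr i k w ^+ 4) B <= K / 4 ^+ i.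
  by move=> ki B0; rewrite /incr ki; exact: hx.
have [iS ES] := expect_level_sum K0 mz hz m j.+1.
have iG i : P.-integrable setT (EFin \o (fun w => G i (dyadic_incr (x w) i))).
  by apply: (@bounded_integrable _ T R P _ M); [exact: measurable_interp|move=> w; exact: FM].
rewrite -(RintegralB measurableT (iG (m + j)%N) (iG m)).
have iB : P.-integrable setT (EFin \o (fun w =>
    G (m + j)%N (dyadic_incr (x w) (m + j)) - G m (dyadic_incr (x w) m))).
  have := integrableB measurableT (iG (m + j)%N) (iG m).
  by apply: eq_integrable => // w _.
apply: le_trans (le_normr_Rintegral measurableT iB) _.
have iLS : P.-integrable setT (EFin \o (fun w =>
    2 * L * \sum_(i < j.+1) level_bound incr (m + i) w)).
  have := integrableZl measurableT (2 * L) iS.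
  by apply: eq_integrable => // w _.
apply: (@le_trans _ _ (\int[P]_w (2 * L * \sum_(i < j.+1) level_bound incr (m + i) w))).
  apply: le_expect => //; first exact: integrable_norm.
  move=> w; rewrite [2 * L]mulrC -mulrA; apply: FL.
    by rewrite mulr_ge0// sumr_ge0// => i _; exact: level_bound_ge0.
  apply: circle_path_dist => t.
  have := set_valP t; rewrite /I01 /= in_itv/= => /andP[t0 t1].
  apply: (@interp_chain R (x w) (fun i => level_bound incr i w) m j _ t0 t1 (x0 w)) => i.
    move=> k _ ki; have := le_level_bound incr w ki.
    by rewrite /incr ki.
  exact: level_bound_ge0.
rewrite (RintegralZl _ measurableT iS) ler_wpM2l// mulr_ge0//.
Unshelve. all: by end_near. Qed.

End path_process.

(** * Weak convergence from Lipschitz functionals *)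

Section envelope.
Context (R : realType).

Lemma within_dist_refl (x : C01S R) : within_dist x x 0.
Proof. by move=> t; rewrite subrr normr0. Qed.

Lemma within_distC (x y : C01S R) e : within_dist x y e -> within_dist y x e.
Proof. by move=> xy t; rewrite distrC. Qed.

Lemma within_distD (x y z : C01S R) e1 e2 :
  within_dist x y e1 -> within_dist y z e2 -> within_dist x z (e1 + e2).
Proof.
move=> xy yz t; rewrite (le_trans (ler_distD (C01S_val y t) _ _))//.
by rewrite rmorphD lerD.
Qed.

Definition lower_semicontinuous (f : C01S R -> R) :=
  forall x e, 0 < e -> \forall y \near x, f x - e <= f y.

Variables (f : C01S R -> R) (M : R).
Hypothesis fM : forall x, `|f x| <= M.

(* Lipschitz inf-convolution, increasing to [f] wherever [f] is lower
   semicontinuous; applied to indicators of open sets it also yields Borel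
   measurability. *)
Definition envelope (k : nat) (x : C01S R) : R :=
  inf [set r | exists y e, [/\ 0 <= e, within_dist x y e & r = f y + k%:R * e]].

Let values k x := [set r | exists y e, [/\ 0 <= e, within_dist x y e & r = f y + k%:R * e]].

Let values0 k x : values k x (f x).
Proof.
by exists x, 0; split=> //; [exact: within_dist_refl|rewrite mulr0 addr0].
Qed.

Let lb_values k x : lbound (values k x) (- M).
Proof.
move=> r [y [e [e0 _ ->]]]; rewrite -[- M]addr0 lerD ?mulr_ge0//.
by have := fM y; rewrite ler_norml => /andP[].
Qed.

Let has_lb k x : has_lbound (values k x). Proof. by exists (- M); exact: lb_values. Qed.

Lemma envelope_le k x : envelope k x <= f x.
Proof. by apply: ge_inf; [exact: has_lb|exact: values0]. Qed.

Lemma envelope_bounded k x : `|envelope k x| <= M.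
Proof.
rewrite ler_norml (le_trans (envelope_le k x)) ?andbT; last first.
  by rewrite (le_trans (ler_norm _)).
by apply: lb_le_inf; [exists (f x); exact: values0|exact: lb_values].
Qed.

Lemma envelope_lipschitz k : path_lipschitz k%:R (envelope k).
Proof.
suff h x y e : 0 <= e -> within_dist x y e -> envelope k x - envelope k y <= k%:R * e.
  move=> x y e e0 xy; rewrite ler_norml h// andbT lerNl opprB h//.
  exact: within_distC.
move=> e0 xy; rewrite lerBlDr addrC -lerBlDr; apply: lb_le_inf.
  by exists (f y); exact: values0.
move=> _ [y' [e' [e'0 yy' ->]]]; rewrite lerBlDr -addrA -mulrDr.
apply: ge_inf; first exact: has_lb.
exists y', (e' + e); split; rewrite ?addr_ge0// addrC; exact: within_distD yy'.
Qed.

Lemma envelope_cvg x : lower_semicontinuous f -> envelope k x @[k --> \oo] --> f x.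
Proof.
move=> lf; apply/cvgrPdist_le => e e0.
have /C01S_nbhsP[dl d0 H] := lf x e e0.
near=> k; rewrite ger0_norm ?subr_ge0 ?envelope_le// lerBlDr addrC -lerBlDr.
apply: lb_le_inf; first by exists (f x); exact: values0.
move=> _ [y [e' [e'0 xy ->]]].
have [ed|de] := ltP e' dl.
  rewrite (le_trans (H y _)) ?lerDl ?mulr_ge0// => t.
  by rewrite (le_lt_trans (xy t))// ltcR.
(* Beyond distance [dl] the penalty is at least [2 * M], the largest possible oscillation of [f]. *)
have kd : 2 * M <= k%:R * dl.
  rewrite -ler_pdivrMr//; near: k; exact: nbhs_infty_ger.
have kd' : k%:R * dl <= k%:R * e' by rewrite ler_wpM2l.
have := fM y; have := fM x; move: kd kd' e0.
rewrite !ler_norml => ? ? ? /andP[? ?] /andP[? ?]; lra.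
Unshelve. all: by end_near. Qed.

End envelope.

Lemma expectationE d (T : measurableType d) (R : realType) (P : probability T R)
    (X : T -> R) (M : R) : measurable_fun setT X -> (forall w, `|X w| <= M) ->
  ('E_P[X])%E = (\int[P]_w X w)%:E.
Proof.
move=> mX XM; rewrite unlock /Rintegral fineK//.
have iX := @bounded_integrable _ T R P _ _ mX XM.
exact: integrable_fin_num iX.
Qed.

Section borel_paths.
Context d (T : measurableType d) (R : realType) (Y : T -> C01S R).
Hypothesis mY : forall F L M, 0 <= L -> path_lipschitz L F -> (forall y, `|F y| <= M) ->
  measurable_fun setT (F \o Y).

Lemma measurable_lower_semicontinuous f M : lower_semicontinuous f ->
  (forall x, `|f x| <= M) -> measurable_fun setT (f \o Y).
Proof.
move=> lf fM; apply: (measurable_fun_cvg (h := fun k => envelope f k \o Y)) => // [k|w _].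
  exact: (mY (ler0n _ k) (envelope_lipschitz fM k) (envelope_bounded fM k)).
exact: (envelope_cvg fM (x := Y w) lf).
Qed.

(** The sets with measurable preimage form a sigma-algebra, and an open set belongs to it because
    its indicator is lower semicontinuous. *)
Lemma borel_measurable_path : borel_measurable Y.
Proof.
apply: smallest_sub; last first.
  move=> U oU; pose f (x : C01S R) : R := \1_U x.
  have lf : lower_semicontinuous f.
    move=> x e e0; rewrite /f indicE; have [xU|xU] := boolP (x \in U).
      have := open_nbhs_nbhs (conj oU (set_mem xU)); apply: filterS => y Uy.
      by rewrite indicE mem_set// lerBlDr lerDl ltW.
    near=> y; rewrite sub0r indicE; apply: (@le_trans _ _ 0); last by case: (y \in U).
    by rewrite oppr_le0 ltW.
  have fM x : `|f x| <= 1 by rewrite /f indicE; case: (x \in U); rewrite ?normr0 ?normr1.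
  have := measurable_lower_semicontinuous lf fM.
  move=> /(_ measurableT [set 1] (measurable_set1 1)); rewrite setTI.
  congr measurable; apply/seteqP; split=> w /=; rewrite /f indicE.
    by case: (boolP (Y w \in U)) => [/set_mem//|_] /eqP; rewrite eq_sym oner_eq0.
  by move=> Uw; rewrite mem_set.
split=> [|A mA|A mA].
- by rewrite preimage_set0.
- by rewrite setTD preimage_setC; exact: measurableC.
- by rewrite preimage_bigcup; exact: bigcup_measurable.
Unshelve. all: by end_near. Qed.

End borel_paths.

Section weak_convergence.
Context d (T : measurableType d) (R : realType) (P : probability T R).
Context d' (T' : measurableType d') (P' : probability T' R).
Variables (Y : nat -> T -> C01S R) (Y' : T' -> C01S R).
Hypothesis mY : forall n F L M, 0 <= L -> path_lipschitz L F -> (forall y, `|F y| <= M) ->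
  measurable_fun setT (F \o Y n).
Hypothesis mY' : forall F L M, 0 <= L -> path_lipschitz L F -> (forall y, `|F y| <= M) ->
  measurable_fun setT (F \o Y').
Hypothesis cY : forall F L M, 0 <= L -> path_lipschitz L F -> (forall y, `|F y| <= M) ->
  \int[P]_w F (Y n w) @[n --> \oo] --> \int[P']_w F (Y' w).

(** One half of a portmanteau argument: an envelope close to [f] in mean under [P'] passes to the
    limit as a Lipschitz functional and stays below [f] under [P]. It is applied to [f] and to
    [- f]. *)
Let liminf_expect f M e : lower_semicontinuous f -> (forall x, `|f x| <= M) -> 0 < e ->
  \forall n \near \oo, \int[P']_w f (Y' w) - e <= \int[P]_w f (Y n w).
Proof.
move=> lf fM e0; have e2 : 0 < e / 2 by rewrite divr_gt0.
have mf' : measurable_fun setT (f \o Y').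
  exact: (@measurable_lower_semicontinuous _ _ _ _ mY' f M lf fM).
have mf n : measurable_fun setT (f \o Y n).
  exact: (@measurable_lower_semicontinuous _ _ _ _ (mY n) f M lf fM).
have EM k := envelope_bounded fM k.
have EL k := envelope_lipschitz fM k.
have c : \int[P']_w envelope f k (Y' w) @[k --> \oo] --> \int[P']_w f (Y' w).
  apply: (@bounded_cvg_expect _ _ _ P' _ _ M) => //.
  - by move=> k; exact: (mY' (ler0n R k) (EL k) (EM k)).
  - by move=> w; exact: (envelope_cvg fM (x := Y' w) lf).
have [k Hk] : exists k, `|\int[P']_w f (Y' w) - \int[P']_w envelope f k (Y' w)| <= e / 2.
  move/cvgrPdist_le : c => /(_ _ e2) [k _ Hk]; exists k; exact: (Hk k (leqnn k)).
have ck := cY (ler0n R k) (EL k) (EM k).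
near=> n.
have h1 : `|\int[P']_w envelope f k (Y' w) - \int[P]_w envelope f k (Y n w)| <= e / 2.
  by near: n; move/cvgrPdist_le : ck; apply.
have h2 : \int[P]_w envelope f k (Y n w) <= \int[P]_w f (Y n w).
  apply: le_expect => [||w]; last exact: envelope_le.
  - apply: (@bounded_integrable _ T R P _ M) => // ; exact: (mY n (ler0n R k) (EL k) (EM k)).
  - by apply: (@bounded_integrable _ T R P _ M) => //; exact: mf.
move: Hk h1 h2; rewrite !ler_norml => /andP[? ?] /andP[? ?] ?; lra.
Unshelve. all: by end_near. Qed.

Lemma weak_cvg_lipschitz : weak_cvg P Y P' Y'.
Proof.
split=> [n||f cf [M fM]].
- exact: (@borel_measurable_path _ _ _ _ (mY n)).
- exact: (@borel_measurable_path _ _ _ _ mY').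
have lf : lower_semicontinuous f.
  move=> x e e0; have /cvgrPdist_le /(_ e e0) := cf x; apply: filterS => y.
  by rewrite ler_norml => /andP[_]; rewrite lerBlDr addrC -lerBlDr.
have lNf : lower_semicontinuous (fun x => - f x).
  move=> x e e0; have /cvgrPdist_le /(_ e e0) := cf x; apply: filterS => y.
  by rewrite ler_norml => /andP[+ _]; lra.
have NfM x : `|- f x| <= M by rewrite normrN.
have mf' : measurable_fun setT (f \o Y').
  exact: (@measurable_lower_semicontinuous _ _ _ _ mY' f M lf fM).
have mf n : measurable_fun setT (f \o Y n).
  exact: (@measurable_lower_semicontinuous _ _ _ _ (mY n) f M lf fM).
under eq_fun do rewrite (expectationE P (mf _) (fun w => fM _)).
rewrite (expectationE P' mf' (fun w => fM _)).
apply: cvg_EFin; first by near=> n.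
apply/cvgrPdist_le => e e0.
have EN n : \int[P]_w (- f (Y n w)) = - \int[P]_w f (Y n w).
  under eq_Rintegral do rewrite -mulN1r.
  rewrite RintegralZl ?mulN1r//; apply: (@bounded_integrable _ T R P _ M) => //; exact: mf.
have EN' : \int[P']_w (- f (Y' w)) = - \int[P']_w f (Y' w).
  under eq_Rintegral do rewrite -mulN1r.
  rewrite RintegralZl ?mulN1r//; apply: (@bounded_integrable _ T' R P' _ M) => //; exact: mf'.
near=> n.
have h1 : \int[P']_w f (Y' w) - e <= \int[P]_w f (Y n w).
  by near: n; exact: liminf_expect lf fM e0.
have h2 : \int[P']_w (- f (Y' w)) - e <= \int[P]_w (- f (Y n w)).
  by near: n; exact: liminf_expect lNf NfM e0.
rewrite EN EN' in h2; rewrite ler_norml; apply/andP; split; move: h1 h2.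
  by rewrite /comp/=; lra.
by rewrite /comp/=; lra.
Unshelve. all: by end_near. Qed.

End weak_convergence.

(** * Weak convergence of the rescaled process *)

Section telegraph_paths.
Context d (T : measurableType d) (R : realType) (P : probability T R).
Context (lambda c : R) (N : R -> T -> nat) (V0 : T -> R).
Hypothesis (lambda0 : 0 < lambda) (c0 : 0 < c).
Hypothesis (hN : poisson_process P lambda N) (mV0 : measurable_fun setT V0).
Hypothesis (hV0 : uniform_pm P c V0) (hV0N : independent_of_process P V0 N).

Lemma dyadic_incr_telegraph a s i k w :
  dyadic_incr (fun t => a * telegraph N V0 (s * t) w) i k =
  a * telegraph_incr N V0 (s / (2 ^ i)%:R) k w.
Proof. by rewrite /dyadic_incr /dyadic /telegraph_incr -mulrBr !(mulrCA s). Qed.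

Lemma telegraph_moment_scaled a h k B : 0 < a -> 0 < h -> 0 <= B ->
  \int[P]_w Num.min ((a * telegraph_incr N V0 h k w) ^+ 4) B <=
  a ^+ 4 * (moment_cst lambda c * h ^+ 2).
Proof.
move=> a0 h0 B0; have a4 : 0 < a ^+ 4 by rewrite exprn_gt0.
have B1 : 0 <= B / a ^+ 4 by rewrite divr_ge0// ltW.
pose g w := Num.min (telegraph_incr N V0 h k w ^+ 4) (B / a ^+ 4).
have ig : P.-integrable setT (EFin \o g).
  apply: (@bounded_integrable _ T R P _ (B / a ^+ 4)) => [|w].
    apply: measurable_minr; last exact: measurable_cst.
    by apply: measurable_funX; exact: (measurable_telegraph_incr hN mV0 k h0).
  have g0 : 0 <= g w by rewrite le_min B1 exprn_even_ge0.
  by rewrite (ger0_norm g0) ge_min lexx orbT.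
rewrite (_ : \int[P]_w _ = \int[P]_w (a ^+ 4 * g w)).
  rewrite (RintegralZl _ measurableT ig) ler_pM2l//.
  exact: (telegraph_moment4_trunc lambda0 c0 hN mV0 hV0 hV0N).
apply: eq_Rintegral => w _; rewrite /g minr_pMr ?(ltW a4)// -exprMn.
by rewrite mulrCA divff ?mulr1// gt_eqF.
Qed.

Lemma rescaled_moment n i k B : 0 <= B ->
  \int[P]_w Num.min (dyadic_incr (fun t =>
    sigma_ lambda c n * telegraph N V0 (n%:R * t) w) i k ^+ 4) B <= 32 / 4 ^+ i.
Proof.
move=> B0; under eq_Rintegral do rewrite dyadic_incr_telegraph.
case: n => [|n].
  (* For [n = 0] the convention that 0 has inverse 0 makes [sigma_] vanish, and the path is
     constant. *)
  under eq_Rintegral do rewrite {1}/sigma_ invr0 mulr0 sqrtr0 mulr0 mul0r expr0n/= (min_idPl B0).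
  by rewrite expect_cst divr_ge0.
have p0 : 0 < (2 ^ i)%:R :> R by rewrite ltr0n expn_gt0.
have n0 : 0 < n.+1%:R :> R by rewrite ltr0n.
have s0 : 0 < sigma_ lambda c n.+1.
  by rewrite mulr_gt0 ?invr_gt0// sqrtr_gt0 divr_gt0.
have h0 : 0 < n.+1%:R / (2 ^ i)%:R :> R by rewrite divr_gt0.
apply: le_trans (telegraph_moment_scaled k s0 h0 B0) _.
have s2 := @sigmaE R lambda c lambda0 c0 n.+1 isT.
rewrite le_eqVlt; apply/orP; left; apply/eqP; rewrite /moment_cst.
rewrite (_ : _ ^+ 4 * _ =
  32 * ((sigma_ lambda c n.+1 * c) ^+ 2 / lambda * n.+1%:R / (2 ^ i)%:R) ^+ 2).
  rewrite s2 (_ : lambda / n.+1%:R / lambda * n.+1%:R = 1); last first.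
    by field; rewrite nat1r !gt_eqF.
  by rewrite mul1r exprVn natrX -exprM mulnC exprM -natrX.
by field; rewrite ?nat1r !gt_eqF.
Qed.

Lemma measurable_rescaled n t : 0 <= t ->
  measurable_fun setT (fun w => sigma_ lambda c n * telegraph N V0 (n%:R * t) w).
Proof.
move=> t0; apply: measurable_funM => //; apply: (measurable_telegraph hN mV0).
by rewrite mulr_ge0.
Qed.

Context d' (T' : measurableType d') (P' : probability T' R) (B : R -> T' -> R).
Hypothesis hB : brownian_motion P' B.

Lemma brownian_moment i k C : 0 <= C ->
  \int[P']_w Num.min (dyadic_incr (B ^~ w) i k ^+ 4) C <= normal4 R / 4 ^+ i.
Proof.
move=> C0; have p0 : 0 < (2 ^ i)%:R :> R by rewrite ltr0n expn_gt0.
pose s : R := k%:R / (2 ^ i)%:R; pose t : R := k.+1%:R / (2 ^ i)%:R.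
have s0 : 0 <= s :> R by rewrite divr_ge0// ltW.
have st : s < t :> R by rewrite ltr_pM2r ?invr_gt0// ltr_nat.
have tsE : t - s = (2 ^ i)%:R^-1 :> R by rewrite /t /s -natr1; ring.
set sd := Num.sqrt (t - s); have sd0 : 0 < sd by rewrite sqrtr_gt0 subr_gt0.
have mf : measurable_fun setT (fun y : R => Num.min (y ^+ 4) C).
  by apply: measurable_minr; [exact: measurable_funX|exact: measurable_cst].
have fC (y : R) : `|Num.min (y ^+ 4) C| <= C.
  have g0 : 0 <= Num.min (y ^+ 4) C by rewrite le_min C0 exprn_even_ge0.
  by rewrite (ger0_norm g0) ge_min lexx orbT.
have mBst : measurable_fun setT (fun w => B t w - B s w).
  apply: measurable_funB; apply: (brownian_motion_meas hB) => //.
  exact: le_trans (ltW st).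
have lBst (A : set R) (mA : measurable A) := brownian_motion_law hB s0 st mA.
rewrite [leLHS](expect_law (nu := normal_prob 0 sd) mBst lBst mf fC).
apply: le_trans (_ : \int[normal_prob 0 sd]_y (y ^+ 4) <= _).
  apply: (@le_expect _ _ R (normal_prob 0 sd)) => [||y].
  - exact: (@bounded_integrable _ _ R (normal_prob 0 sd) _ C).
  - exact: normal_integrable_pow.
  - by rewrite ge_min lexx.
apply: le_trans (normal_moment4 sd0) _.
rewrite -/(normal4 R) (_ : sd ^+ 4 = (4 ^+ i)^-1)//.
rewrite (_ : sd ^+ 4 = (sd ^+ 2) ^+ 2); last by rewrite -exprM.
rewrite sqr_sqrtr ?subr_ge0 ?(ltW st)// tsE exprVn; congr (_^-1).
by rewrite natrX -exprM mulnC exprM; congr (_ ^+ i); ring.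
Qed.

(** At a level [m] given by the chaining bounds, both processes are within [e / 3] in expectation of
    their interpolations, for every [n]. The interpolated functional reads [2 ^ m] increments, so
    finite-dimensional convergence provides the last third. *)
Lemma weak_cvg_telegraph (z : circle R) :
  weak_cvg P (rescaled_circular_telegraph hN V0 c z) P' (circular_brownian hB z).
Proof.
pose X n w t := sigma_ lambda c n * telegraph N V0 (n%:R * t) w.
have X0 n w : X n w 0 = 0 by rewrite /X mulr0 telegraph0 mulr0.
have B0 w : B 0 w = 0 by exact: (brownian_motion0 hB).
pose cX n w : continuous (fun t : I01 R => X n w (\val t)) :=
  @scaled_telegraph_continuous _ _ _ _ _ _ hN V0 (sigma_ lambda c n) n w.
pose cB w := @brownian_motion_continuous01 _ _ _ _ _ hB w.
have mX n t : 0 <= t -> t <= 1 -> measurable_fun setT ((X n) ^~ t).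
  by move=> t0 _; exact: measurable_rescaled.
have mB t : 0 <= t -> t <= 1 -> measurable_fun setT (fun w => B t w).
  by move=> t0 _; exact: (brownian_motion_meas hB).
have hX n i k C : (k < 2 ^ i)%N -> 0 <= C ->
    \int[P]_w Num.min (dyadic_incr (X n w) i k ^+ 4) C <= 32 / 4 ^+ i.
  by move=> _; exact: rescaled_moment.
have hBm i k C : (k < 2 ^ i)%N -> 0 <= C ->
    \int[P']_w Num.min (dyadic_incr (B ^~ w) i k ^+ 4) C <= normal4 R / 4 ^+ i.
  by move=> _; exact: brownian_moment.
have n4 : 0 <= normal4 R by rewrite mulr_ge0// expR_ge0.
have t4 : 0 <= 32 :> R by [].
apply: weak_cvg_lipschitz => [n F L M L0 FL FM|F L M L0 FL FM|F L M L0 FL FM].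
- exact: (measurable_path z (x := X n) (X0 n) (cX n) (mX n) L0 FL).
- exact: (measurable_path z (x := fun w t => B t w) B0 cB mB L0 FL).
apply/cvgrPdist_le => e e0; have e3 : 0 < e / 3 by rewrite divr_gt0.
pose C := 2 * L * (8 * (1 + (32 + normal4 R))).
have [m Hm] : exists m, C * (7 / 8) ^+ m <= e / 3.
  have : C * (7 / 8) ^+ m @[m --> \oo] --> (0 : R).
    rewrite -[X in _ --> X](mulr0 C); apply: cvgM; first exact: cvg_cst.
    by apply: cvg_expr; rewrite ger0_norm; lra.
  move=> /cvgrPdist_le /(_ _ e3) [m _ Hm]; exists m.
  by have := Hm m (leqnn m); rewrite /= sub0r normrN; apply: le_trans; exact: ler_norm.
have L2 : 0 <= 2 * L by rewrite mulr_ge0.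
have r0 : 0 <= (7 / 8 : R) ^+ m by rewrite exprn_ge0.
have Xm n := expect_interp_dist z t4 (X0 n) (cX n) (mX n) (hX n) L0 FL FM m.
have Bm := expect_interp_dist z (x := fun w t => B t w) n4 B0 cB mB hBm L0 FL FM m.
have Xe : 2 * L * (8 * (1 + 32) * (7 / 8) ^+ m) <= e / 3.
  rewrite (le_trans _ Hm)// /C -[leRHS]mulrA ler_wpM2l// ler_wpM2r//; lra.
have Be : 2 * L * (8 * (1 + normal4 R) * (7 / 8) ^+ m) <= e / 3.
  rewrite (le_trans _ Hm)// /C -[leRHS]mulrA ler_wpM2l// ler_wpM2r//; lra.
pose h : R := (2 ^ m)%:R^-1.
have h0 : 0 < h by rewrite invr_gt0 ltr0n expn_gt0.
pose G (u : nat -> R) := F (interp_path z (2 ^ m) u).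
have GL : coord_lipschitz (2 ^ m) L G := path_lipschitz_interp z (2 ^ m)%N FL.
have GM u : `|G u| <= M by exact: FM.
have cG := cvg_finite_dimensional lambda0 c0 hN mV0 hV0 hV0N hB h0 L0 GL GM.
near=> n.
have Hn : `|\int[P']_w G (dyadic_incr (B ^~ w) m) - \int[P]_w G (dyadic_incr (X n w) m)| <= e / 3.
  rewrite (_ : \int[P]_w _ = \int[P]_w G (scaled_incr lambda c N V0 h n w)).
    by near: n; move/cvgrPdist_le : cG; apply.
  apply: eq_Rintegral => w _; congr G; apply/funext => k.
  exact: dyadic_incr_telegraph.
move: (Xm n) Bm Hn Xe Be; rewrite /=.
set a := \int[P]_w F _; set b := \int[P]_w F _; set a' := \int[P']_w F _; set b' := \int[P']_w F _.
rewrite -/a -/b -/a' -/b'.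
rewrite !ler_norml => /andP[? ?] /andP[? ?] /andP[? ?] ? ?; apply/andP; split; lra.
Unshelve. all: by end_near. Qed.

End telegraph_paths.

(** * The strong law *)

Section borel_cantelli.
Context d (T : measurableType d) (R : realType) (P : probability T R).

Lemma ae_cvg0 (f : nat -> T -> R) (C q : R) : 0 <= q -> q < 1 ->
  (forall k w, 0 <= f k w) -> (forall k, P.-integrable setT (EFin \o f k)) ->
  (forall k, \int[P]_w f k w <= C * q ^+ k) ->
  {ae P, forall w, f k w @[k --> \oo] --> (0 : R)}.
Proof.
move=> q0 q1 f0 fi fC.
have mf k : measurable_fun setT (fun w => (f k w)%:E) by exact: measurable_int (fi k).
pose S w := (\sum_(k <oo) (f k w)%:E)%E.
have S0 w : (0 <= S w)%E by apply: nneseries_ge0 => k _ _; rewrite lee_fin.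
have f0' k w : setT w -> xpredT k -> (0 <= (f k w)%:E)%E by rewrite lee_fin.
have mS : measurable_fun setT S by exact: (ge0_emeasurable_sum f0').
have C0 : 0 <= C.
  have := fC 0%N; rewrite expr0 mulr1; apply: le_trans.
  by apply: Rintegral_ge0 => w _; exact: f0.
have SC : (\int[P]_w S w <= (C / (1 - q))%:E)%E.
  rewrite integral_nneseries//; last by move=> k w _; rewrite lee_fin.
  apply: lime_le.
    by apply: is_cvg_nneseries => k _ _; apply: integral_ge0 => w _; rewrite lee_fin.
  near=> n; apply: (@le_trans _ _ (\sum_(0 <= k < n) (C * q ^+ k)%:E)%E).
    apply: lee_sum => k _; rewrite -[leLHS]fineK ?lee_fin; first exact: fC.
    exact: integrable_fin_num (fi k).
  rewrite sumEFin lee_fin -mulr_sumr; apply: ler_wpM2l => //.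
  have q1' : 0 < 1 - q by rewrite subr_gt0.
  rewrite -(ler_pM2l q1') divff ?gt_eqF// big_mkord -[1 - q]opprB mulNr -subrX1 opprB.
  by rewrite gerBl exprn_ge0.
have Si : P.-integrable setT S.
  apply/integrableP; split=> //.
  under eq_integral do rewrite gee0_abs//.
  by rewrite (le_lt_trans SC)// ltry.
have := integrable_ae measurableT Si; apply: filterS => w /(_ Logic.I) Sfin.
apply: cvg_series_cvg_0; apply: nondecreasing_is_cvgn.
  by apply/nondecreasing_seqP => n; rewrite seriesSr lerDl.
exists (fine (S w)) => _ [n _ <-].
rewrite -lee_fin fineK// /series/= -sumEFin.
by apply: (nneseries_lim_ge (P := xpredT)) => k _ _; rewrite lee_fin.
Unshelve. all: by end_near. Qed.

End borel_cantelli.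

Section strong_law.
Context d (T : measurableType d) (R : realType) (P : probability T R).
Context (lambda c : R) (N : R -> T -> nat) (V0 : T -> R).
Hypothesis (lambda0 : 0 < lambda) (c0 : 0 < c).
Hypothesis (hN : poisson_process P lambda N) (mV0 : measurable_fun setT V0).
Hypothesis (hV0 : uniform_pm P c V0) (hV0N : independent_of_process P V0 N).
Notation X := (telegraph N V0).

Lemma telegraph_lipschitz s t w : 0 <= s -> s <= t ->
  `|X t w - X s w| <= `|V0 w| * (t - s).
Proof.
move=> s0 st; have iV := velocity_integrable hN V0 w t.
rewrite /telegraph Rintegral_itvB ?bnd_simp//.
have iV' : lebesgue_measure.-integrable `]s, t]
    (EFin \o (velocity N V0 ^~ w : measurableTypeR R -> R)).
  apply: integrableS iV => //; apply: subset_itvr; by rewrite bnd_simp.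
have leb : lebesgue_measure (`]s, t]%classic : set R) = (t - s)%:E.
  rewrite lebesgue_measure_itv/= lte_fin; case: ltP => // ts.
  by rewrite (_ : t = s) ?subrr//; apply/le_anti; rewrite ts st.
have icst a : lebesgue_measure.-integrable (`]s, t]%classic : set R) (EFin \o cst a).
  apply: measurable_bounded_integrable => //.
    by rewrite [ltLHS]leb ltry.
  exact: bounded_cst.
apply: le_trans (le_normr_Rintegral _ iV') _ => //.
rewrite [leRHS](_ : _ = \int[lebesgue_measure]_(_ in (`]s, t]%classic : set R)) `|V0 w|).
  apply: le_Rintegral => //; first exact: (integrable_norm iV').
    exact: icst.
  by move=> u _; rewrite /velocity normrM normrX normrN1 expr1n mulr1.
by rewrite Rintegral_cst//= [lebesgue_measure _]leb.
Qed.

(** Diffusive rescaling of [X] from [[0, 4 ^ k]] to [[0, 1]]; the fourth moments at dyadic level [i]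
    are at most [C / 4 ^ i] for every [k]. *)
Let block k w (t : R) : R := 2 ^- k * X ((4 ^+ k) * t) w.

Let z k i j w := dyadic_incr (block k w) i j.

Let zE k i j w : z k i j w = 2 ^- k * telegraph_incr N V0 (4 ^+ k / (2 ^ i)%:R) j w.
Proof. exact: dyadic_incr_telegraph. Qed.

Let C : R := moment_cst lambda c.

Let C0 : 0 <= C. Proof. exact: moment_cst_ge0. Qed.

Let h_gt0 k i : 0 < 4 ^+ k / (2 ^ i)%:R :> R.
Proof. by rewrite divr_gt0 ?exprn_gt0// ltr0n expn_gt0. Qed.

Let mz k i j : measurable_fun setT (z k i j).
Proof.
rewrite (_ : z k i j = fun w => 2 ^- k * telegraph_incr N V0 (4 ^+ k / (2 ^ i)%:R) j w).
  by apply: measurable_funM => //; exact: (measurable_telegraph_incr hN mV0).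
by apply/funext => w; exact: zE.
Qed.

Let hz k i j B : (j < 2 ^ i)%N -> 0 <= B ->
  \int[P]_w Num.min (z k i j w ^+ 4) B <= C / 4 ^+ i.
Proof.
move=> _ B0; under eq_Rintegral do rewrite zE.
have k0 : 0 < 2 ^- k :> R by rewrite invr_gt0 exprn_gt0.
apply: le_trans (telegraph_moment_scaled lambda0 c0 hN mV0 hV0 hV0N j k0 (h_gt0 k i) B0) _.
rewrite le_eqVlt; apply/orP; left; apply/eqP; rewrite -/C natrX.
have -> : (4 : R) = 2 ^+ 2 by ring.
rewrite -!exprM -!exprVn -!exprM exprMn -!exprM mulrCA; congr (C * _).
rewrite mulrA (_ : k * 4 = 2 * k * 2)%N; last by rewrite mulnAC mulnC.
by rewrite -exprMn mulVf// expr1n mul1r mulnC.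
Qed.

(** Level [2 * k] is the one whose cells have unit length in the time of [X]. *)
Let G k w := \sum_(i < (k.*2).+1) level_bound (z k) (0 + i) w.

Let G0 k w : 0 <= G k w.
Proof. by apply: sumr_ge0 => i _; exact: level_bound_ge0. Qed.

(** The chain joins 0 to the integer part of [t]; the rest of the unit cell is crossed at speed at
    most [|V0|]. *)
Let telegraph_le_block k t w : 0 <= t -> t < 4 ^+ k -> `|X t w| <= 2 ^+ k * G k w + `|V0 w|.
Proof.
move=> t0 t4; set K := Num.truncn t.
have /andP[h1 h2] := truncn_itv t0; rewrite -/K in h1 h2.
have p0 : 0 < 2 ^+ k :> R by rewrite exprn_gt0.
have e4 : (2 ^ (0 + k.*2))%:R = 4 ^+ k :> R.
  rewrite add0n -mul2n natrX exprM; congr (_ ^+ k); ring.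
have Kp : (K < 2 ^ (0 + k.*2))%N by rewrite -(ltr_nat R) (le_lt_trans h1)// e4.
have W0 i : 0 <= level_bound (z k) i w by exact: level_bound_ge0.
have Wz i j : (0 < i)%N -> (j < 2 ^ i)%N ->
    `|dyadic (block k w) i j.+1 - dyadic (block k w) i j| <= level_bound (z k) i w.
  by move=> _; exact: (le_level_bound (z k) w).
have := dyadic_chain (dyadic_double (block k w)) Wz W0 (ltnW Kp).
rewrite -[in (K %/ _)%N](add0n k.*2) divn_small// /dyadic mul0r e4.
rewrite /block mulr0 telegraph0 mulr0 subr0 mulrCA divff ?expf_neq0// mulr1.
rewrite normrM ger0_norm ?invr_ge0 ?(ltW p0)// mulrC ler_pdivrMr// mulrC => XK.
have GW : \sum_(i < k.*2) level_bound (z k) (0 + i).+1 w <= G k w.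
  by rewrite /G big_ord_recl lerDr.
have XtK : `|X t w - X K%:R w| <= `|V0 w|.
  apply: le_trans (telegraph_lipschitz w _ h1) _ => //.
  by rewrite ler_piMr// lerBlDr nat1r ltW.
rewrite -[X t w](subrK (X K%:R w)) addrC (le_trans (ler_normD _ _))// lerD//.
by rewrite (le_trans XK)// ler_pM2l.
Qed.

Variables (theta p : R).
Hypotheses (p1 : 1 <= p) (p2 : p < 2).

Let a := p^-1.

Let a_half : 2^-1 < a.
Proof. by have p0 := lt_le_trans ltr01 p1; rewrite /a ltf_pV2 ?posrE. Qed.

(** Factor by which [t] to the power [- 1 / p] shrinks when [t] is multiplied by 4; [2 * b < 1]
    expresses [p < 2]. *)
Let b : R := 4 `^ (- a).

Let b0 : 0 < b. Proof. by rewrite powR_gt0. Qed.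

Let b_half : 2 * b < 1.
Proof.
rewrite /b powRN ltr_pdivrMr ?powR_gt0// mul1r.
have ah : 0 < a - 2^-1 by rewrite subr_gt0.
rewrite -[a](subrK (2^-1)) addrC powRD; last by apply/implyP.
have -> : 4 `^ (2^-1) = 2 :> R.
  rewrite powR12_sqrt// (_ : 4 = 2 ^+ 2); last by ring.
  by rewrite sqrtr_sqr ger0_norm.
have one : 1 `^ (a - 2^-1) = 1 :> R by rewrite powR1.
rewrite ltr_pMr// -[ltLHS]one.
by apply: gt0_ltr_powR; rewrite ?nnegrE//; lra.
Qed.

Let powR4 k : (4 ^+ k) `^ (- a) = b ^+ k.
Proof. by rewrite -powR_mulrn// -powRrM mulrC powRrM powR_mulrn// ltW. Qed.

Lemma telegraph_slln :
  {ae P, forall w, t `^ (- a) * (theta + X t w) @[t --> +oo] --> (0 : R)}.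
Proof.
(* For [t] between [4 ^ k] and [4 ^ (k + 1)] the power of [t] is at most [b ^ k], while [|X t|] is
   at most [2 ^ (k + 1) * G (k + 1)] plus [|V0|]: the product is at most [2 * f k] plus a multiple
   of [b ^ k]. *)
pose f k w := (2 * b) ^+ k * G k.+1 w.
have q0 : 0 <= 2 * b by rewrite mulr_ge0// ltW.
have EG k : P.-integrable setT (EFin \o G k) /\ \int[P]_w G k w <= 8 * (1 + C) * (7 / 8) ^+ 0.
  exact: (expect_level_sum C0 (mz k) (@hz k) 0 (k.*2).+1).
have fi k : P.-integrable setT (EFin \o f k).
  have := integrableZl measurableT ((2 * b) ^+ k) (EG k.+1).1.
  by apply: eq_integrable => // w _.
have := @ae_cvg0 _ T R P f (8 * (1 + C)) (2 * b) q0 b_half _ fi _.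
have f0 k w : 0 <= f k w by rewrite mulr_ge0 ?exprn_ge0.
move=> /(_ f0) H; have {}H := H _; apply: filterS (H _) => [w fw|k]; last first.
  rewrite (RintegralZl _ measurableT (EG k.+1).1) mulrC.
  by apply: ler_wpM2r; rewrite ?exprn_ge0// (le_trans (EG k.+1).2)// expr0 mulr1.
apply/cvgrPdist_le => e e0.
have e4 : 0 < e / 4 by rewrite divr_gt0.
have bk : (`|theta| + `|V0 w|) * b ^+ k @[k --> \oo] --> (0 : R).
  rewrite -[X in _ --> X](mulr0 (`|theta| + `|V0 w|)); apply: cvgM; first exact: cvg_cst.
  by apply: cvg_expr; rewrite ger0_norm ?(ltW b0)//; have b0' := b0; have bh := b_half; lra.
have [k0 Hk0] : exists k0, forall k, (k0 <= k)%N ->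
    f k w <= e / 4 /\ (`|theta| + `|V0 w|) * b ^+ k <= e / 4.
  have /cvgrPdist_le /(_ _ e4) [k1 _ h1] := fw.
  have /cvgrPdist_le /(_ _ e4) [k2 _ h2] := bk.
  exists (maxn k1 k2) => k; rewrite geq_max => /andP[kk1 kk2]; split.
    by have := h1 k kk1; rewrite /= sub0r normrN; apply: le_trans; exact: ler_norm.
  by have := h2 k kk2; rewrite /= sub0r normrN; apply: le_trans; exact: ler_norm.
near=> t.
have t4 : 4 ^+ k0 <= t by near: t; apply: nbhs_pinfty_ge; exact: num_real.
have p4 j : 0 < 4 ^+ j :> R by rewrite exprn_gt0.
have t0 : 0 <= t by rewrite (le_trans _ t4)// ltW.
have /andP[h1 h2] := truncn_itv t0; set K := Num.truncn t in h1 h2.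
have k4K : (4 ^ k0 <= K)%N by rewrite truncn_ge_nat// natrX.
have K0 : (0 < K)%N by rewrite (leq_trans _ k4K)// expn_gt0.
(* The scale [k] with [4 ^ k <= t < 4 ^ (k + 1)] is read off the integer part of [t]. *)
have /andP[k1 k2] := @trunc_log_bounds 4 K isT K0.
set k := trunc_log 4 K in k1 k2.
have kk0 : (k0 <= k)%N by rewrite trunc_log_max.
have tk : 4 ^+ k <= t by rewrite (le_trans _ h1)// -natrX ler_nat.
have tk1 : t < 4 ^+ k.+1 by rewrite (lt_le_trans h2)// -natrX ler_nat.
have tb : t `^ (- a) <= b ^+ k.
  have tp := lt_le_trans (p4 k) tk.
  rewrite -powR4 !powRN lef_pV2 ?posrE ?powR_gt0//.
  have a0 : 0 <= a by have ah := a_half; lra.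
  by apply: ge0_ler_powR => //; rewrite nnegrE// ltW.
have [fk bk'] := Hk0 k kk0.
have Xt := telegraph_le_block w t0 tk1.
rewrite sub0r normrN normrM ger0_norm ?powR_ge0//.
apply: (@le_trans _ _ (b ^+ k * (2 ^+ k.+1 * G k.+1 w + (`|theta| + `|V0 w|)))).
  apply: ler_pM => //; first exact: powR_ge0.
  by rewrite (le_trans (ler_normD _ _))// [leRHS]addrCA lerD2l.
have -> : b ^+ k * (2 ^+ k.+1 * G k.+1 w + (`|theta| + `|V0 w|)) =
    2 * f k w + (`|theta| + `|V0 w|) * b ^+ k.
  by rewrite /f exprMn exprS; ring.
move: fk bk' e0; lra.
Unshelve. all: by end_near. Qed.

Lemma circular_telegraph_slln : {ae P, forall w,
  circular_telegraph_pow N V0 theta (t `^ (- a)) t w @[t --> +oo] --> (1 : R[i]^o)}.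
Proof.
apply: filterS telegraph_slln => w h.
have -> : (1 : R[i]^o) = expi (0 : R) by rewrite /expi cos0 sin0.
exact: (cvg_comp _ _ h (@expi_continuous R 0)).
Qed.

End strong_law.

Theorem theorem6 (R : realType) (lambda c : R)
    (hlambda : 0 < lambda) (hc : 0 < c)
    (d : measure_display) (T : measurableType d) (P : probability T R)
    (N : R -> T -> nat) (hN : poisson_process P lambda N)
    (V0 : {RV P >-> R}) (hV0 : uniform_pm P c V0)
    (hV0N : independent_of_process P V0 N) :
  (forall theta p : R, 1 <= p -> p < 2 ->
    {ae P, forall w,
      circular_telegraph_pow N V0 theta (t `^ (- p^-1)) t w
        @[t --> +oo] --> (1 : R[i]^o)}) /\
  (forall (z : circle R)
      (d' : measure_display) (T' : measurableType d') (P' : probability T' R)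
      (B : R -> T' -> R) (hB : brownian_motion P' B),
    weak_cvg P (rescaled_circular_telegraph hN V0 c z)
             P' (circular_brownian hB z)).
Proof.
have mV0 : measurable_fun setT V0 by exact: measurable_funPT.
split=> [theta p p1 p2|z d' T' P' B hB].
  exact: (circular_telegraph_slln hlambda hc hN mV0 hV0 hV0N theta p1 p2).
exact: (weak_cvg_telegraph hlambda hc hN mV0 hV0 hV0N hB z).
Qed.
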